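(* Let $\Gamma\subset\mathbb{R}$ be a closed bounded set of Lebesgue measure zero, let $\mu$ be a Radon measure (finite positive regular Borel measure) whose support is $\Gamma$, and let $\beta:\Gamma\to\mathbb{R}$ be absolutely integrable with respect to $\mu$ and assume negative values on an infinite number of subsets of $\Gamma$. Then the Schrödinger operator $L_{\Gamma,\beta}$ with $\delta'$-interaction on $\Gamma$ of intensity $\beta$ is a self-adjoint operator on $L_2(\mathbb{R})$ and has an infinite number of negative eigenvalues $\lambda_n\to-\infty$.
   Context: Let $\Gamma,\mu,\beta$ be as in the claim. The space $W_2^2(\mathbb{R}\setminus\Gamma;d\mu)$: it consists of all $\psi$ in the Sobolev space $W_2^2(\mathbb{R}\setminus\Gamma)$ (with $\psi,\psi'$ taken continuous on $\mathbb{R}\setminus\Gamma$) for which there are $\mu$-integrable functions $f,g$ on $\Gamma$ such that for all $s<x$ in $\mathbb{R}\setminus\Gamma$ $$\psi(x)=\psi(s)+\int_s^x\psi'(\xi)\,d\xi+\int_{(s,x)}f(\xi)\,\mu(d\xi),\qquad \psi'(x)=\psi'(s)+\int_s^x\psi''(\xi)\,d\xi+\int_{(s,x)}g(\xi)\,\mu(d\xi).$$ One writes $\frac{d\psi}{d\mu}=f$, $\frac{d\psi'}{d\mu}=g$, and on $\Gamma$ sets $\psi_r'(x)=\frac12[\psi'(x+0)+\psi'(x-0)]$. The operator $L_{\Gamma,\beta}$: its domain is the set of all $\psi\in W_2^2(\mathbb{R}\setminus\Gamma;d\mu)$ satisfying $$\frac{d\psi'}{d\mu}(x)=0,\qquad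 \frac{d\psi}{d\mu}(x)=\beta(x)\,\psi_r'(x),\qquad x\in\Gamma$$ (as equalities $\mu$-almost everywhere), and $L_{\Gamma,\beta}\psi(x)=-\psi''(x)$ for $x\notin\Gamma$. The function $\beta$ is said to assume negative values on an infinite number of subsets of $\Gamma$ if for every natural number $N$ there exist $\varepsilon>0$ and pairwise disjoint closed measurable subsets $\Gamma_1,\dots,\Gamma_N\subset\Gamma$ with $\mu(\Gamma_k)>0$ such that $\beta(x)\le-\varepsilon$ for all $x\in\Gamma_k$, $k=1,\dots,N$. *)

(* Defs.v *)
(* MathComp-Analysis; complex numbers are R[i] from mathcomp-real-closed. *)
From HB Require Import structures.
From mathcomp Require Import all_boot all_order all_algebra.
From mathcomp Require Import all_classical all_reals all_analysis.
From mathcomp Require Import complex.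

Set Implicit Arguments.
Unset Strict Implicit.
Unset Printing Implicit Defensive.

Import Order.TTheory GRing.Theory Num.Theory.
Import numFieldNormedType.Exports.

Local Open Scope classical_set_scope.
Local Open Scope ring_scope.
Local Open Scope complex_scope.

(* Measurability, continuity, integrability, integrals and one-sided limits of
   complex-valued functions are componentwise. *)
Section ComplexValued.
Context {R : realType}.
Local Notation Borel := (measurableTypeR R).
Implicit Types (mu : {measure set Borel -> \bar R}) (D : set R) (u : R -> R[i]).

Definition re_part u : R -> R := fun x => complex.Re (u x).
Definition im_part u : R -> R := fun x => complex.Im (u x).

Definition cmeasurable D u :=
  measurable_fun (D : set Borel) (re_part u : Borel -> R) /\
  measurable_fun (D : set Borel) (im_part u : Borel -> R).

Definition ccontinuous D u :=
  {within D, continuous (re_part u)} /\ {within D, continuous (im_part u)}.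

Definition cintegrable mu D u :=
  mu.-integrable D (EFin \o re_part u) /\
  mu.-integrable D (EFin \o im_part u).

Definition cintegral mu D u : R[i] :=
  (\int[mu]_(x in D) re_part u x) +i* (\int[mu]_(x in D) im_part u x).

Definition clim (F : set_system R) u : R[i] :=
  lim (re_part u @ F) +i* lim (im_part u @ F).

End ComplexValued.

Section L2.
Context {R : realType}.
Local Notation leb := (@lebesgue_measure R).
Implicit Types (D : set R) (u v w h : R -> R[i]).

Definition sqnorm (z : R[i]) : R := complex.Re z ^+ 2 + complex.Im z ^+ 2.

Definition L2norm2 D u : \bar R := (\int[leb]_(x in D) (sqnorm (u x))%:E)%E.

(* Elements of L_2(D) are represented by functions whose values outside D are
   irrelevant; two representatives are identified by [eqL2]. *)
Definition L2 D u := cmeasurable D u /\ (L2norm2 D u < +oo)%E.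

Definition eqL2 u v := {ae leb, forall x, u x = v x}.

Definition L2dot u v : R[i] := cintegral leb setT (fun x => u x * (v x)^*).

(* An unbounded operator on L_2(R) is given by its graph, a relation between
   representatives. *)
Implicit Types T : (R -> R[i]) -> (R -> R[i]) -> Prop.

Definition densely_defined T :=
  forall h, L2 setT h -> forall e : R, 0 < e ->
    exists u v, T u v /\ (L2norm2 setT (fun x => (h x - u x)%R) < e%:E)%E.

Definition adjoint T v w :=
  [/\ L2 setT v, L2 setT w & forall u Tu, T u Tu -> L2dot Tu v = L2dot u w].

(* Density of the domain makes [adjoint T], hence a self-adjoint T, linear and
   single-valued up to [eqL2]. *)
Definition selfadjoint T :=
  densely_defined T /\ forall u v, T u v <-> adjoint T u v.

Definition op_eigenvalue T (z : R[i]) :=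
  exists u, T u (fun x => z * u x) /\ ~ eqL2 u (fun=> 0).

End L2.

Section Sobolev.
Context {R : realType}.
Local Notation leb := (@lebesgue_measure R).
Implicit Types (D : set R) (u v psi : R -> R[i]).

Definition test_function D (phi : R -> R) :=
  [/\ forall n x, derivable (phi^`(n)%classic) x 1,
      compact (closure [set x | phi x != 0]) &
      closure [set x | phi x != 0] `<=` D].

Definition weak_derivative D u v :=
  forall phi, test_function D phi ->
    cintegral leb D (fun x => u x * (phi^`()%classic x)%:C) =
    - cintegral leb D (fun x => v x * (phi x)%:C).

(* psi is in W_2^2(D), with first and second derivatives psi1 and psi2, where
   psi and psi1 are the continuous representatives. *)
Definition sobolev22 D psi psi1 psi2 :=
  [/\ L2 D psi, L2 D psi1 & L2 D psi2] /\
  [/\ weak_derivative D psi psi1, weak_derivative D psi1 psi2,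
      ccontinuous D psi & ccontinuous D psi1].

End Sobolev.

Section DeltaPrime.
Context {R : realType}.
Local Notation Borel := (measurableTypeR R).
Local Notation leb := (@lebesgue_measure R).
Implicit Types (mu : {finite_measure set Borel -> \bar R}) (G : set R).
Implicit Types (beta : R -> R) (u v psi f g : R -> R[i]).

Definition regular_measure mu := forall A : set Borel, measurable A ->
  mu A = ereal_inf [set mu U | U in [set U : set R | open U /\ A `<=` U]] /\
  mu A = ereal_sup [set mu K | K in [set K : set R | compact K /\ K `<=` A]].

Definition measure_support mu : set R :=
  [set x | forall U : set R, open U -> U x -> (0 < mu U)%E].

(* u' and f are the densities du/dx and du/dmu: between points of R \ G,
   u(x) - u(s) = \int_s^x u' + \int_(s,x) f dmu.  Since u' lives on R \ G and f
   on G, with G Lebesgue-null and mu carried by G, the domains of integration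
   are restricted accordingly. *)
Definition mu_increments G mu u u' f :=
  forall s x : R, ~ G s -> ~ G x -> s < x ->
    u x = u s + cintegral leb (`]s, x[ `\` G) u' + cintegral mu (`]s, x[ `&` G) f.

(* psi is in W_2^2(R \ G; dmu), with f = dpsi/dmu and g = dpsi'/dmu. *)
Definition sobolev22_mu G mu psi psi1 psi2 f g :=
  [/\ sobolev22 (~` G) psi psi1 psi2,
      cintegrable mu G f /\ cintegrable mu G g,
      mu_increments G mu psi psi1 f & mu_increments G mu psi1 psi2 g].

Definition right_lim G u x : R[i] := clim (within (~` G) x^'+) u.
Definition left_lim G u x : R[i] := clim (within (~` G) x^'-) u.

(* (u(x+0) + u(x-0)) / 2 for x in G *)
Definition reg_value G u x : R[i] :=
  (2^-1)%:C * (right_lim G u x + left_lim G u x).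

(* Graph of the operator -d^2/dx^2 with delta'-interaction on G of intensity
   beta; G being Lebesgue-null, L_2(R \ G) and L_2(R) are identified. *)
Definition delta_prime_op G mu beta u v :=
  [/\ L2 setT u, L2 setT v &
    exists psi psi1 psi2 f g,
      [/\ sobolev22_mu G mu psi psi1 psi2 f g,
          {ae mu, forall x, G x -> g x = 0},
          {ae mu, forall x, G x -> f x = (beta x)%:C * reg_value G psi1 x},
          eqL2 u psi & eqL2 v (fun x => - psi2 x)]].

Definition negative_on_infinitely_many G mu beta :=
  forall N : nat, exists (eps : R) (Gk : 'I_N -> set R),
    [/\ 0 < eps, trivIset setT Gk &
      forall k, [/\ closed (Gk k), measurable (Gk k : set Borel), Gk k `<=` G,
                    (0 < mu (Gk k))%E & forall x, Gk k x -> beta x <= - eps]].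

End DeltaPrime.

(* Main.v *)
Require Import Defs.
From HB Require Import structures.
From mathcomp Require Import all_boot all_order all_algebra.
From mathcomp Require Import all_classical all_reals all_analysis.
From mathcomp Require Import measurable_realfun ring lra complex.

Set Implicit Arguments.
Unset Strict Implicit.
Unset Printing Implicit Defensive.

Import Order.TTheory GRing.Theory Num.Theory.
Import numFieldNormedType.Exports.
Local Open Scope classical_set_scope.
Local Open Scope ring_scope.

(** A function psi in the domain of the operator has a quasi-derivative Phi:
    psi' = Phi off Gamma and dpsi/dmu = beta Phi on Gamma, where Phi is
    continuous because dpsi'/dmu = 0.  With the signed measure
    nu = dx + beta mu, the operator therefore is

        psi(x) = psi(s) + int_[s,x[ Phi dnu,    Phi' = - v,

    a first-order system in which psi is a nu-primitive and Phi an absolutely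
    continuous function.  Products of these two kinds of functions obey one
    integration by parts, [nuprim_by_parts], a consequence of Fubini's theorem;
    everything below rests on it.  The system is real, so that the complex
    operator acts separately on real and imaginary parts
    ([delta_prime_op_parts], [delta_prime_op_of_parts]).

    Self-adjointness.  Testing the system with a cutoff shows that Phi is
    square integrable ([quasiderivative_L2]), so the boundary terms of Green's
    formula vanish at infinity and the operator is symmetric
    ([real_graph_symmetric]).  Conversely let v be in the domain of the adjoint,
    w its image, and let V solve the system with right-hand side w.  Every
    compactly supported h with int h = 0 and int h F = 0, where F is the
    nu-primitive of 1, is of the form - Tu with u of compact support, hence
    v - V is orthogonal to all such h; so v - V is a combination of 1 and F,
    and v solves the system too ([real_adjoint]).  As for density, Gamma being
    closed and Lebesgue-null, a square-integrable function is approximated by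
    bounded ones that vanish near Gamma, and these by iterated averages; the
    derivative of such an average vanishes on Gamma, where the interface
    condition then asks for no jump ([real_dense]).

    Negative eigenvalues.  Choose A < B with Gamma inside ]A, B[.  The number
    - kap^2 is an eigenvalue exactly when the solution equal to
    exp (kap (x - A)) left of A decays at +oo, that is when
    Phi B + kap psi B, its [mismatch], vanishes.
    - Two zeros kap, kap' of the mismatch give orthogonal eigenfunctions; if kap
      and kap' were too close the eigenfunctions would be uniformly close and
      their product almost nonnegative.  So there are finitely many zeros in
      each ]0, K] ([mismatch_separated]).
    - Around a compact set of positive mu-measure where beta <= - eps there are
      arbitrarily short intervals of negative nu-measure, since the set is
      Lebesgue-null ([negative_interval]).  By Picone's inequality Phi vanishes
      in each of them once kap is large ([picone]); N disjoint sets give N zeros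
      of Phi ([many_zeros]).
    - Zeros of Phi are simple and move continuously with kap.  While the mismatch
      does not vanish they stay in a bounded interval, so their number at K0
      is at least that at any larger kap; as the latter is unbounded and the
      former finite, the mismatch has a zero beyond every K0
      ([mismatch_zero_exists]).
    The zeros of the mismatch thus form an infinite, locally finite subset of
    ]0, +oo[, which a sequence tending to +oo enumerates. *)

(** * Functions with prescribed increments *)

Section Monotone.
Context {R : realType}.
Local Notation Borel := (measurableTypeR R).

Lemma nondecreasing_measurable (F : R -> R) :
  {homo F : x y / x <= y} -> measurable_fun (setT : set Borel) (F : Borel -> R).
Proof.
move=> mF; apply: (measurability _ (RGenOInfty.measurableE R)) => //.
move=> _ [_ [r ->] <-]; rewrite setTI.
apply: is_interval_measurable => x y /=; rewrite !in_itv/= !andbT => Fx Fy z /andP[xz zy].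
by rewrite /= in_itv/= andbT (lt_le_trans Fx)// mF.
Qed.
End Monotone.

Section Increments.
Context {R : realType}.
Local Notation Borel := (measurableTypeR R).
Local Notation leb := (@lebesgue_measure R).
Variables (m : {sigma_finite_measure set Borel -> \bar R}) (E : set R).
Hypothesis mE : measurable (E : set Borel).
Implicit Types (F p q : R -> R) (s x y : R).

(** The interval contains s and not x, so that [eint] is additive in the
    interval even if m has atoms. *)
Definition eint s x p : R := \int[m]_(t in `[s, x[ `&` E) p t.

Definition locint p := forall s x, m.-integrable (`[s, x[ `&` E : set Borel) (EFin \o p).

(** F has density p with respect to m on E; it is left-continuous, and may jump
    at the atoms of m in E. *)
Definition increments F p :=
  locint p /\ forall s x, s <= x -> F x = F s + eint s x p.

Lemma measurable_itvE s x : measurable (`[s, x[ `&` E : set Borel).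
Proof. exact: measurableI. Qed.
Local Hint Resolve measurable_itvE : core.

Lemma eintD s y x p : locint p -> s <= y -> y <= x ->
  eint s x p = eint s y p + eint y x p.
Proof.
move=> ip sy yx; rewrite /eint -Rintegral_setU//.
- congr (Rintegral _ _ _); rewrite -setIUl; congr (_ `&` _).
  by rewrite -itv_bndbnd_setU.
- rewrite -setIUl -itv_bndbnd_setU//; exact: ip.
- apply/disj_setPS => z [[/=]]; rewrite in_itv/= => /andP[_ zy] _ [/=].
  by rewrite in_itv/= leNgt zy.
Qed.

Lemma eint_ge s x p : x <= s -> eint s x p = 0.
Proof. by move=> xs; rewrite /eint set_itv_ge -?leNgt ?bnd_simp// set0I Rintegral_set0. Qed.

Lemma eint_linear s x a b p q : locint p -> locint q ->
  eint s x (fun t => a * p t + b * q t) = a * eint s x p + b * eint s x q.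
Proof.
move=> ip iq; rewrite /eint RintegralD//; first by rewrite !RintegralZl.
- by apply: (@integrableZl _ _ _ _ _ (measurable_itvE s x) a (EFin \o p)).
- by apply: (@integrableZl _ _ _ _ _ (measurable_itvE s x) b (EFin \o q)).
Qed.

Lemma locint_linear a b p q : locint p -> locint q ->
  locint (fun t => a * p t + b * q t).
Proof.
move=> ip iq s x; apply: (@integrableD _ _ _ _ _ (measurable_itvE s x)
  (EFin \o (fun t => a * p t)) (EFin \o (fun t => b * q t))) => //.
- by apply: (@integrableZl _ _ _ _ _ (measurable_itvE s x) a (EFin \o p)).
- by apply: (@integrableZl _ _ _ _ _ (measurable_itvE s x) b (EFin \o q)).
Qed.

Lemma eq_eint s x p q : (forall t, E t -> s <= t < x -> p t = q t) ->
  eint s x p = eint s x q.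
Proof.
move=> pq; apply: eq_Rintegral => t; rewrite inE/= in_itv/= => -[? ?].
exact: pq.
Qed.

Lemma locint_norm p : locint p -> locint (fun t => `|p t|).
Proof. by move=> ip s x; apply: (integrable_norm (ip s x)). Qed.

Lemma le_eint s x p q : locint p -> locint q ->
  (forall t, E t -> s <= t < x -> p t <= q t) -> eint s x p <= eint s x q.
Proof.
move=> ip iq pq; apply: le_Rintegral => // t [/=]; rewrite in_itv/= => ? ?.
exact: pq.
Qed.

Lemma eint_bound s x p q : locint p -> locint q ->
  (forall t, E t -> s <= t < x -> `|p t| <= q t) -> `|eint s x p| <= eint s x q.
Proof.
move=> ip iq pq; apply: le_trans (le_eint (locint_norm ip) iq pq).
exact: le_normr_Rintegral.
Qed.

Lemma eint_ge0 s x p : (forall t, E t -> s <= t < x -> 0 <= p t) -> 0 <= eint s x p.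
Proof. by move=> p0; apply: Rintegral_ge0 => t [/=]; rewrite in_itv/= => ? ?; exact: p0. Qed.

Lemma locint_measurable p s x : locint p ->
  measurable_fun (`[s, x[ `&` E : set Borel) (p : Borel -> R).
Proof. by move=> /(_ s x)/integrableP[/measurable_EFinP]. Qed.

Lemma locint_le p q :
  (forall s x, measurable_fun (`[s, x[ `&` E : set Borel) (p : Borel -> R)) ->
  locint q -> (forall t, E t -> `|p t| <= q t) -> locint p.
Proof.
move=> mp iq pq s x; apply: (@le_integrable _ _ _ _ _ (measurable_itvE s x) _ (EFin \o q)) => //.
  exact/measurable_EFinP.
move=> t [_ Et] /=; rewrite lee_fin (le_trans (pq t Et))// ler_norm//.
Qed.

Definition locbounded p := forall s x, exists M, forall t, s <= t <= x -> `|p t| <= M.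

Lemma locint_mull h p : measurable_fun (setT : set Borel) (h : Borel -> R) ->
  locbounded h -> locint p -> locint (fun t => h t * p t).
Proof.
move=> mh bh ip s x.
apply: (@integrableMr _ _ _ _ _ (measurable_itvE s x) h (EFin \o p)) => //.
  exact: measurable_funS mh.
have [M hM] := bh s x; exists M; split; first exact: num_real.
move=> N MN t [/=]; rewrite in_itv/= => /andP[st tx] _.
by rewrite (le_trans (hM t _) (ltW MN))// st ltW.
Qed.

Definition antiderivative a p x := if a <= x then eint a x p else - eint x a p.

Lemma antiderivative_increments a p : locint p -> increments (antiderivative a p) p.
Proof.
move=> ip; split=> // s x sx; rewrite /antiderivative.
case: (leP a s) => as_; first by rewrite (le_trans as_ sx) -eintD.
case: (leP a x) => ax.
  by rewrite (eintD ip (ltW as_) ax) addKr.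
by rewrite (eintD ip sx (ltW ax)); ring.
Qed.

Lemma antiderivativexx a p : antiderivative a p a = 0.
Proof. by rewrite /antiderivative lexx eint_ge. Qed.

Lemma increments_eint F p s x : increments F p -> s <= x -> eint s x p = F x - F s.
Proof. by move=> [_ /[apply] ->]; rewrite addrC addKr. Qed.

Lemma increments_linear a b F G p q : increments F p -> increments G q ->
  increments (fun t => a * F t + b * G t) (fun t => a * p t + b * q t).
Proof.
move=> [ip Fp] [iq Gq]; split; first exact: locint_linear.
by move=> s x sx; rewrite eint_linear// (Fp _ _ sx) (Gq _ _ sx); ring.
Qed.

Lemma increments_cst c : increments (fun=> c) (fun=> 0).
Proof.
split=> [s x|s x sx]; first exact: integrable0.
by rewrite /eint Rintegral_cst ?mul0r ?addr0//.
Qed.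

Lemma increments_bound F G p q s x : increments F p -> increments G q -> s <= x ->
  (forall t, E t -> s <= t < x -> `|p t| <= q t) -> `|F x - F s| <= G x - G s.
Proof.
move=> iF iG sx pq; rewrite -(increments_eint iF sx) -(increments_eint iG sx).
by apply: eint_bound => //; [case: iF|case: iG].
Qed.

(** F is a difference of two nondecreasing functions. *)
Lemma increments_measurable F p : increments F p ->
  measurable_fun (setT : set Borel) (F : Borel -> R).
Proof.
move=> iF; have ip : locint p by case: iF.
(* The positive and negative parts of p have nondecreasing antiderivatives. *)
pose q t := Num.max (p t) 0; pose r t := Num.max (- p t) 0.
have iq : locint q.
  apply: (locint_le _ (locint_norm ip)) => [s x|t _].
    apply: measurable_funrpos; exact: locint_measurable.
  by rewrite /q maxEle; case: ifP => p0; rewrite ?normr0//.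
have ir : locint r.
  apply: (locint_le _ (locint_norm ip)) => [s x|t _].
    apply: measurable_funrneg; exact: locint_measurable.
  by rewrite /r maxEle; case: ifP => p0; rewrite ?normr0// normrN.
have iQ := antiderivative_increments 0 iq; have iS := antiderivative_increments 0 ir.
have mono G h : increments G h -> (forall t, 0 <= h t) -> {homo G : x y / x <= y}.
  move=> iG h0 x y xy; rewrite -subr_ge0 -(increments_eint iG xy).
  exact: eint_ge0.
have mQ := nondecreasing_measurable (mono _ _ iQ (fun t => ltac:(by rewrite /q le_max lexx orbT))).
have mS := nondecreasing_measurable (mono _ _ iS (fun t => ltac:(by rewrite /r le_max lexx orbT))).
have -> : F = fun x => F 0 + (antiderivative 0 q x - antiderivative 0 r x).
  apply/funext => x.
  have iD := increments_linear 1 (-1) iQ iS.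
  have Hpqr : (fun t => 1 * q t + -1 * r t) = p.
    apply/funext => t; rewrite /q /r mul1r mulN1r !maxEle.
    by case: (leP (p t) 0) => h1; case: (leP (- p t) 0) => h2; lra.
  rewrite Hpqr in iD.
  case: (leP 0 x) => x0.
    have := increments_eint iF x0; rewrite (increments_eint iD x0) !antiderivativexx.
    by move=> h; lra.
  have := increments_eint iF (ltW x0); rewrite (increments_eint iD (ltW x0)) !antiderivativexx.
  by move=> h; lra.
by apply: measurable_funD => //; exact: measurable_funB.
Qed.

Lemma increments_locbounded F p : increments F p -> locbounded F.
Proof.
move=> iF s x; have ip : locint p by case: iF.
exists (`|F s| + eint s x (fun t => `|p t|)) => t /andP[st tx].
rewrite (iF.2 _ _ st); apply: (le_trans (ler_normD _ _)); rewrite lerD2l.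
apply: (le_trans (eint_bound ip (locint_norm ip) _)) => //.
rewrite (eintD (locint_norm ip) st tx) lerDl.
by apply: eint_ge0 => *.
Qed.

End Increments.

Section Fubini.
Context {R : realType}.
Local Notation Borel := (measurableTypeR R).
Local Notation leb := (@lebesgue_measure R).
Variables (m : {sigma_finite_measure set Borel -> \bar R}) (E : set R).
Hypothesis mE : measurable (E : set Borel).
Implicit Types (p g Phi psi : R -> R) (s x : R).

(** Both sides are the double integral of p t * g y over s <= y < t < x; the
    strict inequality matches the half-open intervals, so atoms of m are counted
    once. *)
Lemma fubini_triangle p g s x : locint leb setT p -> locint m E g ->
  eint leb setT s x (fun t => p t * eint m E s t g) =
  eint m E s x (fun y => g y * eint leb setT y x p).
Proof.
move=> ip ig.
pose p_ : R -> R := p \_ (`[s, x[ `&` setT); pose g_ : R -> R := g \_ (`[s, x[ `&` E).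
have mI := measurable_itvE mE s x; have mI' := measurable_itvE (@measurableT _ Borel) s x.
have ip_ : leb.-integrable setT (EFin \o p_).
  by rewrite /p_ -restrict_EFin; apply/integrable_restrict => //; rewrite setTI; exact: ip.
have ig_ : m.-integrable setT (EFin \o g_).
  by rewrite /g_ -restrict_EFin; apply/integrable_restrict => //; rewrite setTI; exact: ig.
pose A : set (Borel * Borel) := [set z | z.2 < z.1].
have mA : measurable A.
  have := @measurable_fun_ltr _ (Borel * Borel)%type R setT snd fst measurable_snd measurable_fst.
  by move=> /(_ measurableT [set true] I); rewrite setTI; congr measurable; apply/seteqP; split => z /=.
pose f (z : Borel * Borel) : R := p_ z.1 * g_ z.2 * \1_A z.
have mp_ : measurable_fun setT p_ by case/integrableP : ip_ => /measurable_EFinP.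
have mg_ : measurable_fun setT g_ by case/integrableP : ig_ => /measurable_EFinP.
have mf : measurable_fun setT f.
  apply: measurable_funM; last exact: measurable_indic.
  by apply: measurable_funM; [apply: (measurableT_comp mp_)|apply: (measurableT_comp mg_)].
have iF : (leb \x m)%E.-integrable setT (EFin \o f).
  apply/integrable12ltyP; first exact/measurable_EFinP.
  apply: (@le_lt_trans _ _ (\int[leb]_t (`|p_ t|%:E * \int[m]_y `|g_ y|%:E))%E).
    apply: ge0_le_integral => //.
    - by move=> t _; apply: integral_ge0.
    - apply: (measurable_fun_fubini_tonelli_F (abse \o (EFin \o f))).
        by apply/measurableT_comp => //; exact/measurable_EFinP.
      by move=> z; rewrite /= lee_fin.
    - apply: emeasurable_funM => //; apply/measurable_EFinP.
      exact: measurableT_comp.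
    - move=> t _; rewrite -ge0_integralZl//; last first.
        by apply/measurable_EFinP; exact: measurableT_comp.
      apply: ge0_le_integral => //.
      + apply: measurableT_comp => //; apply/measurable_EFinP.
        by apply: measurableT_comp => //; exact: measurable_pair1.
      + apply: emeasurable_funM => //.
        by apply/measurable_EFinP; exact: measurableT_comp.
      + move=> y _; rewrite -EFinM lee_fin /f /= !normrM ler_piMr//.
        by rewrite indicE; case: (_ \in _); rewrite ?normr1 ?normr0.
  rewrite ge0_integralZr//.
  - by apply: lte_mul_pinfty; [exact: integral_ge0| |]; case/integrableP : ig_; case/integrableP : ip_ => // _ h _ h'; rewrite ?ge0_fin_numE ?integral_ge0.
  - by apply/measurable_EFinP; exact: measurableT_comp.
  - exact: integral_ge0.
have := Fubini iF.
have -> : (\int[leb]_t \int[m]_y (EFin \o f) (t, y))%E =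
    (\int[leb]_(t in `[s, x[ `&` setT) (p t * eint m E s t g)%:E)%E.
  rewrite [RHS]integral_mkcond; apply: eq_integral => t _.
  rewrite patchE; case: ifPn => tI; last first.
    by apply: integral0_eq => y _; rewrite /f /= /p_ patchE (negbTE tI) !mul0r.
  have tI' : s <= t < x by move: tI; rewrite inE/= in_itv/= => -[].
  rewrite /eint EFinM /Rintegral fineK; last first.
    by apply: integrable_fin_num (ig s t); exact: measurable_itvE.
  rewrite -(integralZl (measurable_itvE mE s t) (ig s t)).
  rewrite [RHS]integral_mkcond; apply: eq_integral => y _; rewrite /f /= patchE.
  rewrite /p_ patchE tI indicE /A /=.
  have [yt|ty] := ltP y t.
    rewrite [in X in _ * X]mem_set// mulr1 /g_ patchE.
    have -> : (y \in `[s, x[ `&` E) = (y \in `[s, t[ `&` E).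
      apply/idP/idP; rewrite !inE/= !in_itv/= => -[/andP[h1 h2] h3]; split => //; apply/andP; split => //.
      by case/andP : tI' => _; exact: lt_trans.
    by case: ifP; rewrite ?mulr0.
  rewrite [in X in _ * X]memNset/= ?mulr0; last by rewrite ltNge ty.
  by rewrite memNset//= in_itv/= ltNge ty andbF => -[].
have -> : (\int[m]_y \int[leb]_t (EFin \o f) (t, y))%E =
    (\int[m]_(y in `[s, x[ `&` E) (g y * eint leb setT y x p)%:E)%E.
  rewrite [RHS]integral_mkcond; apply: eq_integral => y _.
  rewrite patchE; case: ifPn => yI; last first.
    by apply: integral0_eq => t _; rewrite /f /= /g_ patchE (negbTE yI) mulr0 mul0r.
  have yI' : s <= y < x by move: yI; rewrite inE/= in_itv/= => -[].
  rewrite /eint EFinM setIT -Rintegral_itv_obnd_cbnd; last first.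
    by have := ip y x; rewrite setIT; apply: integrableS => //; apply: subset_itvr; rewrite bnd_simp.
  have iyx : leb.-integrable `]y, x[ (EFin \o p).
    by have := ip y x; rewrite setIT; apply: integrableS => //; apply: subset_itvr; rewrite bnd_simp.
  rewrite /Rintegral fineK; last exact: integrable_fin_num.
  rewrite -integralZl//.
  rewrite [RHS]integral_mkcond; apply: eq_integral => t _; rewrite /f /= patchE.
  rewrite /g_ patchE yI indicE /A /= /p_ patchE.
  have [yt|ty] := ltP y t.
    rewrite [in X in _ * X]mem_set// mulr1.
    have -> : (t \in `[s, x[ `&` setT) = (t \in `]y, x[%classic).
      apply/idP/idP; rewrite !inE/= !in_itv/=.
        by move=> -[/andP[h1 h2] _]; rewrite yt.
      move=> /andP[_ h2]; split => //; rewrite h2 andbT.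
      by case/andP : yI' => + _ => /le_trans; apply; exact: ltW.
    by case: ifP; rewrite ?mul0r// mulrC.
  rewrite [in X in _ * X]memNset/= ?mulr0; last by rewrite ltNge ty.
  by rewrite memNset//= in_itv/= ltNge ty.
by rewrite /eint /Rintegral => ->.
Qed.

(** Integration by parts for an absolutely continuous function against a
    function of bounded variation.  As Phi is continuous, the jumps of psi
    produce no correction term. *)
Lemma increments_by_parts Phi psi p g s x : s <= x ->
  increments leb setT Phi p -> increments m E psi g ->
  Phi x * psi x - Phi s * psi s =
  eint leb setT s x (fun t => p t * psi t) + eint m E s x (fun t => Phi t * g t).
Proof.
move=> sx iPhi ipsi; have ip := iPhi.1; have ig := ipsi.1.
have bpsi := increments_locbounded mE ipsi; have mpsi := increments_measurable mE ipsi.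
have bPhi := increments_locbounded (@measurableT _ Borel) iPhi.
have mPhi := increments_measurable (@measurableT _ Borel) iPhi.
have Hpsi t : s <= t -> psi t = psi s + eint m E s t g by move/(ipsi.2 s t).
have -> : eint leb setT s x (fun t => p t * psi t) =
    psi s * (Phi x - Phi s) + eint leb setT s x (fun t => p t * eint m E s t g).
  rewrite -(increments_eint iPhi sx).
  transitivity (eint leb setT s x (fun t => psi s * p t + 1 * (psi t * p t - psi s * p t))); last first.
    have i2 : locint leb setT (fun t => psi t * p t - psi s * p t).
      have := locint_linear (@measurableT _ Borel) 1 (- psi s) (locint_mull (@measurableT _ Borel) mpsi bpsi ip) ip.
      by congr locint; apply/funext => t; ring.
    rewrite (eint_linear (@measurableT _ Borel))// mul1r; congr (_ + _).
    by apply: eq_eint => t _ /andP[st _]; rewrite (Hpsi _ st); ring.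
  by apply: eq_eint => t _ _; ring.
have -> : eint m E s x (fun t => Phi t * g t) =
    Phi x * (psi x - psi s) - eint m E s x (fun y => g y * eint leb setT y x p).
  rewrite -(increments_eint ipsi sx).
  transitivity (eint m E s x (fun t => Phi x * g t + (-1) * (Phi x * g t - Phi t * g t))); last first.
    have i2 : locint m E (fun t => Phi x * g t - Phi t * g t).
      have := locint_linear mE (Phi x) (-1) ig (locint_mull mE mPhi bPhi ig).
      by congr locint; apply/funext => t; ring.
    rewrite (eint_linear mE)// mulN1r; congr (_ + - _).
    apply: eq_eint => t _ /andP[st /ltW tx]; rewrite (iPhi.2 _ _ tx); ring.
  by apply: eq_eint => t _ _; ring.
rewrite fubini_triangle//; ring.
Qed.

End Fubini.

Section Primitive.
Context {R : realType}.
Local Notation Borel := (measurableTypeR R).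
Local Notation leb := (@lebesgue_measure R).

Definition primitive (F p : R -> R) := increments leb setT F p.
Definition lint (s x : R) (p : R -> R) := eint leb setT s x p.

Lemma primitiveM F G p q : primitive F p -> primitive G q ->
  primitive (fun t => F t * G t) (fun t => p t * G t + F t * q t).
Proof.
move=> iF iG; have mT := @measurableT _ Borel.
have i1 : locint leb setT (fun t => p t * G t).
  have := locint_mull mT (increments_measurable mT iG) (increments_locbounded mT iG) iF.1.
  by congr locint; apply/funext => t; ring.
have i2 : locint leb setT (fun t => F t * q t).
  exact: (locint_mull mT (increments_measurable mT iF) (increments_locbounded mT iF) iG.1).
split.
  by have := locint_linear mT 1 1 i1 i2; congr locint; apply/funext => t; ring.
move=> s x sx; have := increments_by_parts mT sx iF iG.
have := eint_linear mT s x 1 1 i1 i2; rewrite !mul1r => <- h.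
rewrite addrC; apply/eqP; rewrite -subr_eq h; apply/eqP; apply: eq_eint => t _ _; ring.
Qed.

End Primitive.

Section Calculus.
Context {R : realType}.
Local Notation Borel := (measurableTypeR R).
Local Notation leb := (@lebesgue_measure R).
Implicit Types (F f p q : R -> R) (s x : R).

Let mT := @measurableT _ Borel.

Lemma continuous_within_itv F (A : set R) : continuous F -> {within A, continuous F}.
Proof. by move=> cF; apply: continuous_subspaceT. Qed.

Lemma continuous_locbounded F : continuous F -> locbounded F.
Proof.
move=> cF s x; have [sx|xs] := leP s x; last first.
  by exists 0 => t /andP[st tx]; move: (le_trans st tx); rewrite leNgt xs.
have cnF : continuous (fun t => `|F t|).
  by move=> t; apply: (@continuous_comp _ _ _ F Num.norm); [exact: cF|exact: norm_continuous].
have [c _ h] := EVT_max sx (continuous_within_itv (A := `[s, x]) cnF).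
by exists `|F c| => t tsx; apply: h; rewrite in_itv.
Qed.

Lemma continuous_measurable F : continuous F ->
  measurable_fun (setT : set Borel) (F : Borel -> R).
Proof. exact: continuous_measurable_fun. Qed.

Lemma locint_cst (c : R) : locint leb setT (fun=> c).
Proof.
move=> s x; rewrite setIT.
apply: (@measurable_bounded_integrable _ _ _ _ (fun=> c)) => //.
  by rewrite /= lebesgue_measure_itv/=; case: ifP => _; rewrite ?ltry// -EFinB ltry.
by exists `|c|; split => [|M cM t _]; rewrite ?num_real// ltW.
Qed.

Lemma continuous_locint F : continuous F -> locint leb setT F.
Proof.
move=> cF; have -> : F = fun t => F t * 1 by apply/funext => t; rewrite mulr1.
apply: (locint_mull mT (continuous_measurable cF) (continuous_locbounded cF)).
exact: locint_cst.
Qed.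

Lemma lint_itv_cc s x p : locint leb setT p ->
  lint s x p = \int[leb]_(t in `[s, x]) p t.
Proof.
move=> ip; rewrite /lint /eint setIT Rintegral_itv_bndo_bndc//.
by have := ip s x; rewrite setIT.
Qed.

Lemma primitive_continuous F p : primitive F p -> continuous F.
Proof.
move=> [ip Fp] x.
have xI : x - 1 < x < x + 1 by rewrite ltrDl ltr01 gtrDl ltrN10.
have iI : leb.-integrable `[x - 1, x + 1] (EFin \o p).
  by apply: integrableS (ip (x - 1) (x + 2)) => //; rewrite ?setIT//; apply: subset_itvl; rewrite bnd_simp; lra.
have := parameterized_integral_continuous (ltW (lt_trans (andP xI).1 (andP xI).2)) iI.
have sub : `]x - 1, x + 1[ `<=` (`[x - 1, x + 1] : set R) by move=> z /=; rewrite !in_itv/= => /andP[/ltW-> /ltW->].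
move=> /(continuous_subspaceW sub); rewrite continuous_open_subspace; last exact: interval_open.
move=> /(_ x); rewrite inE/= in_itv/= => /(_ xI) h.
have h2 : F (x - 1) + parameterized_integral leb (x - 1) y p @[y --> x] -->
    F (x - 1) + parameterized_integral leb (x - 1) x p.
  by apply: cvgD => //; exact: cvg_cst.
have Fx : F x = F (x - 1) + parameterized_integral leb (x - 1) x p.
  by rewrite (Fp (x - 1) x) ?(ltW (andP xI).1)// -/(lint _ _ _) lint_itv_cc.
have e : \forall y \near nbhs x,
    F (x - 1) + parameterized_integral leb (x - 1) y p = F y.
  near=> y => /=.
  rewrite [RHS](Fp (x - 1) y) -/(lint _ _ _) ?lint_itv_cc//.
  by near: y; exists 1 => [|y] /=; rewrite ?ltr01// ltr_norml => /andP[_]; lra.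
rewrite /continuous_at Fx; by apply: (cvg_trans _ h2); apply: near_eq_cvg.
Unshelve. all: by end_near. Qed.

Lemma is_derive_primitive F f : (forall x, is_derive x 1 F (f x)) -> continuous f ->
  primitive F f.
Proof.
move=> dF cf; split; first exact: continuous_locint.
move=> s x; rewrite le_eqVlt => /predU1P[<-|sx]; first by rewrite eint_ge// addr0.
have cF : continuous F.
  by move=> t; apply/differentiable_continuous/derivable1_diffP; have [] := dF t.
rewrite -/(lint _ _ _) lint_itv_cc; last exact: continuous_locint.
rewrite /Rintegral (@continuous_FTC2 _ f F s x)//=; first by ring.
- exact: continuous_within_itv.
- split=> [t _||]; first by have [] := dF t.
  + exact/cvg_at_right_filter/cF.
  + exact/cvg_at_left_filter/cF.
- by move=> t _; rewrite derive1E; have [_ ->] := dF t.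
Qed.

Lemma primitive_is_derive F f : primitive F f -> continuous f ->
  forall x, is_derive x 1 F (f x).
Proof.
move=> [ip Fp] cf x.
have xI : x - 1 < x by rewrite gtrDl ltrN10.
have xI' : x < x + 1 by rewrite ltrDl.
have iI : leb.-integrable `[x - 1, x + 1] (EFin \o f).
  by apply: integrableS (ip (x - 1) (x + 2)) => //; rewrite ?setIT//; apply: subset_itvl; rewrite bnd_simp; lra.
have [dF F'] := continuous_FTC1_closed xI' iI xI (cf x).
have h1 : is_derive x 1 (fun y => \int[leb]_(t in `[x - 1, y]) f t) (f x).
  exact: (DeriveDef dF (etrans (esym (derive1E _ _)) F')).
have h2 : is_derive x 1 (fun=> F (x - 1)) 0 by exact: is_derive_cst.
have h := is_deriveD h2 h1; rewrite add0r in h.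
apply: near_eq_is_derive h.
near=> y.
rewrite (Fp (x - 1) y) -/(lint _ _ _) ?lint_itv_cc//.
by near: y; exists 1 => [|y] /=; rewrite ?ltr01// ltr_norml => /andP[_]; lra.
Unshelve. all: by end_near. Qed.

Lemma primitive_exists (a c : R) p : locint leb setT p ->
  exists F, primitive F p /\ F a = c.
Proof.
move=> ip; exists (fun t => 1 * antiderivative leb setT a p t + c * 1); split.
  have iA := antiderivative_increments mT a ip.
  have := increments_linear mT 1 c iA (increments_cst leb (mT) 1).
  by congr increments; apply/funext => t; ring.
by rewrite antiderivativexx; ring.
Qed.

End Calculus.

(** * The signed measure dx + beta mu *)

Section Nu.
Context {R : realType}.
Local Notation Borel := (measurableTypeR R).
Local Notation leb := (@lebesgue_measure R).
Variables (G : set R) (mu : {finite_measure set Borel -> \bar R}) (beta : R -> R).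
Hypothesis mG : measurable (G : set Borel).
Hypothesis beta_integrable : mu.-integrable (G : set Borel) (EFin \o beta).
Implicit Types (F f g p q Phi phi psi : R -> R) (s x a b c : R).

Let mT := @measurableT _ Borel.

(** Integral over [s, x[ against nu = dx + beta mu. *)
Definition nuint s x f := lint s x f + eint mu G s x (fun t => f t * beta t).

(** psi' = f off G and dpsi/dmu = beta f on G, psi being left-continuous. *)
Definition nuprim psi f := forall s x, s <= x -> psi x = psi s + nuint s x f.

Definition beta_norm : R := \int[mu]_(t in G) `|beta t|.

Lemma beta_norm_ge0 : 0 <= beta_norm.
Proof. exact: Rintegral_ge0. Qed.

Lemma locint_beta : locint mu G beta.
Proof. by move=> s x; apply: integrableS beta_integrable => //; apply: measurableI. Qed.

Lemma locint_fbeta f : continuous f -> locint mu G (fun t => f t * beta t).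
Proof.
by move=> cf; apply: locint_mull (locint_beta) => //; [exact: continuous_measurable_fun|exact: continuous_locbounded].
Qed.

Lemma nuprimP psi f : continuous f -> nuprim psi f ->
  exists psi1 psi2, [/\ primitive psi1 f, increments mu G psi2 (fun t => f t * beta t)
     & psi = psi1 \+ psi2].
Proof.
move=> cf psif; have [psi1 [i1 _]] := primitive_exists 0 0 (continuous_locint cf).
exists psi1, (psi \- psi1); split => //; last by apply/funext => t /=; rewrite addrC subrK.
split; first exact: locint_fbeta.
by move=> s x sx /=; rewrite (psif _ _ sx) (i1.2 _ _ sx) /nuint /lint; ring.
Qed.

Lemma nuprim_measurable psi f : continuous f -> nuprim psi f ->
  measurable_fun (setT : set Borel) (psi : Borel -> R).
Proof.
move=> cf /(nuprimP cf)[psi1 [psi2 [i1 i2 ->]]].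
by apply: measurable_funD; [exact: increments_measurable i1|exact: increments_measurable i2].
Qed.

Lemma locboundedD f p : locbounded f -> locbounded p -> locbounded (f \+ p).
Proof.
move=> bf bp s x; have [M hM] := bf s x; have [N hN] := bp s x.
exists (M + N) => t tI; apply: (le_trans (ler_normD _ _)).
by rewrite lerD ?hM ?hN.
Qed.

Lemma nuprim_locbounded psi f : continuous f -> nuprim psi f -> locbounded psi.
Proof.
move=> cf /(nuprimP cf)[psi1 [psi2 [i1 i2 ->]]].
by apply: locboundedD; [exact: increments_locbounded i1|exact: increments_locbounded i2].
Qed.

Lemma nuprim_locint psi f : continuous f -> nuprim psi f -> locint leb setT psi.
Proof.
move=> cf psif; have -> : psi = fun t => psi t * 1 by apply/funext => t; rewrite mulr1.
by apply: locint_mull (locint_cst 1) => //; [exact: nuprim_measurable psif|exact: nuprim_locbounded psif].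
Qed.

Lemma nuint_linear s x a b f g : continuous f -> continuous g ->
  nuint s x (fun t => a * f t + b * g t) = a * nuint s x f + b * nuint s x g.
Proof.
move=> cf cg; rewrite /nuint /lint eint_linear//; try exact: continuous_locint.
have -> : (fun t => (a * f t + b * g t) * beta t) =
   (fun t => a * (f t * beta t) + b * (g t * beta t)) by apply/funext => t; ring.
by rewrite eint_linear//; [ring|exact: locint_fbeta|exact: locint_fbeta].
Qed.

Lemma nuprim_linear a b f g psi phi : continuous f -> continuous g ->
  nuprim psi f -> nuprim phi g ->
  nuprim (fun t => a * psi t + b * phi t) (fun t => a * f t + b * g t).
Proof.
by move=> cf cg hf hg s x sx; rewrite nuint_linear// (hf _ _ sx) (hg _ _ sx); ring.
Qed.

Lemma nuprim_cst c : nuprim (fun=> c) (fun=> 0).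
Proof.
move=> s x sx; rewrite /nuint /lint.
rewrite /eint Rintegral_cst ?mul0r ?add0r//; last exact: measurable_itvE.
under eq_Rintegral do rewrite mul0r.
by rewrite Rintegral_cst ?mul0r ?addr0//; exact: measurable_itvE.
Qed.

(** Integration by parts for a primitive and a nu-primitive.  Symmetry of the
    operator, constancy of the Wronskian, orthogonality of eigenfunctions and
    Picone's inequality are instances of it, with Phi, Phi' = p and psi chosen
    accordingly. *)
Lemma nuprim_by_parts Phi p psi f s x : s <= x -> primitive Phi p ->
  continuous f -> nuprim psi f ->
  Phi x * psi x - Phi s * psi s =
  lint s x (fun t => p t * psi t) + nuint s x (fun t => Phi t * f t).
Proof.
move=> sx iPhi cf /(nuprimP cf)[psi1 [psi2 [i1 i2 ->]]] /=.
have h1 := increments_by_parts mT sx iPhi i1.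
have h2 := increments_by_parts mG sx iPhi i2.
have [b1 b2] := (increments_locbounded mT i1, increments_locbounded mG i2).
have [m1 m2] := (increments_measurable mT i1, increments_measurable mG i2).
have e : (fun t => p t * (psi1 t + psi2 t)) = fun t => 1 * (psi1 t * p t) + 1 * (psi2 t * p t).
  by apply/funext => t; ring.
rewrite e /lint eint_linear//; try exact: (locint_mull mT _ _ iPhi.1).
rewrite /nuint /lint !mul1r.
have -> : eint leb setT s x (fun t => psi1 t * p t) = eint leb setT s x (fun t => p t * psi1 t).
  by apply: eq_eint => t _ _; rewrite mulrC.
have -> : eint leb setT s x (fun t => psi2 t * p t) = eint leb setT s x (fun t => p t * psi2 t).
  by apply: eq_eint => t _ _; rewrite mulrC.
have -> : eint mu G s x (fun t => Phi t * f t * beta t) = eint mu G s x (fun t => Phi t * (f t * beta t)).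
  by apply: eq_eint => t _ _; rewrite mulrA.
by move: h1 h2; lra.
Qed.

Definition nuanti a f x :=
  antiderivative leb setT a f x + antiderivative mu G a (fun t => f t * beta t) x.

Lemma nuprim_nuanti a c f : continuous f -> nuprim (fun t => c + nuanti a f t) f.
Proof.
move=> cf s x sx; rewrite /nuanti.
rewrite ((antiderivative_increments mT a (continuous_locint cf)).2 _ _ sx).
rewrite ((antiderivative_increments mG a (locint_fbeta cf)).2 _ _ sx) /nuint /lint; ring.
Qed.

Lemma nuantixx a f : nuanti a f a = 0.
Proof. by rewrite /nuanti !antiderivativexx addr0. Qed.

Lemma nuint_bound s x f M : continuous f -> s <= x -> 0 <= M ->
  (forall t, s <= t < x -> `|f t| <= M) -> `|nuint s x f| <= (x - s + beta_norm) * M.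
Proof.
move=> cf sx M0 fM.
have [->|sx'] := eqVneq s x.
  rewrite /nuint /lint !eint_ge// addr0 normr0 subrr add0r.
  by rewrite mulr_ge0// beta_norm_ge0.
rewrite /nuint mulrDl; apply: (le_trans (ler_normD _ _)); apply: lerD.
  have h := eint_bound mT (s := s) (x := x) (continuous_locint cf) (locint_cst M) (fun t _ => fM t).
  apply: le_trans h _; rewrite /eint setIT Rintegral_cst//=.
  by rewrite lebesgue_measure_itv/= lte_fin lt_neqAle sx' sx/= mulrC.
have i2 : locint mu G (fun t => M * `|beta t|).
  move=> u v; apply: (@integrableZl _ _ _ _ _ (measurable_itvE mG u v) M (EFin \o (fun t => `|beta t|))).
  exact: integrable_norm (locint_beta u v).
apply: le_trans (eint_bound mG (s := s) (x := x) (locint_fbeta cf) i2 _) _.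
  by move=> t _ tI; rewrite normrM ler_wpM2r// fM.
rewrite /eint RintegralZl//; [|exact: measurable_itvE|exact: (integrable_norm (locint_beta s x))].
rewrite mulrC ler_wpM2r// /beta_norm /Rintegral fine_le//.
- apply: integrable_fin_num; first exact: measurable_itvE.
  exact: (integrable_norm (locint_beta s x)).
- apply: integrable_fin_num => //; exact: integrable_norm beta_integrable.
apply: ge0_subset_integral => //; first exact: measurable_itvE.
by case/integrableP : (integrable_norm beta_integrable).
Qed.

End Nu.

(** * The initial value problem *)

Section Geometric.
Context {R : realType}.
Implicit Types (u : nat -> R) (x y z K : R).

Lemma le_of_geometric x y z : (forall n, x <= y + z / 2 ^+ n) -> x <= y.
Proof.
move=> h; apply/ler_addgt0Pr => e e0.
have [z0|z0] := leP z 0.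
  by have := h 0%N; rewrite expr0 divr1; lra.
have := archi_boundP (ltW (divr_gt0 z0 e0)).
set b := Num.Def.archi_bound _ => zb.
apply: (le_trans (h b)); rewrite lerD2l ler_pdivrMr ?exprn_gt0//.
have b2 : (b%:R <= 2 ^+ b :> R)%R by rewrite -natrX ler_nat ltnW// ltn_expl.
rewrite mulrC -ler_pdivrMr// (le_trans (ltW zb))//.
Qed.

(** The limit is chosen before the rate K: the limits of a sequence of functions
    form one function, while K depends on the compact set under consideration. *)
Lemma geometric_limit u : (exists K, forall n, `|u n.+1 - u n| <= K / 2 ^+ n) ->
  exists l, forall K, (forall n, `|u n.+1 - u n| <= K / 2 ^+ n) ->
    forall n, `|l - u n| <= 2 * K / 2 ^+ n.
Proof.
move=> [K0 h0].
have tail K : (forall n, `|u n.+1 - u n| <= K / 2 ^+ n) ->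
    forall n j, `|u (n + j)%N - u n| <= 2 * K / 2 ^+ n.
  move=> h n j; have K_ge0 : 0 <= K by have := le_trans (normr_ge0 _) (h 0%N); rewrite expr0 divr1.
  suff : `|u (n + j)%N - u n| <= 2 * K / 2 ^+ n * (1 - 1 / 2 ^+ j).
    move/le_trans; apply; apply: ler_piMr.
      by rewrite divr_ge0 ?mulr_ge0 ?exprn_ge0.
    by rewrite gerBl divr_ge0 ?exprn_ge0.
  elim: j => [|j IH]; first by rewrite addn0 subrr normr0 expr0 divr1 subrr mulr0.
  rewrite addnS -[_ - u n](subrKA (u (n + j)%N)) (le_trans (ler_normD _ _))//.
  apply: (le_trans (lerD (h _) IH)).
  rewrite exprD exprS.
  have p1 : 2 ^+ n != 0 :> R by rewrite expf_neq0.
  have p2 : 2 ^+ j != 0 :> R by rewrite expf_neq0.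
  rewrite le_eqVlt; apply/orP; left; apply/eqP; field.
  by rewrite p1 p2.
pose S := [set u n - 2 * K0 / 2 ^+ n | n in [set: nat]].
have mono n m : u n - 2 * K0 / 2 ^+ n <= u m + 2 * K0 / 2 ^+ m.
  case: (leqP n m) => nm.
    have := tail _ h0 n (m - n)%N; rewrite subnKC// ler_norml => /andP[+ _].
    have : 0 <= 2 * K0 / 2 ^+ m.
      by rewrite divr_ge0 ?exprn_ge0// mulr_ge0//; have := le_trans (normr_ge0 _) (h0 0%N); rewrite expr0 divr1.
    by lra.
  have := tail _ h0 m (n - m)%N; rewrite subnKC 1?ltnW// ler_norml => /andP[_ +].
  have : 0 <= 2 * K0 / 2 ^+ n.
    by rewrite divr_ge0 ?exprn_ge0// mulr_ge0//; have := le_trans (normr_ge0 _) (h0 0%N); rewrite expr0 divr1.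
  by lra.
have S0 : S !=set0 by exists (u 0%N - 2 * K0 / 2 ^+ 0), 0%N.
have hl n : `|sup S - u n| <= 2 * K0 / 2 ^+ n.
  rewrite ler_norml; apply/andP; split.
    rewrite lerBrDl; apply: ub_le_sup; last by exists n.
    by exists (u n + 2 * K0 / 2 ^+ n) => _ [m _ <-]; exact: mono.
  rewrite lerBlDl; apply: ge_sup => //.
  by move=> _ [m _ <-]; exact: mono.
exists (sup S) => K h n.
apply: (@le_of_geometric _ _ (2 * K0)) => j.
rewrite -[_ - u n](subrKA (u (n + j)%N)) (le_trans (ler_normD _ _))// addrC lerD//.
  exact: tail.
apply: (le_trans (hl _)); rewrite ler_wpM2l//.
  by rewrite mulr_ge0//; have := le_trans (normr_ge0 _) (h0 0%N); rewrite expr0 divr1.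
by rewrite lef_pV2 ?posrE ?exprn_gt0// ler_eXn2l ?ltr1n// leq_addl.
Qed.

End Geometric.

Section Volterra.
Context {R : realType}.
Local Notation Borel := (measurableTypeR R).
Local Notation leb := (@lebesgue_measure R).
Variables (G : set R) (mu : {finite_measure set Borel -> \bar R}) (beta : R -> R).
Hypothesis mG : measurable (G : set Borel).
Hypothesis beta_integrable : mu.-integrable (G : set Borel) (EFin \o beta).
Variable (A : R).
Implicit Types (F f g p q r Phi phi psi : R -> R) (s t x a b c k L M : R).

Let mT := @measurableT _ Borel.
Local Notation nuprim := (nuprim G mu beta).
Local Notation nuint := (nuint G mu beta).
Local Notation beta_norm := (beta_norm G mu beta).

(** The equation psi'' = k psi off G together with the interface condition, as
    a first-order system. *)
Definition sol k psi Phi := primitive Phi (fun t => k * psi t) /\ nuprim psi Phi.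

(** A smooth substitute for exp (L |t - A|). *)
Definition weight L t : R := expR (L * (t - A)) + expR (- (L * (t - A))).

Lemma weight_ge1 L t : 1 <= weight L t.
Proof.
rewrite /weight; have := expR_ge1Dx (L * (t - A)); have := expR_ge1Dx (- (L * (t - A))).
lra.
Qed.

Lemma primitive_expR L a : primitive (fun t => expR (L * (t - a))) (fun t => L * expR (L * (t - a))).
Proof.
have dl x : is_derive x 1 (fun t => L * (t - a)) L.
  have -> : (fun t => L * (t - a)) = (fun t => L *: (t - a)) by [].
  have := is_deriveZ L (is_deriveB (is_derive_id x 1) (is_derive_cst a x 1)).
  by move=> h; apply: (is_derive_eq h); rewrite subr0 /GRing.scale/= mulr1.
have cl : continuous (fun t => L * (t - a)).
  by move=> x; apply/differentiable_continuous/derivable1_diffP; have [] := dl x.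
have ce : continuous (fun t => expR (L * (t - a))).
  by move=> x; apply: (continuous_comp (cl x)); exact: continuous_expR.
apply: is_derive_primitive => x; last by apply: cvgM; [exact: cvg_cst|exact: ce].
rewrite mulrC.
exact: (@is_derive1_comp _ expR (fun t => L * (t - a)) x _ _ (is_derive_expR _) (dl x)).
Qed.

Lemma weight_primitive L : 0 < L -> exists W, [/\ primitive W (weight L), W A = 0
   & forall t, `|W t| <= weight L t / L].
Proof.
move=> L0; exists (fun t => L^-1 * expR (L * (t - A)) + - L^-1 * expR ((- L) * (t - A))); split.
- have := increments_linear mT L^-1 (- L^-1) (primitive_expR L A) (primitive_expR (- L) A).
  congr increments; apply/funext => t; rewrite /weight !mulNr.
  by field; rewrite gt_eqF.
- by rewrite subrr !mulr0; ring.
- move=> t; set a := expR (L * _); set b := expR (- L * _).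
  have -> : L^-1 * a + - L^-1 * b = (a - b) / L by ring.
  have Li : 0 <= L^-1 by rewrite invr_ge0 ltW.
  rewrite normrM [X in _ * X]ger0_norm// ler_wpM2r//.
  rewrite (le_trans (ler_normB _ _))// !ger0_norm ?expR_ge0// /weight /b.
  by rewrite mulNr.
Qed.

Lemma weight_mono L s t : 0 < L -> `|s - A| <= `|t - A| -> weight L s <= weight L t.
Proof.
move=> L0 st.
have aux z : weight L z = expR (L * `|z - A|) + expR (- (L * `|z - A|)).
  by rewrite /weight; case: (ger0P (z - A)) => _ //; rewrite mulrN opprK addrC.
rewrite !aux; set x := L * `|s - A|; set y := L * `|t - A|.
have xy : x <= y by rewrite ler_pM2l.
have x0 : 0 <= x by rewrite mulr_ge0// ltW.
rewrite !expRN; set a := expR x; set b := expR y.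
have a1 : 1 <= a by rewrite /a -[leLHS]expR0 ler_expR.
have ab : a <= b by rewrite ler_expR.
have a0 : 0 < a by apply: lt_le_trans a1.
have b0 : 0 < b by apply: lt_le_trans ab.
rewrite -subr_ge0.
have -> : b + b^-1 - (a + a^-1) = (b - a) * (a * b - 1) / (a * b).
  by field; rewrite !gt_eqF.
apply: divr_ge0; last by rewrite mulr_ge0// ltW.
apply: mulr_ge0; rewrite subr_ge0//; apply: mulr_ege1 => //; exact: le_trans ab.
Qed.

(** Nothing is gained from the exponential weight here, because mu may have
    atoms; the bound only uses that the weight increases with the distance to
    A.  The gain comes from the Lebesgue integration of the other equation, in
    [volterra_bound]. *)
Lemma nuprim_weight_bound c L M delta Delta t : 0 < L -> 0 <= M ->
  continuous Delta -> nuprim delta Delta ->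
  (forall x, `|x - A| <= c -> `|Delta x| <= M * weight L x) -> `|t - A| <= c ->
  `|delta t| <= `|delta A| + (c + beta_norm) * (M * weight L t).
Proof.
move=> L0 M0 cD hd hM tc.
have Mw x : 0 <= M * weight L x by rewrite mulr_ge0// (le_trans _ (weight_ge1 L x)).
have bn := beta_norm_ge0 G mu beta.
have [At|tA] := leP A t.
  rewrite (hd _ _ At) (le_trans (ler_normD _ _))// lerD2l.
  apply: le_trans (nuint_bound mG beta_integrable cD At (Mw t) _) _.
    move=> x /andP[Ax xt]; have hx : `|x - A| <= `|t - A| by rewrite !ger0_norm; lra.
    by rewrite (le_trans (hM _ (le_trans hx tc)))// ler_wpM2l// weight_mono.
  by rewrite ler_wpM2r// lerD2r; move: tc; rewrite ger0_norm; lra.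
have -> : delta t = delta A - nuint t A Delta by rewrite (hd _ _ (ltW tA)); ring.
rewrite (le_trans (ler_normB _ _))// lerD2l.
apply: le_trans (nuint_bound mG beta_integrable cD (ltW tA) (Mw t) _) _.
  move=> x /andP[tx xA]; have hx : `|x - A| <= `|t - A| by rewrite !ler0_norm; lra.
  by rewrite (le_trans (hM _ (le_trans hx tc)))// ler_wpM2l// weight_mono.
by rewrite ler_wpM2r// lerD2r; move: tc; rewrite ler0_norm; lra.
Qed.

(** One turn of the first-order system, seen as a Volterra equation for Phi, in a
    weighted norm for which it contracts: with L >= 2 k1 (c + beta_norm) the
    constant M is halved. *)
Lemma volterra_bound c k1 rho L M k delta Delta r E t :
  0 <= c -> 0 < L -> 0 <= M -> `|k| <= k1 -> 0 <= rho ->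
  2 * k1 * (c + beta_norm) <= L ->
  continuous Delta -> nuprim delta Delta -> primitive E (fun t => k * delta t + r t) ->
  (forall x, `|x - A| <= c -> `|Delta x| <= M * weight L x) ->
  (forall x, `|x - A| <= c -> `|r x| <= rho) -> `|t - A| <= c ->
  `|E t| <= (`|E A| + (k1 * `|delta A| + rho) * c + M / 2) * weight L t.
Proof.
move=> c0 L0 M0 kk1 rho0 hL cD hd iE hM hr tc.
have bn := beta_norm_ge0 G mu beta.
have k10 : 0 <= k1 by apply: le_trans kk1.
have [W [iW WA Wb]] := weight_primitive L0.
pose d0 := k1 * `|delta A| + rho.
pose N := k1 * ((c + beta_norm) * M).
have d00 : 0 <= d0 by rewrite addr_ge0// mulr_ge0.
have N0 : 0 <= N by rewrite !mulr_ge0// addr_ge0.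
have i1 : primitive id (fun=> 1 : R).
  apply: (@is_derive_primitive _ id (fun=> 1)) => x; exact: cvg_cst.
have iGG : primitive (fun t => d0 * t + N * W t) (fun t => d0 * 1 + N * weight L t).
  exact: increments_linear.
have hq x : `|x - A| <= c -> `|k * delta x + r x| <= d0 * 1 + N * weight L x.
  move=> xc; rewrite (le_trans (ler_normD _ _))// normrM mulr1.
  have h1 := nuprim_weight_bound L0 M0 cD hd hM xc.
  have h2 := ler_pM (normr_ge0 _) (normr_ge0 _) kk1 h1.
  by have := hr x xc; rewrite /d0 /N; move: h2; rewrite mulrDr !mulrA; lra.
have w1 := weight_ge1 L t.
have key : `|E t - E A| <= d0 * c + N * (weight L t / L).
  have [At|tA] := leP A t.
    apply: le_trans (increments_bound mT iE iGG At _) _.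
      move=> x _ /andP[Ax xt]; apply: hq.
      by rewrite (le_trans _ tc)// !ger0_norm; lra.
    rewrite WA mulr0 addr0 addrAC -mulrBr lerD//.
      by rewrite ler_wpM2l// (le_trans _ tc)// ler_norm.
    by rewrite ler_wpM2l// (le_trans (ler_norm _)).
  rewrite distrC; apply: le_trans (increments_bound mT iE iGG (ltW tA) _) _.
    move=> x _ /andP[tx xA]; apply: hq.
    by rewrite (le_trans _ tc)// !ler0_norm; lra.
  rewrite WA mulr0 addr0 opprD addrA -mulrBr lerD//.
    by rewrite ler_wpM2l// (le_trans _ tc)// distrC ler_norm.
  by rewrite -mulrN ler_wpM2l// (le_trans _ (Wb t))// -normrN ler_norm.
have NL : N * (weight L t / L) <= M / 2 * weight L t.
  have h : N <= M / 2 * L.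
    have -> : N = M / 2 * (2 * k1 * (c + beta_norm)) by rewrite /N; field.
    by rewrite ler_wpM2l// divr_ge0.
  have -> : N * (weight L t / L) = N / L * weight L t by ring.
  by rewrite ler_wpM2r ?(le_trans _ w1)// ler_pdivrMr.
have -> : E t = E A + (E t - E A) by ring.
rewrite (le_trans (ler_normD _ _))//.
rewrite mulrDl; apply: le_trans (lerD (lexx _) (le_trans key (lerD (lexx _) NL))) _.
rewrite addrA lerD2r -[leLHS]mulr1 ler_wpM2l// addr_ge0// mulr_ge0//.
Qed.
End Volterra.

Section Solutions.
Context {R : realType}.
Local Notation Borel := (measurableTypeR R).
Local Notation leb := (@lebesgue_measure R).
Variables (G : set R) (mu : {finite_measure set Borel -> \bar R}) (beta : R -> R).
Hypothesis mG : measurable (G : set Borel).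
Hypothesis beta_integrable : mu.-integrable (G : set Borel) (EFin \o beta).
Variable (A : R).
Implicit Types (F f g p q r Phi phi psi : R -> R) (s t x a b c k L M : R).

Let mT := @measurableT _ Borel.
Local Notation nuprim := (nuprim G mu beta).
Local Notation nuint := (nuint G mu beta).
Local Notation beta_norm := (beta_norm G mu beta).
Local Notation sol := (sol G mu beta).
Let bn := beta_norm_ge0 G mu beta.

Lemma primitiveB F f g p : primitive F p -> primitive f g ->
  primitive (fun t => F t - f t) (fun t => p t - g t).
Proof.
move=> iF ig; have := increments_linear mT 1 (-1) iF ig.
by congr increments; apply/funext => t; ring.
Qed.

Lemma nuprimB f g psi phi : continuous f -> continuous g ->
  nuprim psi f -> nuprim phi g ->
  nuprim (fun t => psi t - phi t) (fun t => f t - g t).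
Proof.
move=> cf cg h1 h2; have := nuprim_linear mG beta_integrable 1 (-1) cf cg h1 h2.
by congr (nuprim _ _); apply/funext => t; ring.
Qed.

(** Iterating M |-> C0 + M / 2 from [volterra_bound] leads to 2 C0.  The
    inhomogeneity r makes the bound apply to the difference of two solutions
    with different k. *)
Lemma sol_bound c k1 : 0 <= c -> exists2 C, 0 < C &
  forall k Delta delta r rho, `|k| <= k1 -> 0 <= rho ->
    primitive Delta (fun t => k * delta t + r t) -> nuprim delta Delta ->
    (forall t, `|t - A| <= c -> `|r t| <= rho) ->
    forall t, `|t - A| <= c ->
      `|Delta t| <= C * (`|Delta A| + `|delta A| + rho) /\
      `|delta t| <= C * (`|Delta A| + `|delta A| + rho).
Proof.
move=> c0; pose K := `|k1|.
pose L := 2 * K * (c + beta_norm) + 1.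
have K0 : 0 <= K by exact: normr_ge0.
have L0 : 0 < L by rewrite ltr_wpDl// !mulr_ge0// addr_ge0.
pose wc := weight A L (A + c).
have wc1 : 1 <= wc by exact: weight_ge1.
pose D0 := 1 + (K + 1) * c.
have D00 : 1 <= D0 by rewrite lerDl mulr_ge0// addr_ge0.
exists (1 + 2 * D0 * wc + (c + beta_norm) * (2 * D0 * wc)).
  have q : 0 <= 2 * D0 * wc by rewrite !mulr_ge0//; lra.
  by rewrite -addrA ltr_wpDr// addr_ge0// mulr_ge0// addr_ge0.
move=> k Delta delta r rho kk1 rho0 iD hd hr.
have kK : `|k| <= K by rewrite (le_trans kk1)// ler_norm.
have cD : continuous Delta by exact: primitive_continuous iD.
pose sm := `|Delta A| + `|delta A| + rho.
have sm0 : 0 <= sm by rewrite !addr_ge0.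
pose C0 := `|Delta A| + (K * `|delta A| + rho) * c.
have C00 : 0 <= C0 by rewrite addr_ge0// mulr_ge0// addr_ge0// mulr_ge0.
have C0sm : C0 <= D0 * sm.
  rewrite -subr_ge0 /C0 /D0 /sm; set u := `|delta A|; set v := `|Delta A|.
  have -> : (1 + (K + 1) * c) * (v + u + rho) - (v + (K * u + rho) * c) =
    u + rho + ((K + 1) * c * v + c * u + K * c * rho) by ring.
  have u0 : 0 <= u by exact: normr_ge0.
  have v0 : 0 <= v by exact: normr_ge0.
  by do ![apply: addr_ge0 | apply: mulr_ge0 | by []].
pose P M := 0 <= M /\ forall t, `|t - A| <= c -> `|Delta t| <= M * weight A L t.
have step M : P M -> P (C0 + M / 2).
  move=> [M0 hM]; split; first by rewrite addr_ge0// divr_ge0.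
  move=> t tc; apply: (volterra_bound mG beta_integrable c0 L0 M0 kK rho0 _ cD hd iD hM hr tc).
  by rewrite /L lerDl.
have [M0 PM0] : exists M, P M.
  have [M hM] := continuous_locbounded cD (A - c) (A + c).
  exists `|M|; split => // t; rewrite ler_norml => /andP[t1 t2].
  rewrite (le_trans (hM t _))//; first by apply/andP; split; lra.
  by apply: (le_trans (ler_norm _)); rewrite ler_peMr// weight_ge1.
have P2 n : P (2 * C0 + M0 / 2 ^+ n).
  elim: n => [|n /step].
    split; first by rewrite expr0 divr1 addr_ge0 ?mulr_ge0//; case: PM0.
    move=> t tc; apply: (le_trans (PM0.2 _ tc)); rewrite expr0 divr1 ler_wpM2r//.
      by rewrite (le_trans _ (weight_ge1 A L t)).
    by rewrite lerDr mulr_ge0.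
  by congr P; rewrite exprS; field; rewrite expf_neq0.
have hD t : `|t - A| <= c -> `|Delta t| <= 2 * C0 * weight A L t.
  move=> tc; apply: (@le_of_geometric _ _ _ (M0 * weight A L t)) => n.
  apply: le_trans ((P2 n).2 t tc) _.
  by rewrite mulrDl lerD2l mulrAC.
have hw t : `|t - A| <= c -> weight A L t <= wc.
  by move=> tc; apply: weight_mono => //; rewrite [A + c]addrC addrK [leRHS]ger0_norm.
move=> t tc.
have b1 : 2 * C0 * weight A L t <= 2 * D0 * wc * sm.
  have -> : 2 * D0 * wc * sm = (2 * (D0 * sm)) * wc by ring.
  by rewrite ler_pM ?mulr_ge0// ?hw// ?(le_trans _ (weight_ge1 _ _ _))// ler_wpM2l.
have dsm : `|delta A| <= sm by rewrite /sm; have := normr_ge0 (Delta A); lra.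
have p2 : 0 <= 2 * D0 * wc by rewrite !mulr_ge0//; lra.
have p3 : 0 <= 2 * D0 * wc * sm by rewrite mulr_ge0.
split.
  apply: (le_trans (hD t tc)); apply: (le_trans b1).
  rewrite ler_wpM2r// -addrA addrCA lerDl addr_ge0// mulr_ge0// addr_ge0//.
have C02 : 0 <= 2 * C0 by rewrite mulr_ge0.
apply: (le_trans (nuprim_weight_bound mG beta_integrable L0 C02 cD hd hD tc)).
set X := 2 * D0 * wc.
have -> : (1 + X + (c + beta_norm) * X) * sm = sm + X * sm + (c + beta_norm) * (X * sm) by ring.
apply: lerD; first by rewrite (le_trans dsm)// lerDl.
by rewrite ler_wpM2l// addr_ge0.
Qed.

Lemma sol_unique k psi Phi phi F t :
  sol k psi Phi -> sol k phi F -> psi A = phi A -> Phi A = F A ->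
  psi t = phi t /\ Phi t = F t.
Proof.
move=> [i1 n1] [i2 n2] e1 e2.
have c0 : 0 <= `|t - A| by [].
have [C C0 hC] := sol_bound `|k| c0.
have iD : primitive (fun t => Phi t - F t) (fun t => k * (psi t - phi t) + (fun=> 0) t).
  by have := primitiveB i1 i2; congr primitive; apply/funext => x; ring.
have nD := nuprimB (primitive_continuous i1) (primitive_continuous i2) n1 n2.
have [] := hC k _ _ (fun=> 0) 0 (lexx _) (lexx _) iD nD (fun _ _ => ltac:(by rewrite normr0)) t (lexx _).
rewrite e1 e2 !subrr !normr0 !addr0 mulr0 !normr_le0 !subr_eq0.
by move=> /eqP -> /eqP ->.
Qed.

(** The iteration bears on Phi; psi is recovered as a nu-primitive. *)
Definition picard k (Phi0 psi0 : R) f : R -> R := fun x =>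
  Phi0 + antiderivative leb setT A (fun t => k * (psi0 + nuanti G mu beta A f t)) x.

Lemma picard_primitive k (Phi0 psi0 : R) f : continuous f ->
  primitive (picard k Phi0 psi0 f) (fun t => k * (psi0 + nuanti G mu beta A f t)).
Proof.
move=> cf; have ip : locint leb setT (fun t => k * (psi0 + nuanti G mu beta A f t)).
  have ip := nuprim_locint mG beta_integrable cf (nuprim_nuanti mG beta_integrable A psi0 cf).
  have := locint_linear mT k 0 ip ip.
  by congr locint; apply/funext => t; ring.
have := increments_linear mT 1 1 (increments_cst leb mT Phi0) (antiderivative_increments mT A ip).
by congr increments; apply/funext => t; rewrite /picard; ring.
Qed.

Lemma picard_sequence k (Phi0 psi0 : R) : exists u v : nat -> R -> R,
  [/\ forall n, nuprim (v n) (u n), forall n, primitive (u n.+1) (fun t => k * v n t),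
      forall n, v n A = psi0, forall n, u n A = Phi0 & forall n, continuous (u n)].
Proof.
pose u n := iter n (picard k Phi0 psi0) (fun=> Phi0).
exists u, (fun n t => psi0 + nuanti G mu beta A (u n) t).
have cu n : continuous (u n).
  elim: n => [|n IH]; first by move=> x; exact: cvg_cst.
  exact: primitive_continuous (picard_primitive _ _ _ IH).
split => // n.
- exact: nuprim_nuanti.
- exact: picard_primitive.
- by rewrite nuantixx addr0.
- by case: n => [//|n]; rewrite /u /= /picard antiderivativexx addr0.
Qed.

Lemma sol_exists k (Phi0 psi0 : R) : exists psi Phi,
  [/\ sol k psi Phi, psi A = psi0 & Phi A = Phi0].
Proof.
have [u [v [hv hu vA uA cu]]] := picard_sequence k Phi0 psi0.
have bound c : 0 <= c -> exists2 K, 0 <= K & forall n t, `|t - A| <= c ->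
    `|u n.+1 t - u n t| <= K / 2 ^+ n.
  move=> c0; pose L := 2 * `|k| * (c + beta_norm) + 1.
  have L0 : 0 < L by rewrite ltr_wpDl// !mulr_ge0// addr_ge0.
  have cN : continuous (fun t => u 1%N t - u 0%N t) by move=> x; apply: continuousB; exact: cu.
  have [M hM] := continuous_locbounded cN (A - c) (A + c).
  have main n t : `|t - A| <= c -> `|u n.+1 t - u n t| <= `|M| / 2 ^+ n * weight A L t.
    elim: n t => [|n IH] t tc.
      rewrite expr0 divr1; apply: (le_trans (hM t _)).
        by move: tc; rewrite ler_norml => /andP[t1 t2]; apply/andP; split; lra.
      by apply: (le_trans (ler_norm _)); rewrite ler_peMr// weight_ge1.
    have iE : primitive (fun t => u n.+2 t - u n.+1 t)
        (fun t => k * (v n.+1 t - v n t) + (fun=> 0) t).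
      by have := primitiveB (hu n.+1) (hu n); congr primitive; apply/funext => x; ring.
    have nD := nuprimB (cu n.+1) (cu n) (hv n.+1) (hv n).
    have cD : continuous (fun t => u n.+1 t - u n t).
      by move=> x; apply: continuousB; exact: cu.
    have M0 : 0 <= `|M| / 2 ^+ n by rewrite divr_ge0// exprn_ge0.
    have := volterra_bound mG beta_integrable c0 L0 M0 (lexx _) (lexx 0) _ cD nD iE IH
      (fun _ _ => ltac:(by rewrite normr0)) tc.
    rewrite !uA !vA !subrr !normr0 mulr0 addr0 mul0r addr0 add0r.
    rewrite exprS => h; apply: (le_trans (h _)); first by rewrite lerDl.
    by rewrite [2 * _]mulrC invfM mulrA.
  exists (`|M| * weight A L (A + c)).
    by rewrite mulr_ge0// (le_trans _ (weight_ge1 _ _ _)).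
  move=> n t tc; apply: (le_trans (main n t tc)).
  rewrite mulrAC ler_wpM2r ?invr_ge0 ?exprn_ge0// ler_wpM2l//.
  by apply: weight_mono => //; rewrite [A + c]addrC addrK [leRHS]ger0_norm.
have lim t : exists l, forall K, (forall n, `|u n.+1 t - u n t| <= K / 2 ^+ n) ->
    forall n, `|l - u n t| <= 2 * K / 2 ^+ n.
  apply: geometric_limit; have [K _ hK] := bound `|t - A| (normr_ge0 _).
  by exists K => n; exact: hK.
have [Phi hPhi] := choice lim.
have bPhi c : 0 <= c -> exists2 K, 0 <= K & forall n t, `|t - A| <= c ->
    `|Phi t - u n t| <= K / 2 ^+ n.
  move=> c0; have [K K0 hK] := bound c c0.
  by exists (2 * K); rewrite ?mulr_ge0// => n t tc; apply: hPhi => m; exact: hK.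
have cPhi : continuous Phi.
  move=> x; apply/cvgrPdist_le => e e0.
  have [K K0 hK] := bPhi (`|x - A| + 1) (addr_ge0 (normr_ge0 _) ler01).
  have [n hn] : exists n, K / 2 ^+ n <= e / 3.
    apply: contrapT => /forallNP h.
    have : K = 0 \/ 0 < K by move: K0; rewrite le_eqVlt => /predU1P[->|]; [left|right].
    case=> [K00|Kp]; first by have := h 0%N; rewrite K00 mul0r; apply; rewrite divr_ge0// ltW.
    have /le_of_geometric : forall n, e / 3 <= 0 + K / 2 ^+ n.
      by move=> n; rewrite add0r leNgt; apply/negP => /ltW; exact: h.
    by rewrite leNgt divr_gt0.
  near=> y.
  have yx : `|y - A| <= `|x - A| + 1.
    rewrite -[y - A](subrKA x) (le_trans (ler_normD _ _))// addrC lerD2l.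
    by near: y; apply: cvgr_distC_le => //; exact: cvg_id.
  have xx : `|x - A| <= `|x - A| + 1 by rewrite lerDl.
  have hy := hK n y yx; have hx := hK n x xx.
  have hu' : `|u n x - u n y| <= e / 3.
    by near: y; move: (cu n x) => /cvgrPdist_le; apply; rewrite divr_gt0.
  have -> : Phi x - Phi y = (Phi x - u n x) + (u n x - u n y) - (Phi y - u n y) by ring.
  rewrite (le_trans (ler_normB _ _))// (le_trans (lerD (ler_normD _ _) (lexx _)))//.
  by move: (le_trans hx hn) (le_trans hy hn) hu'; lra.
pose psi t := psi0 + nuanti G mu beta A Phi t.
have hpsi : nuprim psi Phi by exact: nuprim_nuanti.
exists psi, Phi; split; last 2 first.
- by rewrite /psi nuantixx addr0.
- apply/eqP; rewrite -subr_eq0 -normr_le0; have [K K0 hK] := bPhi 0 (lexx 0).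
  apply: (@le_of_geometric _ _ _ K) => n.
  by rewrite add0r -[X in Phi A - X](uA n) hK// subrr normr0.
split => //.
have ip : locint leb setT (fun t => k * psi t).
  have ip := nuprim_locint mG beta_integrable cPhi hpsi.
  have := locint_linear mT k 0 ip ip.
  by congr locint; apply/funext => t; ring.
split=> // s x sx.
pose c := Num.max `|s - A| `|x - A|.
have sc : `|s - A| <= c by rewrite le_max lexx.
have xc : `|x - A| <= c by rewrite le_max lexx orbT.
have c0 : 0 <= c by apply: le_trans sc.
have [K K0 hK] := bPhi c c0.
pose V := (c + beta_norm).
have V0 : 0 <= V by rewrite addr_ge0.
pose wc := weight A 1 (A + c).
have wc0 : 0 <= wc by rewrite (le_trans _ (weight_ge1 _ _ _)).
have tI t : s <= t <= x -> `|t - A| <= c.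
  move: sc xc; rewrite !ler_norml => /andP[s1 s2] /andP[x1 x2] /andP[st tx].
  by apply/andP; split; lra.
have hpv n t : s <= t <= x -> `|psi t - v n t| <= V * (K * wc) / 2 ^+ n.
  move=> /tI tc; have nD := nuprimB cPhi (cu n) hpsi (hv n).
  have Kn : 0 <= K / 2 ^+ n by rewrite divr_ge0// exprn_ge0.
  have cD : continuous (fun t => Phi t - u n t) by move=> y; apply: continuousB; [exact: cPhi|exact: cu].
  have h y : `|y - A| <= c -> `|Phi y - u n y| <= K / 2 ^+ n * weight A 1 y.
    by move=> yc; rewrite (le_trans (hK n y yc))// ler_peMr// weight_ge1.
  apply: (le_trans (nuprim_weight_bound mG beta_integrable ltr01 Kn cD nD h tc)).
  rewrite vA /psi nuantixx addr0 subrr normr0 add0r -/V -mulrA ler_wpM2l//.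
  rewrite mulrAC ler_wpM2r ?invr_ge0 ?exprn_ge0// ler_wpM2l//.
  by apply: weight_mono => //; rewrite [A + c]addrC addrK [leRHS]ger0_norm.
pose Z := K + K + (x - s) * (`|k| * (V * (K * wc))).
apply/eqP; rewrite -subr_eq0 -normr_le0; apply: (@le_of_geometric _ _ _ Z) => n.
rewrite add0r.
have e := (hu n).2 s x sx.
have e2 : eint leb setT s x (fun t => k * psi t) - eint leb setT s x (fun t => k * v n t) =
   eint leb setT s x (fun t => k * (psi t - v n t)).
  have := eint_linear mT s x 1 (-1) ip (hu n).1.
  rewrite mul1r mulN1r => <-; apply: eq_eint => t _ _; ring.
have -> : Phi x - (Phi s + eint leb setT s x (fun t => k * psi t)) =
  (Phi x - u n.+1 x) - (Phi s - u n.+1 s) - eint leb setT s x (fun t => k * (psi t - v n t)).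
  by rewrite -e2 e; ring.
have hint : `|eint leb setT s x (fun t => k * (psi t - v n t))| <= (x - s) * (`|k| * (V * (K * wc))) / 2 ^+ n.
  pose cc := `|k| * (V * (K * wc)) / 2 ^+ n.
  have -> : (x - s) * (`|k| * (V * (K * wc))) / 2 ^+ n = cc * x - cc * s by rewrite /cc; ring.
  have iid : primitive (fun t => cc * t) (fun=> cc).
    apply: (@is_derive_primitive _ _ (fun=> cc)) => y; last exact: cvg_cst.
    have := is_deriveZ cc (is_derive_id y 1).
    by move=> h; apply: (is_derive_eq h); rewrite /GRing.scale/= mulr1.
  have := increments_eint iid sx => <-.
  apply: eint_bound => //.
  - have := locint_linear mT 1 (-1) ip (hu n).1.
    by congr locint; apply/funext => t; ring.
  - exact: iid.1.
  - move=> t _ /andP[st /ltW tx]; rewrite normrM /cc -mulrA ler_wpM2l//.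
    by apply: hpv; rewrite st.
rewrite (le_trans (ler_normB _ _))// (le_trans (lerD (ler_normB _ _) hint))//.
rewrite /Z !mulrDl lerD2r.
have Kn : K / 2 ^+ n.+1 <= K / 2 ^+ n.
  by rewrite ler_wpM2l// lef_pV2 ?posrE ?exprn_gt0// ler_eXn2l ?ltr1n.
by rewrite lerD// (le_trans (hK _ _ _)).
Unshelve. all: by end_near. Qed.

End Solutions.

(** * Solutions decaying at infinity *)

Section Exponential.
Context {R : realType}.
Local Notation Borel := (measurableTypeR R).
Local Notation leb := (@lebesgue_measure R).
Implicit Types (g : R -> R) (a c x : R).
Let mT := @measurableT _ Borel.

Lemma lint_eq0 s x g : (forall t, s <= t < x -> g t = 0) -> eint leb setT s x g = 0.
Proof.
move=> g0; have -> : eint leb setT s x g = eint leb setT s x (fun=> 0).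
  by apply: eq_eint => t _; exact: g0.
by rewrite /eint Rintegral_cst ?mul0r//; exact: measurable_itvE.
Qed.

Let exp_ext g c a : locint leb setT g -> exists h, [/\ primitive h (fun t => c * g t), h a = g a &
  primitive (fun t => h t * expR (- c * (t - a)))
    (fun t => c * g t * expR (- c * (t - a)) + h t * (- c * expR (- c * (t - a))))].
Proof.
move=> ig; have icg : locint leb setT (fun t => c * g t).
  by have := locint_linear mT c 0 ig ig; congr locint; apply/funext => t; ring.
have [h [ih ha]] := primitive_exists a (g a) icg.
by exists h; split => //; apply: primitiveM => //; exact: primitive_expR.
Qed.

(** The equation says g' = c g in integrated form, for x >= a only; the auxiliary
    h solves it on the whole line and agrees with g for x >= a, so that the
    derivative of h exp (- c (x - a)) vanishes there. *)
Lemma exp_right g c a : locint leb setT g ->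
  (forall x, a <= x -> g x = g a + lint a x (fun t => c * g t)) ->
  forall x, a <= x -> g x = g a * expR (c * (x - a)).
Proof.
move=> ig hg x ax; have [h [ih ha ip]] := exp_ext c a ig.
have hgE t : a <= t -> h t = g t by move=> at_; rewrite (ih.2 _ _ at_) ha (hg _ at_).
have := increments_eint ip ax.
rewrite lint_eq0; last first.
  by move=> t /andP[at_ _]; rewrite (hgE _ at_); ring.
rewrite (hgE _ ax) (hgE _ (lexx _)) subrr mulr0 expR0 mulr1 => /esym/eqP.
rewrite subr_eq0 mulNr expRN => /eqP <-.
by rewrite mulfVK// gt_eqF// expR_gt0.
Qed.

Lemma exp_left g c a : locint leb setT g ->
  (forall x, x <= a -> g a = g x + lint x a (fun t => c * g t)) ->
  forall x, x <= a -> g x = g a * expR (c * (x - a)).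
Proof.
move=> ig hg x xa; have [h [ih ha ip]] := exp_ext c a ig.
have hgE t : t <= a -> h t = g t.
  by move=> ta; have := ih.2 _ _ ta; rewrite ha (hg _ ta) => /addIr.
have := increments_eint ip xa.
rewrite lint_eq0; last first.
  by move=> t /andP[_ /ltW ta]; rewrite (hgE _ ta); ring.
rewrite (hgE _ xa) (hgE _ (lexx _)) subrr mulr0 expR0 mulr1 => /esym/eqP.
rewrite subr_eq0 mulNr expRN => /eqP ->.
by rewrite mulfVK// gt_eqF// expR_gt0.
Qed.
End Exponential.

Section Jost.
Context {R : realType}.
Local Notation Borel := (measurableTypeR R).
Local Notation leb := (@lebesgue_measure R).
Variables (G : set R) (mu : {finite_measure set Borel -> \bar R}) (beta : R -> R).
Hypothesis mG : measurable (G : set Borel).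
Hypothesis beta_integrable : mu.-integrable (G : set Borel) (EFin \o beta).
Variables (A B : R).
Hypothesis AB : A < B.
Hypothesis GAB : forall x, G x -> A < x < B.
Implicit Types (F f g p q r Phi phi psi : R -> R) (s t x a b c k L M K : R).

Let mT := @measurableT _ Borel.
Local Notation nuprim := (nuprim G mu beta).
Local Notation nuint := (nuint G mu beta).
Local Notation beta_norm := (beta_norm G mu beta).
Local Notation sol := (sol G mu beta).
Let bn := beta_norm_ge0 G mu beta.

Lemma nuint_lint s x f : x <= A \/ B <= s -> nuint s x f = lint s x f.
Proof.
move=> h; rewrite /(nuint _ _ _) /eint; have -> : `[s, x[ `&` G = set0.
  apply/seteqP; split => // t [/=]; rewrite in_itv/= => /andP[st tx] /GAB /andP[At tB].
  by case: h => h; lra.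
by rewrite Rintegral_set0 addr0.
Qed.

Lemma sol_locint a b k psi Phi : sol k psi Phi -> locint leb setT (fun t => a * Phi t + b * psi t).
Proof.
move=> [iPhi npsi]; have cPhi := primitive_continuous iPhi.
apply: locint_linear => //; first exact: continuous_locint.
exact: nuprim_locint npsi.
Qed.

(** Outside [A, B] one has psi' = Phi and Phi' = kap^2 psi, so Phi + kap psi is
    a multiple of exp (kap x).  The sign of kap is arbitrary: both exponentials
    are obtained. *)
Lemma sol_exp_incr kap psi Phi s x : sol (kap ^+ 2) psi Phi -> s <= x -> x <= A \/ B <= s ->
  Phi x + kap * psi x = Phi s + kap * psi s + lint s x (fun t => kap * (Phi t + kap * psi t)).
Proof.
move=> S sx h; have [iPhi npsi] := S; have cPhi := primitive_continuous iPhi.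
have -> : (fun t => kap * (Phi t + kap * psi t)) = (fun t => 1 * (kap ^+ 2 * psi t) + kap * Phi t).
  by apply/funext => t; ring.
rewrite /lint eint_linear//; [|exact: iPhi.1|exact: continuous_locint].
rewrite (iPhi.2 _ _ sx) (npsi _ _ sx) nuint_lint// /lint; ring.
Qed.

Lemma sol_right_tail kap psi Phi x : sol (kap ^+ 2) psi Phi -> B <= x ->
  Phi x + kap * psi x = (Phi B + kap * psi B) * expR (kap * (x - B)).
Proof.
move=> S; apply: (exp_right (g := fun t => Phi t + kap * psi t)).
  by have := sol_locint 1 kap S; congr locint; apply/funext => t; rewrite mul1r.
by move=> y By; apply: sol_exp_incr => //; right.
Qed.

Lemma sol_left_tail kap psi Phi x : sol (kap ^+ 2) psi Phi -> x <= A ->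
  Phi x + kap * psi x = (Phi A + kap * psi A) * expR (kap * (x - A)).
Proof.
move=> S; apply: (exp_left (g := fun t => Phi t + kap * psi t)).
  by have := sol_locint 1 kap S; congr locint; apply/funext => t; rewrite mul1r.
by move=> y By; apply: sol_exp_incr => //; left.
Qed.

(** The solution for the eigenvalue -kap^2 that is exp (kap (x - A)) left of A,
    hence decays at -oo. *)
Definition jost kap psi Phi := [/\ sol (kap ^+ 2) psi Phi, psi A = 1 & Phi A = kap].

(** Coefficient of the growing exponential at +oo, up to a factor. *)
Definition mismatch kap psi Phi : R := Phi B + kap * psi B.

Lemma jost_bound c K : 0 <= c -> exists2 C, 0 < C & forall kap psi Phi, 0 <= kap <= K ->
  jost kap psi Phi -> forall t, `|t - A| <= c -> `|Phi t| <= C /\ `|psi t| <= C.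
Proof.
move=> c0; have [C C0 hC] := sol_bound mG beta_integrable A (K ^+ 2) c0.
exists (C * (`|K| + 1)) => [|kap psi Phi /andP[k0 kK] [[iPhi npsi] psiA PhiA] t tc].
  by rewrite mulr_gt0// ltr_wpDl.
have kk : `|kap ^+ 2| <= K ^+ 2 by rewrite ger0_norm ?sqr_ge0// ler_pXn2r ?nnegrE// (le_trans k0).
have i' : primitive Phi (fun t => kap ^+ 2 * psi t + (fun=> 0) t).
  by move: iPhi; congr primitive; apply/funext => y; rewrite addr0.
have [] := hC _ _ _ (fun=> 0) 0 kk (lexx _) i' npsi (fun _ _ => ltac:(by rewrite normr0)) t tc.
rewrite psiA PhiA normr1 addr0 => h1 h2.
have h : C * (`|kap| + 1) <= C * (`|K| + 1).
  by rewrite ler_wpM2l ?(ltW C0)// lerD2r !ger0_norm// (le_trans k0).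
by split; [apply: le_trans h1 h|apply: le_trans h2 h].
Qed.

Lemma jost_lipschitz c K : 0 <= c -> 0 <= K -> exists2 C, 0 < C &
  forall kap kap' psi Phi psi' Phi', 0 <= kap <= K -> 0 <= kap' <= K ->
  jost kap psi Phi -> jost kap' psi' Phi' -> forall t, `|t - A| <= c ->
  `|Phi t - Phi' t| <= C * `|kap - kap'| /\ `|psi t - psi' t| <= C * `|kap - kap'|.
Proof.
move=> c0 K0; have [C C0 hC] := sol_bound mG beta_integrable A (K ^+ 2) c0.
have [C1 C10 hC1] := jost_bound K c0.
exists (C * (1 + 2 * K * C1)) => [|kap kap' psi Phi psi' Phi' /andP[k0 kK] /andP[k0' kK'] J J' t tc].
  by rewrite mulr_gt0// ltr_pwDl// !mulr_ge0// ltW.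
have [[iPhi npsi] psiA PhiA] := J; have [[iPhi' npsi'] psiA' PhiA'] := J'.
have kk : `|kap ^+ 2| <= K ^+ 2 by rewrite ger0_norm ?sqr_ge0// ler_pXn2r ?nnegrE// (le_trans k0).
have i' : primitive (fun t => Phi t - Phi' t)
    (fun t => kap ^+ 2 * (psi t - psi' t) + (fun t => (kap ^+ 2 - kap' ^+ 2) * psi' t) t).
  by have := primitiveB iPhi iPhi'; congr primitive; apply/funext => y; ring.
have n' := nuprimB mG beta_integrable (primitive_continuous iPhi) (primitive_continuous iPhi') npsi npsi'.
pose rho := 2 * K * C1 * `|kap - kap'|.
have rho0 : 0 <= rho by rewrite !mulr_ge0// ltW.
have hr y : `|y - A| <= c -> `|(kap ^+ 2 - kap' ^+ 2) * psi' y| <= rho.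
  move=> yc; rewrite normrM subr_sqr normrM /rho.
  have -> : 2 * K * C1 * `|kap - kap'| = `|kap - kap'| * (2 * K) * C1 by ring.
  have [_ h2] : `|Phi' y| <= C1 /\ `|psi' y| <= C1 by apply: (hC1 kap') => //; rewrite k0'.
  apply: ler_pM => //; rewrite ler_wpM2l// ger0_norm; lra.
have := hC _ _ _ _ rho kk rho0 i' n' hr t tc.
rewrite psiA psiA' PhiA PhiA' subrr normr0 addr0.
have -> : C * (`|kap - kap'| + rho) = C * (1 + 2 * K * C1) * `|kap - kap'| by rewrite /rho; ring.
by [].
Qed.

(** Orthogonality of two eigenfunctions: 1 and psi B psi' B are (kap + kap')
    times the integrals of psi psi' over the tails, where both functions are
    exponentials. *)
Lemma jost_orthogonal kap kap' psi Phi psi' Phi' : kap != kap' ->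
  jost kap psi Phi -> jost kap' psi' Phi' ->
  mismatch kap psi Phi = 0 -> mismatch kap' psi' Phi' = 0 ->
  (kap + kap') * lint A B (fun t => psi t * psi' t) + 1 + psi B * psi' B = 0.
Proof.
move=> kk' [[iPhi npsi] psiA PhiA] [[iPhi' npsi'] psiA' PhiA'].
rewrite /mismatch => /eqP; rewrite addr_eq0 => /eqP m /eqP; rewrite addr_eq0 => /eqP m'.
have c := primitive_continuous iPhi; have c' := primitive_continuous iPhi'.
have h := nuprim_by_parts mG beta_integrable (ltW AB) iPhi c' npsi'.
have h' := nuprim_by_parts mG beta_integrable (ltW AB) iPhi' c npsi.
have e : nuint A B (fun t => Phi t * Phi' t) = nuint A B (fun t => Phi' t * Phi t).
  by congr (nuint _ _ _); apply/funext => t; rewrite mulrC.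
have ipp : locint leb setT (fun t => psi t * psi' t).
  exact: (locint_mull mT (nuprim_measurable mG beta_integrable c npsi)
    (nuprim_locbounded mG beta_integrable c npsi) (nuprim_locint mG beta_integrable c' npsi')).
have l1 : lint A B (fun t => kap ^+ 2 * psi t * psi' t) = kap ^+ 2 * lint A B (fun t => psi t * psi' t).
  have := eint_linear mT A B (kap ^+ 2) 0 ipp ipp; rewrite mul0r addr0 => <-.
  by apply: eq_eint => t _ _; ring.
have l2 : lint A B (fun t => kap' ^+ 2 * psi' t * psi t) = kap' ^+ 2 * lint A B (fun t => psi t * psi' t).
  have := eint_linear mT A B (kap' ^+ 2) 0 ipp ipp; rewrite mul0r addr0 => <-.
  by apply: eq_eint => t _ _; ring.
move: h h'; rewrite m m' PhiA PhiA' psiA psiA' l1 l2 -e => h h'.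
set I := lint A B _ in h h' *.
apply: (@mulfI _ (kap - kap')); first by rewrite subr_eq0.
by rewrite mulr0; move: h h'; set N := nuint _ _ _ => h h'; lra.
Qed.

(** If kap and kap' were close, psi and psi' would be close on [A, B], and
    psi psi' >= - (psi - psi')^2 / 4 would make the left-hand side of
    [jost_orthogonal] positive. *)
Lemma mismatch_separated K : 0 < K -> exists2 d, 0 < d &
  forall kap kap' psi Phi psi' Phi', 0 < kap <= K -> 0 < kap' <= K -> kap != kap' ->
  jost kap psi Phi -> jost kap' psi' Phi' ->
  mismatch kap psi Phi = 0 -> mismatch kap' psi' Phi' = 0 -> d <= `|kap - kap'|.
Proof.
move=> K0; have c0 : 0 <= B - A by rewrite subr_ge0 ltW.
have [C C0 hC] := jost_lipschitz c0 (ltW K0).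
pose X := 2 * K * (B - A) + 1.
have X1 : 1 <= X by rewrite lerDr !mulr_ge0// ltW.
exists (C * X)^-1; first by rewrite invr_gt0 mulr_gt0//; lra.
move=> kap kap' psi Phi psi' Phi' /andP[k0 kK] /andP[k0' kK'] kk' J J' m m'.
rewrite leNgt; apply/negP => hd.
have := jost_orthogonal kk' J J' m m'.
pose e := C * `|kap - kap'|.
have e0 : 0 <= e by rewrite mulr_ge0// ltW.
have eX : e * X < 1.
  rewrite /e mulrAC; rewrite -(ltr_pM2l (_ : 0 < C * X)) in hd; last by rewrite mulr_gt0//; lra.
  by move: hd; rewrite divff// mulf_neq0// gt_eqF//; lra.
have e1 : e < 1 by apply: le_lt_trans eX; rewrite ler_peMr.
have low t : `|t - A| <= B - A -> - (e / 4) <= psi t * psi' t.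
  move=> tc; have [_] := hC kap kap' psi Phi psi' Phi' ltac:(rewrite kK; lra) ltac:(rewrite kK'; lra) J J' t tc.
  rewrite -/e => h.
  have h2 : (psi t - psi' t) ^+ 2 <= e.
    rewrite -real_normK ?num_real// expr2 (@le_trans _ _ (e * e))//; first exact: ler_pM.
    by rewrite ler_piMr// ltW.
  have -> : psi t * psi' t = ((psi t + psi' t) ^+ 2 - (psi t - psi' t) ^+ 2) / 4 by field.
  have := sqr_ge0 (psi t + psi' t); move: h2; set u := _ ^+ 2; set v := _ ^+ 2; lra.
have ipp : locint leb setT (fun t => psi t * psi' t).
  have [[i n] _ _] := J; have [[i' n'] _ _] := J'.
  have c := primitive_continuous i; have c' := primitive_continuous i'.
  exact: (locint_mull mT (nuprim_measurable mG beta_integrable c n)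
    (nuprim_locbounded mG beta_integrable c n) (nuprim_locint mG beta_integrable c' n')).
have lI : - (e / 4) * (B - A) <= lint A B (fun t => psi t * psi' t).
  have iid : primitive (fun t => - (e / 4) * t) (fun=> - (e / 4)).
    apply: (@is_derive_primitive _ _ (fun=> - (e / 4))) => y; last exact: cvg_cst.
    have := is_deriveZ (- (e / 4)) (is_derive_id y 1).
    by move=> h; apply: (is_derive_eq h); rewrite /GRing.scale/= mulr1.
  rewrite mulrBr -(increments_eint iid (ltW AB)); apply: le_eint => //; first exact: iid.1.
  by move=> t _ /andP[At tB]; apply: low; rewrite ger0_norm; lra.
have lB : - (e / 4) <= psi B * psi' B by apply: low; rewrite ger0_norm; lra.
set I := lint _ _ _ in lI *.
have h1 : (kap + kap') * (- (e / 4) * (B - A)) <= (kap + kap') * I by rewrite ler_wpM2l//; lra.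
have h2 : (2 * K) * (- (e / 4) * (B - A)) <= (kap + kap') * (- (e / 4) * (B - A)).
  by rewrite mulNr !mulrN lerN2 ler_wpM2r// ?mulr_ge0 ?divr_ge0//; lra.
have h3 : (2 * K) * (- (e / 4) * (B - A)) - e / 4 = - (e * X) / 4 by rewrite /X; field.
by lra.
Qed.

End Jost.

(** * Zeros of the quasi-derivative *)

Section Between.
Context {R : realType}.
Implicit Types (s t x z d : R).

Lemma norm_between s t x z d : s <= t -> t <= x -> `|s - z| <= d -> `|x - z| <= d -> `|t - z| <= d.
Proof.
rewrite !ler_norml => st tx /andP[s1 _] /andP[_ x2].
by apply/andP; split; [apply: le_trans s1 _|apply: le_trans x2]; rewrite lerD2r.
Qed.

Lemma norm_le_side s t z d : (z <= s <= t) || (t <= s <= z) -> `|t - z| <= d -> `|s - z| <= d.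
Proof.
move=> zst h; have zz : `|z - z| <= d by rewrite subrr normr0 (le_trans _ h).
by case/orP : zst => /andP[a b]; [exact: norm_between a b zz h|exact: norm_between a b h zz].
Qed.
End Between.

Section Zeros.
Context {R : realType}.
Local Notation Borel := (measurableTypeR R).
Local Notation leb := (@lebesgue_measure R).
Variables (G : set R) (mu : {finite_measure set Borel -> \bar R}) (beta : R -> R).
Hypothesis mG : measurable (G : set Borel).
Hypothesis beta_integrable : mu.-integrable (G : set Borel) (EFin \o beta).
Variables (A B : R).
Hypothesis AB : A < B.
Hypothesis GAB : forall x, G x -> A < x < B.
Implicit Types (F f g p q r Phi phi psi : R -> R) (s t x a b c k L M K : R).

Let mT := @measurableT _ Borel.
Local Notation nuprim := (nuprim G mu beta).
Local Notation nuint := (nuint G mu beta).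
Local Notation beta_norm := (beta_norm G mu beta).
Local Notation sol := (sol G mu beta).
Local Notation jost := (jost G mu beta A).
Local Notation mismatch := (mismatch B).
Let bn := beta_norm_ge0 G mu beta.

(** At a zero of Phi the Wronskian with the solution starting from (0, 1)
    reduces to a product, so psi cannot be small there. *)
Lemma jost_zero_lower c K : 0 <= c -> exists2 m, 0 < m & forall kap psi Phi, 0 <= kap <= K ->
  jost kap psi Phi -> forall z, A <= z <= A + c -> Phi z = 0 -> m <= `|psi z|.
Proof.
move=> c0; have [C C0 hC] := sol_bound mG beta_integrable A (K ^+ 2) c0.
exists C^-1; rewrite ?invr_gt0// => kap psi Phi /andP[k0 kK] [[iPhi npsi] psiA PhiA] z /andP[Az zc] Phiz.
have [phi [F [[iF nphi] phiA FA]]] := sol_exists mG beta_integrable A (kap ^+ 2) 1 0.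
have kk : `|kap ^+ 2| <= K ^+ 2 by rewrite ger0_norm ?sqr_ge0// ler_pXn2r ?nnegrE// (le_trans k0).
have i' : primitive F (fun t => kap ^+ 2 * phi t + (fun=> 0) t).
  by move: iF; congr primitive; apply/funext => y; rewrite addr0.
have zA : `|z - A| <= c by rewrite ger0_norm; lra.
have [FC _] := hC _ _ _ (fun=> 0) 0 kk (lexx _) i' nphi (fun _ _ => ltac:(by rewrite normr0)) z zA.
rewrite phiA FA normr1 normr0 !addr0 mulr1 in FC.
have cPhi := primitive_continuous iPhi; have cF := primitive_continuous iF.
have h1 := nuprim_by_parts mG beta_integrable Az iPhi cF nphi.
have h2 := nuprim_by_parts mG beta_integrable Az iF cPhi npsi.
have e1 : nuint A z (fun t => Phi t * F t) = nuint A z (fun t => F t * Phi t).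
  by congr (nuint _ _ _); apply/funext => t; rewrite mulrC.
have e2 : lint A z (fun t => kap ^+ 2 * psi t * phi t) = lint A z (fun t => kap ^+ 2 * phi t * psi t).
  by congr lint; apply/funext => t; ring.
move: h1 h2; rewrite Phiz PhiA psiA FA phiA e1 e2 => h1 h2.
(* At A the Wronskian F psi - Phi phi is 1, and Phi vanishes at z. *)
have W : F z * psi z = 1 by lra.
rewrite -[C^-1]mul1r -W ler_pdivrMr// in FC *.
rewrite -[leLHS]mul1r.
have : `|F z| * `|psi z| = 1 by rewrite -normrM W normr1.
rewrite W => h; rewrite mul1r -{1}h mulrC.
by rewrite ler_wpM2l.
Qed.

(** Near a zero z, psi keeps a sign and stays away from 0 by [jost_zero_lower],
    and Phi' = kap^2 psi.  Although psi may jump, it varies little near z since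
    its increments are integrals of the small function Phi. *)
Lemma jost_zero_growth c K0 K1 : 0 <= c -> 0 < K0 -> exists m d, [/\ 0 < m, 0 < d, d <= 1 &
  forall kap psi Phi, K0 <= kap <= K1 -> jost kap psi Phi ->
  forall z, A <= z <= A + c -> Phi z = 0 ->
  exists2 sg : R, `|sg| = 1 &
    (forall x, z <= x <= z + d -> m * (x - z) <= sg * Phi x) /\
    (forall x, z - d <= x <= z -> m * (z - x) <= - (sg * Phi x))].
Proof.
move=> c0 K00.
have [m0 m00 hm0] := jost_zero_lower K1 c0.
have c10 : 0 <= c + 1 by rewrite addr_ge0.
have [C C0 hC] := jost_bound mG beta_integrable A K1 c10.
pose V := 1 + beta_norm.
have V0 : 0 < V by rewrite ltr_pwDl.
pose D := V * (K1 ^+ 2 * C).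
pose d := Num.min 1 (m0 / (2 * (D + 1))).
have K1C0 : 0 <= K1 ^+ 2 * C by rewrite mulr_ge0 ?sqr_ge0 ?(ltW C0).
have D0 : 0 <= D by rewrite mulr_ge0 ?(ltW V0).
have D1 : 0 < D + 1 by rewrite ltr_wpDl.
have d0 : 0 < d by rewrite lt_min ltr01/= divr_gt0// mulr_gt0.
have d1 : d <= 1 by rewrite /d ge_min lexx.
have dD : D * d <= m0 / 2.
  have : d <= m0 / (2 * (D + 1)) by rewrite ge_min lexx orbT.
  rewrite ler_pdivlMr ?mulr_gt0// => h.
  have : 0 <= d * 2 by rewrite mulr_ge0// ltW.
  by move: h; rewrite mulrDr mulrDr; lra.
exists (K0 ^+ 2 * (m0 / 2)), d; split => //; first by rewrite mulr_gt0 ?exprn_gt0// divr_gt0.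
move=> kap psi Phi /andP[k0 k1] J z /andP[Az zc] Phiz.
have kap0 : 0 < kap by apply: lt_le_trans k0.
have hk : 0 <= kap <= K1 by rewrite (ltW kap0).
have lowz := hm0 kap psi Phi hk J z ltac:(by rewrite Az) Phiz.
have near t : `|t - z| <= d -> `|t - A| <= c + 1.
  by rewrite !ler_norml => /andP[t1 t2]; apply/andP; split; lra.
have bnd t : `|t - z| <= d -> `|Phi t| <= C /\ `|psi t| <= C by move/near; exact: (hC kap).
have [[iPhi npsi] psiA PhiA] := J.
have cPhi := primitive_continuous iPhi.
have iid e : primitive (fun t => e * t) (fun=> e).
  apply: (@is_derive_primitive _ _ (fun=> e)) => y; last exact: cvg_cst.
  have := is_deriveZ e (is_derive_id y 1).
  by move=> h; apply: (is_derive_eq h); rewrite /GRing.scale/= mulr1.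
have kk : kap ^+ 2 <= K1 ^+ 2 by rewrite ler_pXn2r ?nnegrE ?(ltW kap0)// (le_trans (ltW kap0)).
have lipx s x : s <= x -> `|s - z| <= d -> `|x - z| <= d -> `|Phi x - Phi s| <= K1 ^+ 2 * C * (x - s).
  move=> sx sz xz; rewrite mulrBr.
  apply: (increments_bound mT iPhi (iid (K1 ^+ 2 * C)) sx) => t _ /andP[st tx].
  have /bnd[_ ht] : `|t - z| <= d.
    exact: norm_between st (ltW tx) sz xz.
  by rewrite normrM ger0_norm ?sqr_ge0// ler_pM ?sqr_ge0.
have smallPhi t : `|t - z| <= d -> `|Phi t| <= K1 ^+ 2 * C * d.
  move=> tz.
  have zz : `|z - z| <= d by rewrite subrr normr0 ltW.
  have [tz'|/ltW tz'] := leP z t.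
    have := lipx _ _ tz' zz tz; rewrite Phiz subr0 => /le_trans; apply.
    by rewrite ler_wpM2l// (le_trans _ tz)// ler_norm.
  have := lipx _ _ tz' tz zz; rewrite Phiz sub0r normrN => /le_trans; apply.
  by rewrite ler_wpM2l// (le_trans _ tz)// distrC ler_norm.
have psinear t : `|t - z| <= d -> `|psi t - psi z| <= m0 / 2.
  move=> tz; have M0 : 0 <= K1 ^+ 2 * C * d by rewrite mulr_ge0 ?(ltW d0).
  have fin w : 0 <= w -> w <= d -> (w + beta_norm) * (K1 ^+ 2 * C * d) <= m0 / 2.
    move=> w0 wd; apply: le_trans dD; rewrite /D.
    have -> : V * (K1 ^+ 2 * C) * d = V * (K1 ^+ 2 * C * d) by ring.
    by rewrite ler_wpM2r// lerD2r; apply: le_trans d1.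
  have [tz'|/ltW tz'] := leP z t.
    rewrite (npsi _ _ tz') addrAC subrr add0r.
    apply: le_trans (nuint_bound mG beta_integrable cPhi tz' M0 _) _.
      move=> y /andP[y1 y2]; apply: smallPhi; move: tz.
      by apply: norm_le_side; rewrite y1 ltW.
    apply: fin; first by rewrite subr_ge0.
    by apply: le_trans tz; exact: ler_norm.
  rewrite distrC (npsi _ _ tz') addrAC subrr add0r.
  apply: le_trans (nuint_bound mG beta_integrable cPhi tz' M0 _) _.
    move=> y /andP[y1 y2]; apply: smallPhi; move: tz.
    by apply: norm_le_side; rewrite y1 (ltW y2) orbT.
  apply: fin; first by rewrite subr_ge0.
  by apply: le_trans tz; rewrite distrC; exact: ler_norm.
pose sg : R := Num.sg (psi z).
have pz : psi z != 0 by rewrite -normr_gt0; apply: lt_le_trans lowz.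
have sg1 : `|sg| = 1 by rewrite normr_sg pz.
have sgpsi t : `|t - z| <= d -> m0 / 2 <= sg * psi t.
  move=> tz; have -> : sg * psi t = sg * psi z + sg * (psi t - psi z) by ring.
  have -> : sg * psi z = `|psi z| by rewrite normrEsg.
  have : `|sg * (psi t - psi z)| <= m0 / 2 by rewrite normrM sg1 mul1r psinear.
  by rewrite ler_norml => /andP[h _]; lra.
have grow s x : s <= x -> `|s - z| <= d -> `|x - z| <= d ->
    K0 ^+ 2 * (m0 / 2) * (x - s) <= sg * Phi x - sg * Phi s.
  move=> sx sz xz.
  have iS : primitive (fun t => sg * Phi t) (fun t => sg * (kap ^+ 2 * psi t)).
    by have := increments_linear mT sg 0 iPhi iPhi; congr increments; apply/funext => t; ring.
  rewrite mulrBr -(increments_eint iS sx) -(increments_eint (iid _) sx).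
  apply: le_eint => //; [exact: (iid _).1|exact: iS.1|].
  move=> t _ /andP[st tx].
  have /sgpsi ht : `|t - z| <= d.
    exact: norm_between st (ltW tx) sz xz.
  rewrite [leRHS]mulrCA; apply: ler_pM => //.
  - exact: sqr_ge0.
  - by rewrite divr_ge0 ?(ltW m00).
  - by rewrite ler_pXn2r ?nnegrE ?(ltW kap0) ?(ltW K00).
have zz : `|z - z| <= d by rewrite subrr normr0 ltW.
exists sg => //; split => x /andP[x1 x2].
  have := grow z x x1 zz; rewrite Phiz mulr0 subr0; apply.
  by rewrite ger0_norm ?subr_ge0// lerBlDl.
have := grow x z x2 _ zz; rewrite Phiz mulr0 sub0r; apply.
by rewrite distrC ger0_norm ?subr_ge0// lerBlDr -lerBlDl.
Qed.

End Zeros.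

Section ZeroCount.
Context {R : realType}.
Local Notation Borel := (measurableTypeR R).
Local Notation leb := (@lebesgue_measure R).
Variables (G : set R) (mu : {finite_measure set Borel -> \bar R}) (beta : R -> R).
Hypothesis mG : measurable (G : set Borel).
Hypothesis beta_integrable : mu.-integrable (G : set Borel) (EFin \o beta).
Variables (A B : R).
Hypothesis AB : A < B.
Hypothesis GAB : forall x, G x -> A < x < B.
Implicit Types (F f g p q r Phi phi psi : R -> R) (s t x a b c k L M K : R).

Let mT := @measurableT _ Borel.
Local Notation nuprim := (nuprim G mu beta).
Local Notation nuint := (nuint G mu beta).
Local Notation beta_norm := (beta_norm G mu beta).
Local Notation sol := (sol G mu beta).
Local Notation jost := (jost G mu beta A).
Local Notation mismatch := (mismatch B).
Let bn := beta_norm_ge0 G mu beta.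

Lemma zeros_separated m d sg Phi z z' : 0 < m -> Phi z' = 0 ->
  (forall x, z <= x <= z + d -> m * (x - z) <= sg * Phi x) ->
  (forall x, z - d <= x <= z -> m * (z - x) <= - (sg * Phi x)) ->
  `|z' - z| <= d -> z' = z.
Proof.
move=> m0 Pz' h1 h2; rewrite ler_norml => /andP[a b].
have [zz'|z'z|//] := ltgtP z z'.
- have := h1 z'; rewrite (ltW zz')/= -lerBlDl => /(_ b).
  by rewrite Pz' mulr0 => h; have := mulr_gt0 m0 (etrans (subr_gt0 z z') zz'); rewrite ltNge h.
- have zd : z - d <= z' by move: a; lra.
  have := h2 z'; rewrite zd (ltW z'z) Pz' mulr0 oppr0 => /(_ isT) h.
  by have := mulr_gt0 m0 (etrans (subr_gt0 z' z) z'z); rewrite ltNge h.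
Qed.

(** The sign change of Phi at distance d / 3 on both sides of each zero survives a
    small perturbation; distinct zeros being more than d apart, the new ones are
    distinct too. *)
Lemma zero_persistence c K0 K1 : 0 <= c -> 0 < K0 -> exists2 rho, 0 < rho &
  forall kap kap' psi Phi psi' Phi', K0 <= kap <= K1 -> K0 <= kap' <= K1 ->
  `|kap - kap'| <= rho -> jost kap psi Phi -> jost kap' psi' Phi' ->
  forall sz : seq R, uniq sz -> (forall z, z \in sz -> Phi z = 0 /\ A <= z <= A + c) ->
  exists sz' : seq R, [/\ uniq sz', size sz' = size sz & forall z, z \in sz' -> Phi' z = 0].
Proof.
move=> c0 K00; have [m [d [m0 d0 d1 hg]]] := jost_zero_growth mG beta_integrable A K1 c0 K00.
have [K10|K10] := leP 0 K1; last first.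
  exists 1 => // kap kap' ? ? ? ? /andP[k0 k1].
  by move: (le_lt_trans (le_trans k0 k1) K10); rewrite ltNge (ltW K00).
have c10 : 0 <= c + 1 by rewrite addr_ge0.
have [C C0 hC] := jost_lipschitz mG beta_integrable A c10 K10.
pose e := d / 3.
have e0 : 0 < e by rewrite divr_gt0.
have ed : e + e < d by rewrite /e; lra.
exists (m * e / (2 * C)); first by rewrite divr_gt0 ?mulr_gt0.
move=> kap kap' psi Phi psi' Phi' hk hk' kk J J' sz usz hsz.
have hk1 : 0 <= kap <= K1 by case/andP : hk => k0 ->; rewrite andbT (le_trans (ltW K00)).
have hk1' : 0 <= kap' <= K1 by case/andP : hk' => k0 ->; rewrite andbT (le_trans (ltW K00)).
have close t : `|t - A| <= c + 1 -> `|Phi t - Phi' t| <= m * e / 2.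
  move=> tc; have [h _] := hC kap kap' psi Phi psi' Phi' hk1 hk1' J J' t tc.
  apply: (le_trans h); apply: (le_trans (ler_wpM2l (ltW C0) kk)).
  by rewrite le_eqVlt; apply/orP; left; apply/eqP; field; rewrite gt_eqF.
have ex z : exists z', z \in sz -> `|z' - z| <= e /\ Phi' z' = 0.
  have [zs|zs] := boolP (z \in sz); last by exists 0.
  have [Pz /andP[Az zc]] := hsz z zs.
  have [sg sg1 [h1 h2]] := hg kap psi Phi hk J z ltac:(by rewrite Az) Pz.
  have me0 : 0 < m * e by rewrite mulr_gt0.
  have sgb t : `|t - A| <= c + 1 -> `|sg * Phi t - sg * Phi' t| <= m * e / 2.
    by move=> tc; rewrite -mulrBr normrM sg1 mul1r close.
  have zm : `|z - e - A| <= c + 1 by rewrite ler_norml; apply/andP; split; lra.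
  have zp : `|z + e - A| <= c + 1 by rewrite ler_norml; apply/andP; split; lra.
  have m1 : sg * Phi' (z - e) <= 0.
    have := sgb _ zm; rewrite ler_norml => /andP[hh _].
    have := h2 (z - e); rewrite lerD2l lerN2 (_ : e <= d)//=; last by lra.
    rewrite gerBl (ltW e0) => /(_ isT).
    rewrite (_ : z - (z - e) = e); last by ring.
    by move: hh; set u := sg * _; set v := sg * _; set w := m * e in me0 *; lra.
  have p1 : 0 <= sg * Phi' (z + e).
    have := sgb _ zp; rewrite ler_norml => /andP[_ hh].
    have := h1 (z + e); rewrite lerD2l (_ : e <= d)//; last by lra.
    rewrite lerDl (ltW e0) => /(_ isT).
    rewrite (_ : z + e - z = e); last by ring.
    by move: hh; set u := sg * _; set v := sg * _; set w := m * e in me0 *; lra.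
  have [[iPhi' _] _ _] := J'.
  have cP : continuous (fun t => sg * Phi' t).
    by move=> t; apply: cvgM; [exact: cvg_cst|exact: (primitive_continuous iPhi')].
  have ze : z - e <= z + e by lra.
  have [|w] := IVT ze (continuous_within_itv (A := `[z - e, z + e]) cP) (v := 0).
    by rewrite ge_min m1 le_max p1 orbT.
  rewrite in_itv/= => /andP[w1 w2] /eqP; rewrite mulf_eq0 => /orP[/eqP sg0|/eqP Pw].
    by move: sg1; rewrite sg0 normr0 => /esym/eqP; rewrite oner_eq0.
  by exists w => _; split => //; rewrite ler_norml; apply/andP; split; lra.
have [f hf] := choice ex.
exists (map f sz); split; last first.
- by move=> _ /mapP[z zs ->]; case: (hf z zs).
- by rewrite size_map.
rewrite map_inj_in_uniq// => z z' zs zs' ff.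
have [fz _] := hf z zs; have [fz' _] := hf z' zs'; rewrite -ff in fz'.
have [Pz ?] := hsz z zs; have [Pz' zc'] := hsz z' zs'.
have [sg sg1 [h1 h2]] := hg kap psi Phi hk J z' zc' Pz'.
apply: (zeros_separated m0 Pz h1 h2).
have -> : z - z' = (f z - z') - (f z - z) by ring.
by rewrite (le_trans (ler_normB _ _))// (le_trans (lerD fz' fz))// ltW.
Qed.

Lemma zero_count_bounded c kap psi Phi : 0 <= c -> 0 < kap -> jost kap psi Phi ->
  exists N, forall sz : seq R, uniq sz -> (forall z, z \in sz -> Phi z = 0 /\ A <= z <= A + c) ->
  (size sz <= N)%N.
Proof.
move=> c0 k0 J; have [m [d [m0 d0 d1 hg]]] := jost_zero_growth mG beta_integrable A kap c0 k0.
exists (Num.truncn (c / d)).+1 => sz usz hsz.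
pose f z := Num.truncn ((z - A) / d).
rewrite -(size_map f) -(size_iota 0 (Num.truncn (c / d)).+1); apply: uniq_leq_size.
  rewrite map_inj_in_uniq// => z z' zs zs' ff.
  have [Pz /andP[Az zc]] := hsz z zs; have [Pz' /andP[Az' zc']] := hsz z' zs'.
  have [sg sg1 [h1 h2]] := hg kap psi Phi ltac:(by rewrite lexx) J z' ltac:(by rewrite Az') Pz'.
  apply: (zeros_separated m0 Pz h1 h2).
  have t0 : 0 <= (z - A) / d by rewrite divr_ge0 ?subr_ge0// ltW.
  have t0' : 0 <= (z' - A) / d by rewrite divr_ge0 ?subr_ge0// ltW.
  have /andP[a1 a2] := Num.Theory.truncn_itv t0; have /andP[b1 b2] := Num.Theory.truncn_itv t0'.
  rewrite -/(f z) -/(f z') ff in a1 a2 b1 b2.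
  have : `|(z - A) / d - (z' - A) / d| <= 1.
    by rewrite ler_norml; move: a1 a2 b1 b2; rewrite -natr1 => *; apply/andP; split; lra.
  by rewrite -mulrBl opprB addrA subrK normrM normfV (gtr0_norm d0) ler_pdivrMr// mul1r.
move=> _ /mapP[z zs ->]; rewrite mem_iota /= add0n ltnS; have [_ /andP[Az zc]] := hsz z zs.
by apply: Num.Theory.le_truncn; rewrite ler_wpM2r ?invr_ge0 ?(ltW d0)// lerBlDl.
Qed.

Lemma jost_left_pos kap psi Phi x : 0 < kap -> jost kap psi Phi -> x <= A -> 0 < Phi x.
Proof.
move=> k0 [S psiA PhiA] xA.
have S' : sol ((- kap) ^+ 2) psi Phi by rewrite sqrrN.
have h1 := sol_left_tail mG beta_integrable GAB S xA.
have h2 := sol_left_tail mG beta_integrable GAB S' xA.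
rewrite psiA PhiA mulr1 subrr mul0r in h2; rewrite psiA PhiA mulr1 in h1.
have -> : Phi x = kap * expR (kap * (x - A)) by move: h1 h2; set E := expR _; lra.
by rewrite mulr_gt0// expR_gt0.
Qed.

Lemma jost_right kap psi Phi x : jost kap psi Phi -> B <= x ->
  2 * Phi x = mismatch kap psi Phi * expR (kap * (x - B)) +
     (Phi B - kap * psi B) * expR (- (kap * (x - B))).
Proof.
move=> [S psiA PhiA] Bx; have S' : sol ((- kap) ^+ 2) psi Phi by rewrite sqrrN.
have h1 := sol_right_tail mG beta_integrable GAB S Bx.
have h2 := sol_right_tail mG beta_integrable GAB S' Bx.
rewrite !mulNr in h2.
by rewrite /(mismatch _ _ _) -h1 -h2; ring.
Qed.

(** As long as the growing exponential is present, with a coefficient bounded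
    below by compactness of [K0, K1], Phi cannot vanish far to the right. *)
Lemma zeros_located K0 K1 : 0 < K0 -> K0 <= K1 ->
  (forall kap psi Phi, K0 <= kap <= K1 -> jost kap psi Phi -> mismatch kap psi Phi != 0) ->
  exists2 c, 0 <= c & forall kap psi Phi, K0 <= kap <= K1 -> jost kap psi Phi ->
    forall z, Phi z = 0 -> A <= z <= A + c.
Proof.
move=> K00 K01 hm.
have K10 : 0 <= K1 by rewrite (le_trans (ltW K00)).
have c0 : 0 <= B - A by rewrite subr_ge0 ltW.
have BA : `|B - A| <= B - A by rewrite ger0_norm.
have exJ kap : exists s : (R -> R) * (R -> R), jost kap s.1 s.2.
  have [psi [Phi [S p P]]] := sol_exists mG beta_integrable A (kap ^+ 2) kap 1.
  by exists (psi, Phi).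
have [J hJ] := choice exJ.
have [C C0 hC] := jost_lipschitz mG beta_integrable A c0 K10.
have [C1 C10 hC1] := jost_bound mG beta_integrable A K1 c0.
pose D kap := mismatch kap (J kap).1 (J kap).2.
have lipD kap kap' : K0 <= kap <= K1 -> K0 <= kap' <= K1 ->
    `|D kap - D kap'| <= (C + K1 * C + C1) * `|kap - kap'|.
  move=> /andP[a b] /andP[a' b'].
  have hk : 0 <= kap <= K1 by rewrite b (le_trans (ltW K00)).
  have hk' : 0 <= kap' <= K1 by rewrite b' (le_trans (ltW K00)).
  have [h1 h2] := hC kap kap' _ _ _ _ hk hk' (hJ kap) (hJ kap') B BA.
  have [_ h3] := hC1 kap' _ _ hk' (hJ kap') B BA.
  rewrite /D /(mismatch _ _ _).
  set u := (J kap).2 B in h1 *; set v := (J kap).1 B in h2 *.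
  set u' := (J kap').2 B in h1 *; set v' := (J kap').1 B in h2 h3 *.
  have -> : u + kap * v - (u' + kap' * v') = (u - u') + kap * (v - v') + (kap - kap') * v' by ring.
  rewrite [leRHS]mulrDl [X in _ <= X + _]mulrDl (le_trans (ler_normD _ _))// lerD//.
    rewrite (le_trans (ler_normD _ _))// lerD// normrM -mulrA ler_pM// ger0_norm//.
    by case/andP : hk.
  by rewrite normrM mulrC ler_pM.
have cD : {within `[K0, K1], continuous (fun k => `|D k|)}.
  pose L := C + K1 * C + C1.
  have L0 : 0 < L by rewrite /L ltr_wpDl// addr_ge0// ?mulr_ge0// ltW.
  apply/subspace_continuousP => x; rewrite /= in_itv/= => xI.
  apply/cvgrPdist_le => e e0; rewrite near_withinE; near=> y.
  rewrite /= in_itv/= => yI; rewrite (le_trans (ler_dist_dist _ _))//.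
  rewrite (le_trans (lipD _ _ xI yI))// -ler_pdivlMl// mulrC.
  near: y; apply: cvgr_dist_le; first exact: cvg_id.
  by rewrite divr_gt0.
have [kmin kminI hmin] := EVT_min K01 cD.
pose dd := `|D kmin|.
have dd0 : 0 < dd.
  by rewrite normr_gt0; apply: hm (hJ kmin); move: kminI; rewrite in_itv.
have Dge kap psi Phi : K0 <= kap <= K1 -> jost kap psi Phi -> dd <= `|mismatch kap psi Phi|.
  move=> hk [S p P]; have [S' p' P'] := hJ kap.
  have [e1 e2] := sol_unique mG beta_integrable B S S' (etrans p (esym p')) (etrans P (esym P')).
  by rewrite /(mismatch _ _ _) e1 e2; apply: hmin; rewrite in_itv.
pose Y := (C1 + K1 * C1) / (dd * K0).
have Y0 : 0 <= Y by rewrite divr_ge0 ?mulr_ge0 ?addr_ge0 ?mulr_ge0// ltW.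
exists (B - A + Y); first by rewrite addr_ge0.
move=> kap psi Phi hk Jk z Pz.
have /andP[kK0 kK1] := hk.
have k0 : 0 < kap by rewrite (lt_le_trans K00).
apply/andP; split.
  rewrite leNgt; apply/negP => /ltW zA.
  by have := jost_left_pos k0 Jk zA; rewrite Pz ltxx.
have -> : A + (B - A + Y) = B + Y by ring.
have [zB|/ltW Bz] := leP z B; first by rewrite (le_trans zB)// lerDl.
rewrite -lerBlDl.
have := jost_right Jk Bz; rewrite Pz mulr0.
set y := z - B.
have y0 : 0 <= y by rewrite subr_ge0.
have ky0 : 0 <= kap * y by rewrite mulr_ge0// ltW.
have e1 := expR_ge1Dx (kap * y).
have e2 : expR (- (kap * y)) <= 1 by rewrite -[leRHS]expR0 ler_expR oppr_le0.
move/esym/eqP; rewrite addr_eq0 => /eqP /(congr1 Num.norm).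
rewrite normrN !normrM (ger0_norm (expR_ge0 _)) (ger0_norm (expR_ge0 _)) => heq.
have hD := Dge kap psi Phi hk Jk.
have [b1 b2] := hC1 kap psi Phi ltac:(by rewrite (ltW k0)) Jk B BA.
have up : `|Phi B - kap * psi B| * expR (- (kap * y)) <= C1 + K1 * C1.
  rewrite -[leRHS]mulr1 ler_pM ?expR_ge0// (le_trans (ler_normB _ _))// lerD//.
  by rewrite normrM ler_pM// ger0_norm// ltW.
have low : dd * (K0 * y) <= `|mismatch kap psi Phi| * expR (kap * y).
  apply: ler_pM => //; [exact: ltW|by rewrite mulr_ge0// ltW|].
  apply: le_trans e1; have : K0 * y <= kap * y by rewrite ler_wpM2r.
  by lra.
rewrite /Y ler_pdivlMr ?mulr_gt0//.
by rewrite mulrC -mulrA (le_trans low)// heq.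
Unshelve. all: by end_near. Qed.

(** Otherwise the zeros of Phi stay in a bounded interval while kap decreases
    from K1 to K0, and by [zero_persistence] their number never drops: K0
    would have more zeros than [zero_count_bounded] allows. *)
Lemma mismatch_zero_exists K0 : 0 < K0 ->
  (forall N : nat, exists K, forall kap psi Phi, K <= kap -> jost kap psi Phi ->
     exists sz : seq R, [/\ uniq sz, size sz = N & forall z, z \in sz -> Phi z = 0]) ->
  exists kap psi Phi, [/\ K0 <= kap, jost kap psi Phi & mismatch kap psi Phi = 0].
Proof.
move=> K00 hN; apply: contrapT => hno.
have hm kap psi Phi : K0 <= kap -> jost kap psi Phi -> mismatch kap psi Phi != 0.
  by move=> hk Jk; apply/eqP => m0; apply: hno; exists kap, psi, Phi.
have exJ kap : exists s : (R -> R) * (R -> R), jost kap s.1 s.2.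
  have [psi [Phi [S p P]]] := sol_exists mG beta_integrable A (kap ^+ 2) kap 1.
  by exists (psi, Phi).
have [J hJ] := choice exJ.
have [c0 c00 hc0] := zeros_located K00 (lexx K0)
  (fun kap psi Phi (h : K0 <= kap <= K0) => hm kap psi Phi (proj1 (andP h))).
have [N hNb] := zero_count_bounded c00 K00 (hJ K0).
have [K hK] := hN N.+1.
pose K1 := Num.max K0 K.
have K01 : K0 <= K1 by rewrite le_max lexx.
have [c cc hc] := zeros_located K00 K01
  (fun kap psi Phi (h : K0 <= kap <= K1) => hm kap psi Phi (proj1 (andP h))).
have [rho rho0 hrho] := zero_persistence K1 cc K00.
(* Steps of length rho, from K1 down to K0. *)
pose kj (j : nat) : R := Num.max K0 (K1 - j%:R * rho).
have kjI j : K0 <= kj j <= K1.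
  by rewrite le_max lexx ge_max K01 gerBl mulr_ge0// ltW.
have step j : exists sz : seq R, [/\ uniq sz, size sz = N.+1 & forall z, z \in sz -> (J (kj j)).2 z = 0].
  elim: j => [|j [sz [u1 s1 z1]]].
    apply: (hK (kj 0%N) (J (kj 0%N)).1 (J (kj 0%N)).2); last exact: hJ.
    by rewrite /kj mul0r subr0 /K1 !le_max lexx !orbT.
  have near : `|kj j - kj j.+1| <= rho.
    rewrite /kj -natr1 mulrDl mul1r !maxEle ler_norml.
    by do 2![case: ifPn; rewrite -?ltNge => ?]; apply/andP; split; lra.
  have [sz' [u2 s2 z2]] := hrho _ _ _ _ _ _ (kjI j) (kjI j.+1) near (hJ (kj j)) (hJ (kj j.+1)) sz u1
    (fun z zs => conj (z1 z zs) (hc _ _ _ (kjI j) (hJ (kj j)) z (z1 z zs))).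
  by exists sz'; rewrite s2.
have [j hj] : exists j, kj j = K0.
  have := archi_boundP (divr_ge0 (_ : 0 <= K1 - K0) (ltW rho0)).
  rewrite subr_ge0 => /(_ K01); set j := Num.Def.archi_bound _; rewrite ltr_pdivrMr// => h.
  by exists j; rewrite /kj maxEle ifF//; apply/negP => h2; lra.
have [sz [u s z]] := step j; rewrite hj in z.
have := hNb sz u (fun y ys => conj (z y ys) (hc0 K0 (J K0).1 (J K0).2 ltac:(by rewrite lexx) (hJ K0) y (z y ys))).
by rewrite s ltnn.
Qed.

End ZeroCount.

(** * Picone's inequality and intervals of negative measure *)

Section DominatedConvergence.
Context d (T : measurableType d) (R : realType) (m : {measure set T -> \bar R}).
Variables (D : set T) (f_ : nat -> T -> R) (f h : T -> R).

Lemma Rintegral_dominated : measurable D -> m.-integrable D (EFin \o h) ->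
  (forall n, measurable_fun D (f_ n)) -> measurable_fun D f ->
  {ae m, forall x, D x -> f_ n x @[n --> \oo] --> f x} ->
  (forall n x, D x -> `|f_ n x| <= h x) ->
  \int[m]_(x in D) f_ n x @[n --> \oo] --> \int[m]_(x in D) f x.
Proof.
move=> mD ih mf_ mf cf fh.
have [i0 _ c] : [/\ m.-integrable D (EFin \o f),
  [sequence (\int[m]_(x in D) `|(f_ n x)%:E - (f x)%:E|)%E]_n @ \oo --> 0%E &
  [sequence (\int[m]_(x in D) (f_ n x)%:E)%E]_n @ \oo --> (\int[m]_(x in D) (f x)%:E)%E].
  apply: (@dominated_convergence _ _ _ m D mD (fun n x => (f_ n x)%:E) (EFin \o f) (EFin \o h)) => //.
  - by move=> n; exact/measurable_EFinP.
  - exact/measurable_EFinP.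
  - by apply: filterS cf => x cx Dx; apply: cvg_EFin; [exact: nearW|exact: cx].
  - by apply: aeW => x n Dx; rewrite lee_fin fh.
apply: fine_cvg; rewrite fineK//; exact: integrable_fin_num.
Qed.
End DominatedConvergence.

Section Affine.
Context {R : realType}.

Lemma is_derive_affine (c d t : R) : is_derive t 1 (fun t => c * t + d) c.
Proof.
have h1 : is_derive t 1 (fun t => c * t) c.
  have h := is_deriveZ c (is_derive_id t 1).
  by apply: (is_derive_eq h); rewrite /GRing.scale/= mulr1.
have h2 : is_derive t 1 (fun=> d) 0 by exact: is_derive_cst.
by have := is_deriveD h1 h2; rewrite addr0.
Qed.

Lemma affine_continuous (c d : R) : continuous (fun t => c * t + d).
Proof.
by move=> x; apply/differentiable_continuous/derivable1_diffP; have [] := is_derive_affine c d x.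
Qed.

Lemma affineX_continuous (c d : R) k : continuous (fun t => (c * t + d) ^+ k).
Proof.
move=> x; apply: (@continuous_comp _ _ _ (fun t => c * t + d) (fun y : R => y ^+ k)).
  exact: affine_continuous.
exact: exprn_continuous.
Qed.

Lemma is_derive_affineX (c d t : R) k :
  is_derive t 1 (fun t => (c * t + d) ^+ k.+1) (k.+1%:R * (c * t + d) ^+ k * c).
Proof.
have h := is_deriveX k.+1 (is_derive_affine c d t).
rewrite (_ : (fun t => _) = (fun t => c * t + d) ^+ k.+1); last first.
  by apply/funext => y; rewrite exprfctE.
exact: h.
Qed.
End Affine.

Section Picone.
Context {R : realType}.
Local Notation Borel := (measurableTypeR R).
Local Notation leb := (@lebesgue_measure R).
Variables (G : set R) (mu : {finite_measure set Borel -> \bar R}) (beta : R -> R).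
Hypothesis mG : measurable (G : set Borel).
Hypothesis beta_integrable : mu.-integrable (G : set Borel) (EFin \o beta).
Implicit Types (F f g p q r Phi phi psi eta : R -> R) (s t x a b c k L M K : R).

Let mT := @measurableT _ Borel.
Local Notation nuprim := (nuprim G mu beta).
Local Notation nuint := (nuint G mu beta).
Local Notation sol := (sol G mu beta).

Lemma eq_nuint s x f g : (forall t, s <= t < x -> f t = g t) -> nuint s x f = nuint s x g.
Proof.
move=> fg; rewrite /(nuint _ _ _) /lint; congr (_ + _).
  by apply: eq_eint => t _; exact: fg.
by apply: eq_eint => t _ /fg ->.
Qed.

(** The reciprocal is built from its expected derivative; that Q Phi = 1 then
    follows from uniqueness for the linear equation e' = (p / Phi) e satisfied by
    e = Q Phi - 1. *)
Lemma primitive_inv Phi p a b : a <= b -> primitive Phi p ->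
  measurable_fun (setT : set Borel) (p : Borel -> R) -> locbounded p ->
  (forall x, a <= x <= b -> Phi x != 0) ->
  exists Q q, [/\ primitive Q q, forall x, a <= x <= b -> Q x = (Phi x)^-1 &
     forall x, a <= x <= b -> q x = - p x / Phi x ^+ 2].
Proof.
move=> ab iPhi mp bp Phi0.
have cPhi := primitive_continuous iPhi.
have cn : continuous (fun t => `|Phi t|).
  by move=> t; apply: (@continuous_comp _ _ _ Phi Num.norm); [exact: cPhi|exact: norm_continuous].
have [c cab hmin] := EVT_min ab (continuous_within_itv (A := `[a, b]) cn).
pose m := `|Phi c|.
have m0 : 0 < m by rewrite normr_gt0; apply: Phi0; move: cab; rewrite in_itv.
have ge_m t : a <= t <= b -> m <= `|Phi t| by move=> tab; apply: hmin; rewrite in_itv.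
have [P hP] := bp a b.
have P0 : 0 <= P by apply: le_trans (hP a _) => //; rewrite lexx.
(* g equals |Phi| on [a, b] and is at least m everywhere, which makes w
   continuous on the whole line. *)
pose g t := Num.max `|Phi t| m.
have gm t : m <= g t by rewrite le_max lexx orbT.
have g0 t : 0 < g t by exact: lt_le_trans (gm t).
pose w t := - (g t * g t)^-1.
have cg : continuous g.
  move=> t; apply: (@continuous_max _ _ (fun t => `|Phi t|) (fun=> m)); [exact: cn|exact: cvg_cst].
have cw : continuous w.
  move=> t; apply: (@continuousN _ _ _ (fun t => (g t * g t)^-1)).
  apply: (@continuousV _ _ (fun t => g t * g t)); first by rewrite mulf_neq0// gt_eqF.
  by apply: cvgM; exact: cg.
have mw := continuous_measurable cw.
have bw := continuous_locbounded cw.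
pose q t := w t * p t.
have iq : locint leb setT q by exact: (locint_mull mT mw bw iPhi.1).
have [Q [iQ Qa]] := primitive_exists a (Phi a)^-1 iq.
have qE x : a <= x <= b -> q x = - p x / Phi x ^+ 2.
  move=> xab; rewrite /q /w /g (max_l (ge_m x xab)) -expr2 real_normK ?num_real//.
  by rewrite mulrC mulrN mulNr.
exists Q, q; split => // x /andP[ax xb].
pose E t := Q t * Phi t - 1.
pose e t := q t * Phi t + Q t * p t.
have iE : primitive E e.
  have := primitiveB (primitiveM iQ iPhi) (increments_cst leb mT 1).
  by congr primitive; apply/funext => t; rewrite /e subr0.
have Ea : E a = 0 by rewrite /E Qa mulVf ?subrr// Phi0// lexx.
pose L := P / m.
have L0 : 0 <= L by rewrite divr_ge0// ltW.
have eE t : a <= t <= b -> `|e t| <= L * `|E t|.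
  move=> tab; have Pt := Phi0 t tab.
  have -> : e t = p t / Phi t * E t by rewrite /e /E (qE t tab); field.
  rewrite !normrM ler_wpM2r// normfV; apply: ler_pM => //; first exact: hP.
  rewrite lef_pV2; [exact: ge_m|by rewrite posrE normr_gt0|exact: m0].
have [M hM] := increments_locbounded mT iE a b.
have key n t : a <= t <= b -> `|E t| <= `|M| / 2 ^+ n * expR ((2 * L + 1) * (t - a)).
  elim: n t => [|n IH] t tab.
    rewrite expr0 divr1; apply: (le_trans (hM t tab)); apply: (le_trans (ler_norm _)).
    have h1 : 0 <= (2 * L + 1) * (t - a).
      by apply: mulr_ge0; [rewrite addr_ge0// mulr_ge0|rewrite subr_ge0; case/andP : tab].
    by rewrite ler_peMr// (le_trans _ (expR_ge1Dx _))// lerDl.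
  have /andP[at_ tb] := tab.
  pose N := `|M| / 2 ^+ n.
  have N0 : 0 <= N by rewrite divr_ge0 ?exprn_ge0.
  have iW := primitive_expR (2 * L + 1) a.
  have iNW : primitive (fun t => N / 2 * expR ((2 * L + 1) * (t - a)))
     (fun t => N / 2 * ((2 * L + 1) * expR ((2 * L + 1) * (t - a)))).
    by have := increments_linear mT (N / 2) 0 iW iW; congr increments; apply/funext => y; ring.
  have := increments_bound mT iE iNW at_; rewrite Ea subr0 => h.
  have -> : `|M| / 2 ^+ n.+1 = N / 2 by rewrite exprS [2 * _]mulrC invfM mulrA.
  apply: (le_trans (h _)); last first.
    by rewrite gerBl mulr_ge0 ?expR_ge0// divr_ge0.
  move=> y _ /andP[ay yt]; have yab : a <= y <= b by rewrite ay (le_trans (ltW yt)).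
  apply: (le_trans (eE y yab)); apply: (le_trans (ler_wpM2l L0 (IH y yab))).
  rewrite -/N; set X := expR _.
  have X0 : 0 <= X by exact: expR_ge0.
  have -> : N / 2 * ((2 * L + 1) * X) = L * (N * X) + N / 2 * X by field.
  by rewrite lerDl mulr_ge0// divr_ge0.
have xab : a <= x <= b by rewrite ax.
have : `|E x| <= 0.
  apply: (@le_of_geometric _ _ _ (`|M| * expR ((2 * L + 1) * (x - a)))) => n.
  by rewrite add0r mulrAC; exact: key.
rewrite normr_le0 subr_eq0 => /eqP h.
by rewrite -[Q x](mulfK (Phi0 x xab)) h mul1r.
Qed.

(** Integration by parts of eta^2 / Phi against psi, and the pointwise identity
    eta'^2 - (eta^2 / Phi)' Phi' = (eta' - eta Phi' / Phi)^2.  When nu has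
    a negative eta^2-integral this bounds kap, so Phi must vanish in [a, b] for
    large kap. *)
Lemma picone kap psi Phi eta deta a b : a <= b -> 0 < kap -> sol (kap ^+ 2) psi Phi ->
  (forall x, a <= x <= b -> Phi x != 0) ->
  primitive eta deta -> continuous deta -> eta a = 0 -> eta b = 0 ->
  0 <= lint a b (fun t => deta t ^+ 2) + kap ^+ 2 * nuint a b (fun t => eta t ^+ 2).
Proof.
move=> ab k0 [iPhi npsi] Phi0 ieta cdeta ea eb.
have cPhi := primitive_continuous iPhi.
have mpsi := nuprim_measurable mG beta_integrable cPhi npsi.
have bpsi := nuprim_locbounded mG beta_integrable cPhi npsi.
have mp : measurable_fun (setT : set Borel) ((fun t => kap ^+ 2 * psi t) : Borel -> R).
  by apply: measurable_funM => //; exact: measurable_cst.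
have bp : locbounded (fun t => kap ^+ 2 * psi t).
  move=> s x; have [M hM] := bpsi s x; exists (kap ^+ 2 * M) => t tI.
  by rewrite normrM ger0_norm ?sqr_ge0// ler_wpM2l ?sqr_ge0// hM.
have [Q [q [iQ QE qE]]] := primitive_inv ab iPhi mp bp Phi0.
have iP := primitiveM (primitiveM ieta ieta) iQ.
have := nuprim_by_parts mG beta_integrable ab iP cPhi npsi.
rewrite ea eb !mul0r subrr.
set p := (fun t => _ + _) in iP *.
rewrite (_ : nuint a b _ = nuint a b (fun t => eta t ^+ 2)); last first.
  apply: eq_nuint => t /andP[at_ tb]; have tab : a <= t <= b by rewrite at_ ltW.
  by rewrite (QE t tab) mulfVK ?Phi0// expr2.
move=> h; have -> : nuint a b (fun t => eta t ^+ 2) = - lint a b (fun t => p t * psi t) by lra.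
have ipp : locint leb setT (fun t => p t * psi t).
  by have := locint_mull mT mpsi bpsi iP.1; congr locint; apply/funext => t; rewrite mulrC.
have ide : locint leb setT (fun t => deta t ^+ 2).
  by apply: continuous_locint => t; apply: cvgM; exact: cdeta.
have : lint a b (fun t => kap ^+ 2 * (p t * psi t)) <= lint a b (fun t => deta t ^+ 2).
  apply: le_eint => //.
    by have := locint_linear mT (kap ^+ 2) 0 ipp ipp; congr locint; apply/funext => t; ring.
  move=> t _ /andP[at_ tb]; have tab : a <= t <= b by rewrite at_ ltW.
  have Pt := Phi0 t tab.
  have -> : kap ^+ 2 * (p t * psi t) =
    deta t ^+ 2 - (deta t - eta t * (kap ^+ 2 * psi t / Phi t)) ^+ 2.
    by rewrite /p (QE t tab) (qE t tab); field.
  by rewrite gerBl sqr_ge0.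
have -> : lint a b (fun t => kap ^+ 2 * (p t * psi t)) = kap ^+ 2 * lint a b (fun t => p t * psi t).
  have := eint_linear mT a b (kap ^+ 2) 0 ipp ipp; rewrite mul0r addr0 => <-.
  by apply: eq_eint => t _ _; ring.
by set u := lint _ _ _; set v := lint _ _ _; rewrite mulrN; lra.
Qed.

(** With y the affine map of [a, b] onto [-1, 1], the bumps 1 - y^(2 n + 2)
    increase to 1 on ]a, b[, so the nu-integral of their squares approaches the
    nu-measure of ]a, b[; the point a carries no mu-mass on G as it lies off G. *)
Lemma bump_exists a b : a < b -> ~ G a -> b - a + eint mu G a b beta < 0 ->
  exists eta deta, [/\ primitive eta deta, continuous deta, eta a = 0, eta b = 0 &
    nuint a b (fun t => eta t ^+ 2) < 0].
Proof.
move=> ab Ga neg.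
pose y t := 2 / (b - a) * (t - a) - 1.
pose eta n t := 1 - y t ^+ (2 * n).+2.
pose deta n t := - ((2 * n).+2%:R * y t ^+ (2 * n).+1 * (2 / (b - a))).
pose c := 2 / (b - a); pose d := - (c * a) - 1.
have yE0 : y = fun t => c * t + d by apply/funext => t; rewrite /y /d -/c; ring.
have cyn (k : nat) : continuous (fun t => y t ^+ k) by rewrite yE0; exact: affineX_continuous.
have cde n : continuous (deta n).
  move=> x; apply: (@continuousN _ _ _ (fun t => (2 * n).+2%:R * y t ^+ (2 * n).+1 * (2 / (b - a)))).
  by apply: cvgM; [apply: cvgM; [exact: cvg_cst|exact: cyn]|exact: cvg_cst].
have iy n : primitive (eta n) (deta n).
  apply: is_derive_primitive => [x|]; last exact: cde.
  have h1 := is_derive_affineX c d x (2 * n).+1.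
  have h0 : is_derive x 1 (fun=> 1 : R) 0 by exact: is_derive_cst.
  have h2 := is_deriveB h0 h1; rewrite sub0r in h2.
  by rewrite /eta /deta yE0; exact: h2.
have ba : b - a != 0 by rewrite subr_eq0 gt_eqF.
have ya : y a = -1 by rewrite /y subrr mulr0 sub0r.
have yb : y b = 1 by rewrite /y divfK//; ring.
have evn n : odd (2 * n).+2 = false by rewrite /= negbK mul2n odd_double.
have ea n : eta n a = 0 by rewrite /eta ya -signr_odd evn expr0 subrr.
have eb n : eta n b = 0 by rewrite /eta yb expr1n subrr.
have yy t : y t = 2 * ((t - a) / (b - a)) - 1 by rewrite /y; ring.
have ba0 : 0 < b - a by rewrite subr_gt0.
have r01 t : a <= t < b -> 0 <= (t - a) / (b - a) < 1.
  by move=> /andP[at_ tb]; rewrite divr_ge0 ?subr_ge0 ?(ltW ab)//= ltr_pdivrMr// mul1r ltrD2r.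
have y2 t : a <= t < b -> y t ^+ 2 <= 1.
  move=> /r01; rewrite yy; set r := _ / _ => /andP[r0 r1]; have : 0 <= r * (1 - r) by rewrite mulr_ge0//; lra.
  by rewrite expr2 mulrBr mulr1; nra.
have y2' t : a < t < b -> y t ^+ 2 < 1.
  move=> /andP[at_ tb]; have /andP[_] := r01 t ltac:(by rewrite (ltW at_)).
  rewrite yy; have : 0 < (t - a) / (b - a) by rewrite divr_gt0// subr_gt0.
  set r := _ / _ => r0 r1; have : 0 < r * (1 - r) by rewrite mulr_gt0//; lra.
  by rewrite expr2 mulrBr mulr1; nra.
have yE n t : y t ^+ (2 * n).+2 = (y t ^+ 2) ^+ n.+1 by rewrite -exprM mulnS.
have e01 n t : a <= t < b -> 0 <= eta n t <= 1.
  move=> tab; rewrite /eta yE subr_ge0 gerBl exprn_ge0 ?sqr_ge0// andbT.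
  by rewrite exprn_ile1 ?sqr_ge0// y2.
have ceta n : continuous (eta n) by exact: primitive_continuous (iy n).
have ceta2 n : continuous (fun t => eta n t ^+ 2).
  move=> t; rewrite /continuous_at expr2; under eq_fun do rewrite expr2.
  by apply: cvgM; exact: ceta.
have e2 n t : a <= t < b -> 0 <= eta n t ^+ 2 <= 1.
  by move=> tab; have /andP[h1 h2] := e01 n t tab; rewrite exprn_ge0//= exprn_ile1.
have lim : eint mu G a b (fun t => eta n t ^+ 2 * beta t) @[n --> \oo] --> eint mu G a b beta.
  have mbeta := locint_measurable (s := a) (x := b) (locint_beta mG beta_integrable).
  apply: (@Rintegral_dominated _ _ _ mu _ (fun n t => eta n t ^+ 2 * beta t) beta (fun t => `|beta t|)).
  - exact: measurable_itvE.
  - exact: (integrable_norm (locint_beta mG beta_integrable a b)).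
  - move=> n; apply: measurable_funM => //.
    exact: measurable_funS (continuous_measurable (ceta2 n)).
  - exact: mbeta.
  - apply: aeW => t [/=]; rewrite in_itv/= => /andP[at_ tb] Gt.
    have at' : a < t < b.
      by rewrite tb andbT lt_neqAle at_ andbT; apply/eqP => h; apply: Ga; rewrite h.
    rewrite -[X in _ --> X]mul1r; apply: cvgM; last exact: cvg_cst.
    have c1 : eta n t @[n --> \oo] --> (1 : R).
      rewrite /eta -[X in _ --> X]subr0; under eq_fun do rewrite yE.
      apply: cvgB; first exact: cvg_cst.
      have : (y t ^+ 2) ^+ n @[n --> \oo] --> (0 : R).
        by apply: cvg_expr; rewrite ger0_norm ?sqr_ge0// y2'.
      by rewrite -(cvg_shiftS (fun n => (y t ^+ 2) ^+ n)).
    have e : (fun n => eta n t ^+ 2) = (fun n => eta n t * eta n t).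
      by apply/funext => n; rewrite expr2.
    by rewrite e; have := cvgM c1 c1; rewrite mulr1 => h; exact: h.
  - move=> n t [/=]; rewrite in_itv/= => tab _.
    have /andP[h1 h2] := e2 n t tab.
    by rewrite normrM ger0_norm// ler_piMl.
have : \forall n \near \oo, eint mu G a b (fun t => eta n t ^+ 2 * beta t) < - (b - a).
  by apply: (cvgr_lt _ lim); lra.
move=> /filter_ex[n hn].
exists (eta n), (deta n); split => //.
rewrite /(nuint _ _ _); have : lint a b (fun t => eta n t ^+ 2) <= b - a.
  have iid : primitive (fun t => 1 * t + 0) (fun=> 1).
    by apply: (@is_derive_primitive _ _ (fun=> 1)) => z; [exact: is_derive_affine|exact: cvg_cst].
  have := increments_eint iid (ltW ab); rewrite !mul1r !addr0 => <-.
  apply: le_eint => //; [exact: continuous_locint|exact: iid.1|].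
  by move=> t _ /(e2 n)/andP[].
by lra.
Qed.

End Picone.

Section NegativeIntervals.
Context {R : realType}.
Local Notation Borel := (measurableTypeR R).
Local Notation leb := (@lebesgue_measure R).
Variables (G : set R) (mu : {finite_measure set Borel -> \bar R}) (beta : R -> R).
Hypothesis cG : closed G.
Hypothesis nG : leb G = 0%E.
Hypothesis beta_integrable : mu.-integrable (G : set Borel) (EFin \o beta).
Variables (A B : R).
Hypothesis AB : A < B.
Hypothesis GAB : forall x, G x -> A < x < B.
Implicit Types (F f g p q r Phi phi psi eta : R -> R) (s t x a b c L M : R).

Let mT := @measurableT _ Borel.
Let mG : measurable (G : set Borel). Proof. exact: closed_measurable. Qed.

Lemma null_gap a b : a < b -> exists c, a < c < b /\ ~ G c.
Proof.
move=> ab; apply: contrapT => h.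
have sub : `]a, b[ `<=` G.
  move=> c; rewrite /= in_itv/= => cab; apply: contrapT => Gc; apply: h; by exists c.
have : (leb `]a, b[%classic <= leb G)%E.
  by apply: le_measure => //; rewrite inE.
rewrite nG /= lebesgue_measure_itv/= lte_fin ab -EFinB lee_fin.
by rewrite leNgt subr_gt0 ab.
Qed.

Definition near_set (K : set R) (d : R) : set R := [set x | exists2 y, K y & `|x - y| < d].

Lemma near_set_measurable (K : set R) d : measurable (near_set K d : set Borel).
Proof.
apply: open_measurable.
have -> : near_set K d = \bigcup_(y in K) ball y d.
  by apply/seteqP; split => x [y Ky h]; exists y => //; move: h; rewrite /ball/= distrC.
by apply: bigcup_open => y _; exact: ball_open.
Qed.

(** A closed set is the decreasing limit of its neighbourhoods. *)
Lemma near_set_cvg (K : set R) t : closed K ->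
  \1_(near_set K n.+1%:R^-1) t @[n --> \oo] --> (\1_K t : R).
Proof.
move=> cK; apply: cvg_near_cst; have [Kt|Kt] := pselect (K t).
  apply: nearW => n; rewrite !indicE !mem_set//.
  by exists t => //; rewrite subrr normr0 invr_gt0.
have : open (~` K) by exact: closed_openC.
rewrite openE => /(_ t Kt) /nbhs_ballP[r r0 hr].
near=> n; rewrite !indicE (memNset Kt) memNset// => -[y Ky ty].
apply: (hr y) => //; rewrite /ball/=; apply: (lt_le_trans ty).
by apply: ltW; near: n; exact: (near_infty_natSinv_lt (PosNum r0)).
Unshelve. all: by end_near. Qed.

(** Dominates beta on a neighbourhood of K, equals beta on K. *)
Definition excess (K : set R) d t := `|beta t| * (\1_(near_set K d) t * (1 - \1_K t)) + beta t * \1_K t.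

(** Upper bound for the nu-measure of [a, b[ when [a, b[ lies in near_set K d,
    and additive in the interval without that restriction. *)
Definition total K d a b : R :=
  eint leb setT a b (\1_(near_set K d)) + eint mu G a b (excess K d).

Lemma indic01 (K : set R) t : 0 <= (\1_K t : R) <= 1.
Proof. by rewrite indicE; case: (t \in K); rewrite ?lexx ?ler01. Qed.

Lemma indic_locbounded (K : set R) : locbounded (\1_K : R -> R).
Proof. by move=> s x; exists 1 => t _; have /andP[h1 h2] := indic01 K t; rewrite ger0_norm. Qed.

Lemma locint_indic_leb (K : set R) : measurable (K : set Borel) -> locint leb setT (\1_K : R -> R).
Proof.
move=> mK; have := locint_mull mT (measurable_indic mK) (@indic_locbounded K) (locint_cst 1).
by congr locint; apply/funext => t; rewrite mulr1.
Qed.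

Lemma measurable_beta s x : measurable_fun (`[s, x[ `&` G : set Borel) (beta : Borel -> R).
Proof. exact: locint_measurable (locint_beta mG beta_integrable). Qed.

Lemma excess_le K d t : `|excess K d t| <= `|beta t|.
Proof.
rewrite /excess !indicE; case: (t \in K); case: (t \in near_set K d) => /=;
  rewrite ?subrr ?mulr0 ?mulr1 ?subr0 ?mulr1 ?mulr0 ?add0r ?addr0 ?normr_id ?normr0//.
Qed.

Lemma excess_measurable (K : set R) d s x : measurable (K : set Borel) ->
  measurable_fun (`[s, x[ `&` G : set Borel) (excess K d : Borel -> R).
Proof.
move=> mK; have mB := @measurable_beta s x.
have mi (D : set R) : measurable (D : set Borel) -> measurable_fun (`[s, x[ `&` G : set Borel) (\1_D : Borel -> R).
  by move=> mD; exact: measurable_indic.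
apply: measurable_funD; apply: measurable_funM => //.
- exact: measurableT_comp.
- by apply: measurable_funM; [by apply: mi; exact: near_set_measurable|apply: measurable_funB => //; exact: mi].
Qed.

Lemma locint_excess (K : set R) d : measurable (K : set Borel) -> locint mu G (excess K d).
Proof.
move=> mK; apply: (@locint_le _ _ _ mG _ (fun t => `|beta t|)).
- by move=> s x; exact: excess_measurable.
- exact: (locint_norm (locint_beta mG beta_integrable)).
- by move=> t _; exact: excess_le.
Qed.

(** As d decreases to 0 the first term of [total] tends to the Lebesgue measure
    of K, which is 0, and the second to the integral of beta over K, at most
    - eps mu K. *)
Lemma total_negative (K : set R) eps : closed K -> K `<=` G -> 0 < eps ->
  (0 < mu K)%E -> (forall x, K x -> beta x <= - eps) ->
  exists n : nat, total K n.+1%:R^-1 A B < 0.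
Proof.
move=> cK KG e0 muK hK.
have mK : measurable (K : set Borel) by exact: closed_measurable.
have lim1 : eint leb setT A B (\1_(near_set K n.+1%:R^-1)) @[n --> \oo] --> eint leb setT A B (\1_K).
  apply: (@Rintegral_dominated _ _ _ leb _ (fun n => \1_(near_set K n.+1%:R^-1)) (\1_K) (fun=> 1)).
  - exact: measurable_itvE.
  - exact: (locint_cst 1 A B).
  - by move=> n; apply: measurable_indic; exact: near_set_measurable.
  - exact: measurable_indic.
  - by apply: aeW => t _; exact: near_set_cvg.
  - by move=> n t _; have /andP[h1 h2] := indic01 (near_set K n.+1%:R^-1) t; rewrite ger0_norm.
have lim2 : eint mu G A B (excess K n.+1%:R^-1) @[n --> \oo] --> eint mu G A B (fun t => beta t * \1_K t).
  apply: (@Rintegral_dominated _ _ _ mu _ (fun n => excess K n.+1%:R^-1) (fun t => beta t * \1_K t) (fun t => `|beta t|)).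
  - exact: measurable_itvE.
  - exact: (integrable_norm (locint_beta mG beta_integrable A B)).
  - by move=> n; exact: excess_measurable.
  - by apply: measurable_funM; [exact: measurable_beta|exact: measurable_indic].
  - apply: aeW => t _; rewrite /excess -[X in _ --> X]add0r; apply: cvgD; last exact: cvg_cst.
    have h : (\1_(near_set K n.+1%:R^-1) t * (1 - \1_K t) : R) @[n --> \oo] --> (\1_K t * (1 - \1_K t) : R).
      by apply: cvgM; [exact: near_set_cvg|exact: cvg_cst].
    have e : (\1_K t * (1 - \1_K t) : R) = 0.
      by rewrite indicE; case: (t \in K); rewrite /= ?subrr ?mulr0 ?mul0r.
    rewrite e in h; rewrite -(mulr0 `|beta t|).
    by apply: cvgM; [exact: cvg_cst|exact: h].
  - by move=> n t _; exact: excess_le.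
have z1 : eint leb setT A B (\1_K) = 0.
  rewrite /eint /Rintegral integral_indic//; last exact: measurable_itvE.
  have h : leb (K `&` (`[A, B[ `&` setT)) = 0%E.
    apply/eqP; rewrite -measure_le0 -nG le_measure ?inE//.
      by apply: measurableI => //; exact: measurable_itvE.
    by move=> t [/KG].
  exact: (congr1 (@fine _) h).
have z2 : eint mu G A B (fun t => beta t * \1_K t) < 0.
  have iK : locint mu G (fun t => (- eps) * \1_K t).
    have ic : locint mu G (fun=> - eps).
      by move=> s x; apply: finite_measure_integrable_cst; exact: measurable_itvE.
    have := locint_mull mG (measurable_indic mK) (@indic_locbounded K) ic.
    by congr locint; apply/funext => t; rewrite mulrC.
  have iB : locint mu G (fun t => beta t * \1_K t).
    have := locint_mull mG (measurable_indic mK) (@indic_locbounded K) (locint_beta mG beta_integrable).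
    by congr locint; apply/funext => t; rewrite mulrC.
  apply: (@le_lt_trans _ _ (eint mu G A B (fun t => (- eps) * \1_K t))).
    apply: le_eint => // t Gt _; rewrite indicE; have [Kt|Kt] := pselect (K t).
      by rewrite mem_set// !mulr1 hK.
    by rewrite memNset// !mulr0.
  have i1 : mu.-integrable (`[A, B[ `&` G) (EFin \o (\1_K : R -> R)).
    have ic : locint mu G (fun=> 1).
      by move=> s x; apply: finite_measure_integrable_cst; exact: measurable_itvE.
    have := locint_mull mG (measurable_indic mK) (@indic_locbounded K) ic A B.
    by congr (_.-integrable _ _); apply/funext => t /=; rewrite mulr1.
  rewrite /eint RintegralZl//; last exact: measurable_itvE.
  rewrite mulNr oppr_lt0 mulr_gt0// /Rintegral integral_indic//; last exact: measurable_itvE.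
  rewrite (_ : K `&` _ = K); last first.
    apply/seteqP; split => [t []//|t Kt]; split => //; split; last exact: KG.
    by rewrite /= in_itv/=; have /andP[h1 h2] := GAB (KG t Kt); rewrite (ltW h1).
  by apply: fine_gt0; rewrite muK/= ltey_eq fin_num_measure.
have lim : total K n.+1%:R^-1 A B @[n --> \oo] -->
    eint leb setT A B (\1_K) + eint mu G A B (fun t => beta t * \1_K t).
  by apply: cvgD.
have : \forall n \near \oo, total K n.+1%:R^-1 A B < 0.
  by apply: (cvgr_lt _ lim); rewrite z1 add0r.
by move=> /filter_ex[n hn]; exists n.
Qed.

(** Cutting at a point off G in the middle third: one of the two pieces keeps a
    negative total. *)
Lemma short_negative_interval (K : set R) d n : measurable (K : set Borel) -> total K d A B < 0 ->
  exists a b, [/\ a < b, b - a <= (2 / 3) ^+ n * (B - A), ~ G a & total K d a b < 0].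
Proof.
move=> mK tot; elim: n => [|n [a [b [ab ban Ga tab]]]].
  by exists A, B; split => //; [rewrite expr0 mul1r|move=> /GAB; rewrite ltxx].
have third : a + (b - a) / 3 < b - (b - a) / 3 by lra.
have [c [/andP[c1 c2] Gc]] := null_gap third.
have ac : a <= c by lra.
have cb : c <= b by lra.
have p1 : b - (b - a) / 3 - a = 2 / 3 * (b - a) by field.
have h : total K d a b = total K d a c + total K d c b.
  rewrite /total (eintD mT (locint_indic_leb (near_set_measurable K d)) ac cb).
  by rewrite (eintD mG (locint_excess d mK) ac cb); ring.
have l : 2 / 3 * (b - a) <= (2 / 3) ^+ n.+1 * (B - A).
  rewrite (_ : (2 / 3) ^+ n.+1 * (B - A) = 2 / 3 * ((2 / 3) ^+ n * (B - A))).
    by rewrite ler_wpM2l// divr_ge0.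
  by rewrite exprS; ring.
have [tac|tac] := ltP (total K d a c) 0.
  by exists a, c; split => //; lra.
by exists c, b; split => //; lra.
Qed.

(** An interval of negative total meets K, since [total] is nonnegative away
    from K; if it is shorter than d it lies within distance d of K, where [total]
    bounds the nu-measure from above. *)
Lemma negative_interval (K : set R) eps delta : closed K -> K `<=` G -> 0 < eps ->
  (0 < mu K)%E -> (forall x, K x -> beta x <= - eps) -> 0 < delta ->
  exists a b, [/\ a < b, b - a < delta, ~ G a, exists2 x, K x & a <= x <= b &
    b - a + eint mu G a b beta < 0].
Proof.
move=> cK KG e0 muK hK d0; have [n0 tot] := total_negative cK KG e0 muK hK.
have mK : measurable (K : set Borel) by exact: closed_measurable.
set d := n0.+1%:R^-1 in tot.
have dd0 : 0 < d by rewrite invr_gt0.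
pose m := Num.min delta d.
have m0 : 0 < m by rewrite lt_min d0.
have [n hn] : exists n, (2 / 3) ^+ n * (B - A) < m.
  have : (2 / 3) ^+ n * (B - A) @[n --> \oo] --> (0 * (B - A) : R).
    by apply: cvgM; [apply: cvg_expr; rewrite ger0_norm; lra|exact: cvg_cst].
  rewrite mul0r => /cvgr_lt /(_ m m0) /filter_ex[n hn].
  by exists n.
have [a [b [ab ba Ga tab]]] := short_negative_interval n mK tot.
have bam : b - a < m by exact: le_lt_trans hn.
have bad : b - a < delta by apply: (lt_le_trans bam); rewrite ge_min lexx.
have bad' : b - a < d by apply: (lt_le_trans bam); rewrite ge_min lexx orbT.
have [x [Kx /andP[ax xb]]] : exists x, K x /\ a <= x < b.
  apply: contrapT => hno; move: tab; rewrite ltNge => /negP; apply.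
  apply: addr_ge0; apply: eint_ge0 => t _ tab; first by have /andP[] := indic01 (near_set K d) t.
  rewrite /excess; have Kt : ~ K t by move=> Kt; apply: hno; exists t.
  rewrite (_ : \1_K t = 0) ?mulr0 ?addr0 ?subr0 ?mulr1; last by rewrite indicE memNset.
  by rewrite mulr_ge0//; have /andP[] := indic01 (near_set K d) t.
exists a, b; split => //; first by exists x => //; rewrite ax ltW.
apply: le_lt_trans tab; rewrite /total.
have inN t : a <= t < b -> \1_(near_set K d) t = 1 :> R.
  move=> /andP[at_ tb]; rewrite indicE mem_set//; exists x => //.
  by rewrite (le_lt_trans _ bad')// ler_norml; apply/andP; split; lra.
apply: lerD.
  have iid : primitive (fun t => 1 * t + 0) (fun=> 1).
    by apply: (@is_derive_primitive _ _ (fun=> 1)) => z; [exact: is_derive_affine|exact: cvg_cst].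
  have := increments_eint iid (ltW ab); rewrite !mul1r !addr0 => <-.
  rewrite le_eqVlt; apply/orP; left; apply/eqP; apply: eq_eint => t _ tI.
  by rewrite inN.
apply: le_eint => //; [exact: locint_beta|exact: locint_excess|].
move=> t Gt tI; rewrite /excess (inN t tI) mul1r indicE; case: (t \in K) => /=.
  by rewrite subrr mulr0 add0r mulr1.
by rewrite subr0 mulr1 mulr0 addr0 ler_norm.
Qed.

Lemma compact_separated (K1 K2 : set R) : closed K1 -> closed K2 -> K1 `<=` G -> K2 `<=` G ->
  K1 `&` K2 = set0 -> exists2 d, 0 < d & forall x y, K1 x -> K2 y -> d <= `|x - y|.
Proof.
move=> c1 c2 s1 s2 K12.
have comp (K : set R) : closed K -> K `<=` G -> compact K.
  move=> cK KG; apply: (subclosed_compact cK (@segment_compact _ A B)) => x /KG /GAB /andP[h1 h2].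
  by rewrite /= in_itv/= !ltW.
have cX := compact_setX (comp _ c1 s1) (comp _ c2 s2).
have cf : {within K1 `*` K2, continuous (fun z : R * R => z.1 - z.2)}.
  by apply: continuous_subspaceT => z; apply: cvgB; [exact: cvg_fst|exact: cvg_snd].
have ci := continuous_compact cf cX.
have cl := compact_closed (@Rhausdorff R) ci.
have n0 : (~` ((fun z : R * R => z.1 - z.2) @` (K1 `*` K2))) 0.
  move=> [[x y] /= [K1x K2y] /eqP]; rewrite subr_eq0 => /eqP xy.
  have hx : (K1 `&` K2) x by split => //; rewrite xy.
  by move: hx; rewrite K12.
have : open (~` ((fun z : R * R => z.1 - z.2) @` (K1 `*` K2))) by exact: closed_openC.
rewrite openE => /(_ 0 n0) /nbhs_ballP[r r0 hr].
exists r => // x y K1x K2y; rewrite leNgt; apply/negP => h.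
apply: (hr (x - y)); first by rewrite /ball/= sub0r normrN.
by exists (x, y).
Qed.

Lemma finite_min (I : finType) (P : I -> R -> Prop) :
  (forall i e e', P i e -> 0 < e' -> e' <= e -> P i e') ->
  (forall i, exists2 e, 0 < e & P i e) -> exists2 e, 0 < e & forall i, P i e.
Proof.
move=> mono ex; have ex' i : exists e, 0 < e /\ P i e by have [e e0 Pe] := ex i; exists e.
have [f hf] := choice ex'.
exists (\big[Num.min/1]_i f i).
  by apply: lt_bigmin => // i _; case: (hf i).
move=> i; have [h1 h2] := hf i.
apply: (mono i (f i)) => //; last exact: bigmin_le.
by apply: lt_bigmin => // j _; case: (hf j).
Qed.

(** Each of the N sets yields, by [negative_interval] and [bump_exists], an
    interval in which Phi must vanish for large kap by [picone]; intervals
    shorter than half the mutual distance of the sets are disjoint. *)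
Lemma many_zeros : negative_on_infinitely_many G mu beta ->
  forall N : nat, exists K, forall kap psi Phi, K <= kap -> jost G mu beta A kap psi Phi ->
     exists sz : seq R, [/\ uniq sz, size sz = N & forall z, z \in sz -> Phi z = 0].
Proof.
move=> neg N; have [eps [Gk [e0 triv hGk]]] := neg N.
have [d d0 hd] : exists2 d, 0 < d & forall p : 'I_N * 'I_N, p.1 != p.2 ->
    forall x y, Gk p.1 x -> Gk p.2 y -> d <= `|x - y|.
  apply: (@finite_min ('I_N * 'I_N)%type (fun (p : 'I_N * 'I_N) (d : R) => p.1 != p.2 -> forall x y, Gk p.1 x -> Gk p.2 y -> d <= `|x - y|)).
    by move=> p e e' h _ ee ne x y h1 h2; rewrite (le_trans ee)// h.
  move=> [i j]; have [->|ij] := eqVneq i j; first by exists 1 => //=; rewrite eqxx.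
  have [ci _ si _ _] := hGk i; have [cj _ sj _ _] := hGk j.
  have dij : Gk i `&` Gk j = set0.
    by move/trivIsetP : triv => /(_ i j I I ij).
  by have [r r0 hr] := compact_separated ci cj si sj dij; exists r => // _; exact: hr.
have ex k : exists s : R * R, [/\ s.1 < s.2, s.2 - s.1 < d / 2, ~ G s.1,
    exists2 x, Gk k x & s.1 <= x <= s.2 & s.2 - s.1 + eint mu G s.1 s.2 beta < 0].
  have [ck _ sk mk bk] := hGk k.
  have [a [b h]] := negative_interval ck sk e0 mk bk (divr_gt0 d0 (ltr0n _ 2)).
  by exists (a, b).
have [J hJ] := choice ex.
have exK k : exists K, forall kap psi Phi, K <= kap -> jost G mu beta A kap psi Phi ->
    exists2 z, (J k).1 <= z <= (J k).2 & Phi z = 0.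
  have [ab _ Ga _ ng] := hJ k.
  have [eta [deta [ieta cdeta ea eb nneg]]] := bump_exists mG beta_integrable ab Ga ng.
  set a := (J k).1 in ab ng ieta ea nneg *; set b := (J k).2 in ab ng eb nneg *.
  set I := lint a b (fun t => deta t ^+ 2).
  set m := nuint G mu beta a b _ in nneg.
  exists (Num.max 1 (1 + `|I| / - m)) => kap psi Phi; rewrite ge_max => /andP[k1 k2] [S _ _].
  apply: contrapT => hno.
  have k0 : 0 < kap by lra.
  have Phi0 x : a <= x <= b -> Phi x != 0 by move=> xab; apply/eqP => P0; apply: hno; exists x.
  have := picone mG beta_integrable (ltW ab) k0 S Phi0 ieta cdeta ea eb; rewrite -/I -/m.
  have m0 : 0 < - m by rewrite oppr_gt0.
  have : `|I| < kap * - m by rewrite -ltr_pdivrMr//; lra.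
  have kk : kap * - m <= kap ^+ 2 * - m by rewrite ler_wpM2r ?(ltW m0)// expr2 ler_peMr ?(ltW k0).
  have := ler_norm I; rewrite !mulrN in kk *; lra.
have [Kk hKk] := choice exK.
exists (\big[Num.max/0]_k Kk k) => kap psi Phi hkap Jk.
have exz k : exists z, (J k).1 <= z <= (J k).2 /\ Phi z = 0.
  have [|z z1 z2] := hKk k kap psi Phi _ Jk; last by exists z.
  by rewrite (le_trans _ hkap)//; exact: le_bigmax.
have [z hz] := choice exz.
exists (map z (enum 'I_N)); split.
- rewrite map_inj_uniq ?enum_uniq// => i j zij; apply/eqP/negP => /negP ij.
  have [_ li _ [x Gx /andP[x1 x2]] _] := hJ i; have [_ lj _ [y Gy /andP[y1 y2]] _] := hJ j.
  have [/andP[a1 a2] _] := hz i; have [/andP[b1 b2] _] := hz j; rewrite zij in a1 a2.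
  have := hd (i, j) ij x y Gx Gy; rewrite leNgt => /negP; apply.
  rewrite (_ : x - y = (x - z j) + (z j - y)); last by ring.
  apply: (le_lt_trans (ler_normD _ _)).
  have h1 : `|x - z j| <= (J i).2 - (J i).1 by rewrite ler_norml; apply/andP; split; lra.
  have h2 : `|z j - y| <= (J j).2 - (J j).1 by rewrite ler_norml; apply/andP; split; lra.
  by lra.
- by rewrite size_map -cardE card_ord.
- by move=> _ /mapP[k _ ->]; case: (hz k).
Qed.

End NegativeIntervals.

(** * The operator on real square-integrable functions *)

Section SquareIntegrable.
Context {R : realType}.
Local Notation Borel := (measurableTypeR R).
Local Notation leb := (@lebesgue_measure R).
Implicit Types (p q : R -> R) (s x a b C : R).
Let mT := @measurableT _ Borel.

Lemma lebS (P Q : R -> Prop) : (forall x, P x -> Q x) ->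
  {ae leb, forall x, P x} -> {ae leb, forall x, Q x}.
Proof. by move=> PQ; apply: filterS; [exact: (ae_filter_ringOfSetsType leb)|exact: PQ]. Qed.

Lemma lebS2 (P P' Q : R -> Prop) : (forall x, P x -> P' x -> Q x) ->
  {ae leb, forall x, P x} -> {ae leb, forall x, P' x} -> {ae leb, forall x, Q x}.
Proof. by move=> PQ; apply: filterS2; [exact: (ae_filter_ringOfSetsType leb)|exact: PQ]. Qed.

Definition L2r (D : set R) p :=
  measurable_fun (D : set Borel) (p : Borel -> R) /\
  leb.-integrable (D : set Borel) (EFin \o (fun t => p t ^+ 2)).

Lemma integrable_locint p : leb.-integrable (setT : set Borel) (EFin \o p) -> locint leb setT p.
Proof. by move=> ip s x; apply: integrableS ip => //; exact: measurable_itvE. Qed.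

Lemma measurable_sqr (D : set Borel) p : measurable_fun D (p : Borel -> R) ->
  measurable_fun D ((fun t => p t ^+ 2) : Borel -> R).
Proof. by move=> mp; apply: measurable_funX. Qed.

Lemma L2r_mul p q : L2r setT p -> L2r setT q ->
  leb.-integrable (setT : set Borel) (EFin \o (fun t => p t * q t)).
Proof.
move=> [mp ip] [mq iq].
have i2 : leb.-integrable setT (EFin \o (fun t => p t ^+ 2 + q t ^+ 2)).
  exact: (@integrableD _ _ _ _ _ mT (EFin \o (fun t => p t ^+ 2)) (EFin \o (fun t => q t ^+ 2))).
apply: (le_integrable _ _ _ i2) => //.
  by apply/measurable_EFinP; exact: measurable_funM.
move=> t _ /=; rewrite lee_fin normrM [leRHS]ger0_norm ?addr_ge0 ?sqr_ge0//.
rewrite -(real_normK (num_real (p t))) -(real_normK (num_real (q t))).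
have := sqr_ge0 (`|p t| - `|q t|); have := normr_ge0 (p t); have := normr_ge0 (q t).
set u := `|p t|; set v := `|q t| => v0 u0; rewrite sqrrB.
have : 0 <= u * v by rewrite mulr_ge0.
by rewrite mulr2n; set w := u * v; lra.
Qed.

Lemma L2r_linear a b p q : L2r setT p -> L2r setT q -> L2r setT (fun t => a * p t + b * q t).
Proof.
move=> Lp Lq; have [mp ip] := Lp; have [mq iq] := Lq; have ipq := L2r_mul Lp Lq.
split; first by apply: measurable_funD; apply: measurable_funM => //; exact: measurable_cst.
have -> : (EFin \o (fun t => (a * p t + b * q t) ^+ 2)) =
   (EFin \o (fun t => a ^+ 2 * p t ^+ 2)) \+ ((EFin \o (fun t => (2 * a * b) * (p t * q t))) \+
   (EFin \o (fun t => b ^+ 2 * q t ^+ 2))).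
  by apply/funext => t /=; rewrite -!EFinD; congr EFin; ring.
apply: integrableD => //; [|apply: integrableD => //].
- exact: (@integrableZl _ _ _ _ _ mT (a ^+ 2) (EFin \o (fun t => p t ^+ 2))).
- exact: (@integrableZl _ _ _ _ _ mT (2 * a * b) (EFin \o (fun t => p t * q t))).
- exact: (@integrableZl _ _ _ _ _ mT (b ^+ 2) (EFin \o (fun t => q t ^+ 2))).
Qed.

Lemma L2rN p : L2r setT p -> L2r setT (fun t => - p t).
Proof.
move=> Lp; have := L2r_linear (-1) 0 Lp Lp.
by congr L2r; apply/funext => t; ring.
Qed.

Lemma L2r_locint p : L2r setT p -> locint leb setT p.
Proof.
move=> [mp ip]; apply: (@locint_le _ _ _ mT _ (fun t => 1 * 1 + 1 * p t ^+ 2)).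
- by move=> s x; exact: measurable_funS mp.
- by apply: (locint_linear mT 1 1 (locint_cst 1)); exact: integrable_locint.
- move=> t _; rewrite !mul1r; have := sqr_ge0 (`|p t| - 1); have := normr_ge0 (p t).
  rewrite -[p t ^+ 2]real_normK ?num_real// sqrrB mulr1 expr1n mulr2n.
  by set u := `|p t|; set w := u ^+ 2; lra.
Qed.

Lemma L2r_locint2 p : L2r setT p -> locint leb setT (fun t => p t ^+ 2).
Proof. by move=> [_]; exact: integrable_locint. Qed.

Lemma L2r_ae p q : L2r setT p -> measurable_fun (setT : set Borel) (q : Borel -> R) ->
  {ae leb, forall x, p x = q x} -> L2r setT q.
Proof.
move=> [mp ip] mq pq; split => //.
have [_ fin] := integrableP _ _ _ ip.
apply/integrableP; split; first by apply/measurable_EFinP; exact: measurable_sqr.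
apply: le_lt_trans fin; rewrite le_eqVlt; apply/orP; left; apply/eqP.
apply: ge0_ae_eq_integral => //.
- by apply: measurableT_comp => //; apply/measurable_EFinP; exact: measurable_sqr.
- by apply: measurableT_comp => //; apply/measurable_EFinP; exact: measurable_sqr.
- by apply: lebS pq => t /= -> _.
Qed.

Lemma L2r_cut p s x : measurable_fun (setT : set Borel) (p : Borel -> R) ->
  locint leb setT (fun t => p t ^+ 2) -> L2r setT (fun t => p t * \1_(`[s, x[%classic) t).
Proof.
move=> mp ip; split; first by apply: measurable_funM => //; exact: measurable_indic.
have := ip s x; rewrite setIT => h.
have : leb.-integrable setT ((EFin \o (fun t => p t ^+ 2)) \_ `[s, x[).
  by apply/integrable_restrict => //; rewrite setTI.
apply: eq_integrable => // t _; rewrite /= patchE indicE.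
by case: (t \in _) => /=; rewrite ?mulr1// mulr0 expr0n.
Qed.

Lemma Rintegral_linear a b p q :
  leb.-integrable (setT : set Borel) (EFin \o p) -> leb.-integrable (setT : set Borel) (EFin \o q) ->
  \int[leb]_t (a * p t + b * q t) = a * \int[leb]_t p t + b * \int[leb]_t q t.
Proof.
move=> ip iq; rewrite RintegralD//; first by rewrite !RintegralZl.
- exact: (@integrableZl _ _ _ _ _ mT a (EFin \o p)).
- exact: (@integrableZl _ _ _ _ _ mT b (EFin \o q)).
Qed.

Lemma lint_ind s x p : lint s x p = \int[leb]_t (p t * \1_(`[s, x[%classic) t).
Proof.
rewrite /lint /eint setIT Rintegral_mkcond; apply: eq_Rintegral => t _.
by rewrite patchE indicE; case: (t \in _); rewrite ?mulr1 ?mulr0.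
Qed.

Lemma ae_eq_Rintegral p q : measurable_fun (setT : set Borel) (p : Borel -> R) ->
  measurable_fun (setT : set Borel) (q : Borel -> R) ->
  {ae leb, forall x, p x = q x} -> \int[leb]_t p t = \int[leb]_t q t.
Proof.
move=> mp mq pq; rewrite /Rintegral; congr fine; apply: ae_eq_integral => //.
- exact/measurable_EFinP.
- exact/measurable_EFinP.
- by apply: lebS pq => t /= -> _.
Qed.

Lemma lint_cvg p : leb.-integrable (setT : set Borel) (EFin \o p) ->
  lint (- n%:R) n%:R p @[n --> \oo] --> \int[leb]_t p t.
Proof.
move=> ip; have mp : measurable_fun (setT : set Borel) (p : Borel -> R).
  by case/integrableP : ip => /measurable_EFinP.
under eq_fun do rewrite lint_ind.
apply: (@Rintegral_dominated _ _ _ leb setT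
  (fun n t => p t * \1_(`[- n%:R, n%:R[%classic) t) p (fun t => `|p t|)) => //.
- exact: integrable_norm.
- by move=> n; apply: measurable_funM => //; exact: measurable_indic.
- apply: aeW => t _; apply: cvg_near_cst; near=> n.
  rewrite indicE mem_set ?mulr1//= in_itv/=; have tn : `|t| < n%:R.
    by near: n; exact: nbhs_infty_gtr.
  by move: tn; rewrite ltr_norml => /andP[/ltW -> ->].
- move=> n t _; rewrite normrM ler_piMr//.
  by rewrite indicE; case: (t \in _); rewrite ?normr1 ?normr0.
Unshelve. all: by end_near. Qed.

Lemma integrable_bounded_lint p C : measurable_fun (setT : set Borel) (p : Borel -> R) ->
  (forall t, 0 <= p t) -> locint leb setT p ->
  (\forall n \near \oo, lint (- n%:R) n%:R p <= C) ->
  leb.-integrable (setT : set Borel) (EFin \o p).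
Proof.
move=> mp p0 ip hC; apply/integrableP; split; first exact/measurable_EFinP.
pose F (n : nat) : set Borel := `[- n%:R, n%:R[%classic.
have Fm n : measurable (F n) by exact: measurable_itv.
have FT : \bigcup_n F n = setT.
  apply/seteqP; split => // t _; exists (Num.truncn `|t|).+1 => //.
  rewrite /F/= in_itv/=; have tn : `|t| < (Num.truncn `|t|).+1%:R.
    by case/andP : (Num.Theory.truncn_itv (normr_ge0 t)).
  by move: tn; rewrite ltr_norml => /andP[/ltW -> ->].
have h : (\int[leb]_(x in F i) `|(p x)%:E|)%E @[i --> \oo] -->
    (\int[leb]_(x in \bigcup_i F i) `|(p x)%:E|)%E.
  apply: ge0_nondecreasing_set_cvg_integral => //.
  - move=> n m nm; apply/subsetPset => t; rewrite /F/= !in_itv/= => /andP[h1 h2].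
    have nmR : n%:R <= m%:R :> R by rewrite ler_nat.
    by rewrite (le_trans _ h1) ?lerN2//= (lt_le_trans h2).
  - move=> n; apply: measurableT_comp => //; apply/measurable_EFinP.
    exact: measurable_funS mp.
rewrite FT in h.
apply: (@le_lt_trans _ _ C%:E); last exact: ltry.
rewrite -(cvg_lim _ h)//; apply: lime_le; first by apply/cvg_ex; eexists; exact: h.
apply: filterS hC => n hn.
have -> : (\int[leb]_(x in F n) `|(p x)%:E|)%E = (lint (- n%:R) n%:R p)%:E.
  rewrite /lint /eint /Rintegral setIT fineK.
    by apply: eq_integral => t _ /=; rewrite ger0_norm.
  by apply: integrable_fin_num => //; have := ip (- n%:R) n%:R; rewrite setIT.
by rewrite lee_fin.
Qed.

Lemma sqr_Rintegral_eq0 p : L2r setT p -> \int[leb]_t (p t ^+ 2) = 0 -> {ae leb, forall x, p x = 0}.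
Proof.
move=> [mp ip] h.
have h2 : (\int[leb]_x `|(p x ^+ 2)%:E| = 0)%E.
  have -> : (\int[leb]_x `|(p x ^+ 2)%:E| = \int[leb]_x (p x ^+ 2)%:E)%E.
    by apply: eq_integral => t _ /=; rewrite ger0_norm// sqr_ge0.
  by rewrite -[LHS]fineK ?(integrable_fin_num _ ip)// -/(Rintegral _ _ _) h.
have m2 : measurable_fun setT (EFin \o (fun t => p t ^+ 2)).
  by apply/measurable_EFinP; exact: measurable_sqr.
have := (ae_eq_integral_abs _ mT m2).1 h2.
by apply: lebS => t /(_ I) /= [] /eqP; rewrite sqrf_eq0 => /eqP.
Qed.

End SquareIntegrable.

Section RealGraph.
Context {R : realType}.
Local Notation Borel := (measurableTypeR R).
Local Notation leb := (@lebesgue_measure R).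
Variables (G : set R) (mu : {finite_measure set Borel -> \bar R}) (beta : R -> R).
Hypothesis mG : measurable (G : set Borel).
Hypothesis beta_integrable : mu.-integrable (G : set Borel) (EFin \o beta).
Variables (A B : R).
Hypothesis AB : A < B.
Hypothesis GAB : forall x, G x -> A < x < B.
Implicit Types (F f g p q u v w Phi phi psi : R -> R) (s t x a b c r : R).

Let mT := @measurableT _ Borel.
Local Notation nuprim := (nuprim G mu beta).
Local Notation nuint := (nuint G mu beta).

(** The operator on real-valued functions: u is represented by a function psi
    of bounded variation, and v = -Phi' where Phi is its quasi-derivative. *)
Definition real_graph u v := [/\ L2r setT u, L2r setT v &
  exists psi Phi, [/\ primitive Phi (fun t => - v t), nuprim psi Phi &
    {ae leb, forall x, u x = psi x}]].

Lemma eint_support s x f : s <= A -> B <= x -> eint mu G s x f = eint mu G A B f.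
Proof.
move=> sA Bx; rewrite /eint; congr Rintegral; apply/seteqP; split => t [/= _ Gt]; split => //;
  rewrite /= in_itv/=; have /andP[h1 h2] := GAB Gt.
  by rewrite (ltW h1).
by rewrite (le_trans sA (ltW h1)) (lt_le_trans h2).
Qed.

(** Removes the boundary terms at - r and r, where it vanishes; its derivative
    between them is O(1 / r). *)
Definition cutoff r t := 1 - r^-2 * (t * t).

Lemma cutoff_primitive r : primitive (cutoff r) (fun t => - (r^-2 * (t + t))).
Proof.
have i1 : primitive id (fun=> 1 : R).
  by apply: (@is_derive_primitive _ id (fun=> 1)) => x; exact: cvg_cst.
have := increments_linear mT 1 (- r^-2) (increments_cst leb mT 1) (primitiveM i1 i1).
congr increments; apply/funext => t; rewrite /cutoff; ring.
Qed.

Lemma cutoff01 r t : 0 < r -> - r <= t < r -> 0 <= cutoff r t <= 1.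
Proof.
move=> r0 /andP[t1 t2]; rewrite /cutoff.
have tt : t * t <= r ^+ 2.
  by rewrite -expr2 -[t ^+ 2]real_normK ?num_real// ler_pXn2r ?nnegrE ?(ltW r0)// ler_norml t1 ltW.
have h : r^-2 * (t * t) <= 1 by rewrite mulrC ler_pdivrMr ?exprn_gt0// mul1r.
have h0 : 0 <= r^-2 * (t * t) by rewrite mulr_ge0 ?invr_ge0 ?exprn_ge0 ?(ltW r0)// -expr2 sqr_ge0.
by apply/andP; split; lra.
Qed.

Lemma cutoff_deriv r t : 0 < r -> - r <= t < r -> `|- (r^-2 * (t + t))| <= 2 / r.
Proof.
move=> r0 /andP[t1 t2].
have -> : - (r^-2 * (t + t)) = - (2 / r * (t / r)) by field; rewrite gt_eqF.
rewrite normrN normrM ger0_norm ?divr_ge0 ?(ltW r0)// ler_piMr ?divr_ge0 ?(ltW r0)//.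
rewrite normrM normfV (gtr0_norm r0) ler_pdivrMr// mul1r ler_norml t1 ltW//.
Qed.

Lemma cutoff_end r : 0 < r -> cutoff r r = 0 /\ cutoff r (- r) = 0.
Proof. by move=> r0; rewrite /cutoff; split; field; rewrite gt_eqF. Qed.

Lemma lint_le_int s x p : leb.-integrable (setT : set Borel) (EFin \o p) -> (forall t, 0 <= p t) ->
  lint s x p <= \int[leb]_t p t.
Proof.
move=> ip p0; rewrite lint_ind.
have mp : measurable_fun (setT : set Borel) (p : Borel -> R) by case/integrableP : ip => /measurable_EFinP.
apply: le_Rintegral => //.
  apply: (le_integrable _ _ _ ip) => //.
    by apply/measurable_EFinP; apply: measurable_funM => //; exact: measurable_indic.
  move=> t _ /=; rewrite lee_fin normrM ler_piMr// indicE.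
  by case: (t \in _); rewrite ?normr1 ?normr0.
by move=> t _; rewrite ler_piMr// indicE; case: (t \in _).
Qed.

(** Integration by parts of z^2 Phi against psi, z a cutoff, bounds the integral
    of z^2 Phi^2 by those of psi^2 and v^2, up to a term over G which does not
    depend on the cutoff. *)
Lemma quasiderivative_L2 psi Phi v : L2r setT psi -> L2r setT v ->
  primitive Phi (fun t => - v t) -> nuprim psi Phi -> L2r setT Phi.
Proof.
move=> Lpsi Lv iPhi npsi.
have cPhi := primitive_continuous iPhi.
have mPhi := continuous_measurable cPhi.
split => //.
pose c1 := eint mu G A B (fun t => Phi t ^+ 2 * `|beta t|).
pose C0 := 9 * \int[leb]_t (psi t ^+ 2) + \int[leb]_t (v t ^+ 2) + c1.
have cPhi2 : continuous (fun t => Phi t ^+ 2).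
  by move=> t; apply: (@continuous_comp _ _ _ Phi (fun y : R => y ^+ 2)); [exact: cPhi|exact: exprn_continuous].
have iPhi2 := continuous_locint cPhi2.
apply: (integrable_bounded_lint (C := 4 * C0)) => //; first exact: measurable_sqr.
  by move=> t; exact: sqr_ge0.
(* The cutoff at r = 2 n is at least 3 / 4 on [- n, n]. *)
near=> n; pose r : R := 2 * n%:R.
have n1 : 1 <= n%:R :> R by near: n; exact: nbhs_infty_ger.
have nA : - A <= n%:R by near: n; exact: nbhs_infty_ger.
have nB : B <= n%:R by near: n; exact: nbhs_infty_ger.
have rA : - r <= A by rewrite /r; lra.
have rB : B <= r by rewrite /r; lra.
have r1 : 1 <= r by rewrite /r; lra.
have r0 : 0 < r by lra.
have rr : - r <= r by lra.
pose z := cutoff r; pose dz t := - (r^-2 * (t + t)).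
have iz : primitive z dz by exact: cutoff_primitive.
have iF := primitiveM (primitiveM iz iz) iPhi.
have := nuprim_by_parts mG beta_integrable rr iF cPhi npsi.
have [zr zr'] : z r = 0 /\ z (- r) = 0 := cutoff_end r0; rewrite zr zr' !mul0r subrr.
set p := (fun t => _ + _) in iF *.
pose S t := z t * z t * Phi t * Phi t.
have cz := primitive_continuous iz.
have cS : continuous S by move=> t; do !apply: cvgM; [exact: cz|exact: cz|exact: cPhi|exact: cPhi].
rewrite (_ : nuint _ _ _ = lint (- r) r S + eint mu G (- r) r (fun t => S t * beta t))//.
have Sle t : - r <= t < r -> 0 <= S t <= Phi t ^+ 2.
  move=> tr; have /andP[z0 z1] := cutoff01 r0 tr.
  have -> : S t = (z t * z t) * Phi t ^+ 2 by rewrite /S; ring.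
  by rewrite mulr_ge0 ?sqr_ge0 ?mulr_ge0//= ler_piMl ?sqr_ge0// mulr_ile1.
have b1 : `|eint mu G (- r) r (fun t => S t * beta t)| <= c1.
  rewrite /c1 -(@eint_support (- r) r)//.
  have i2 : locint mu G (fun t => Phi t ^+ 2 * `|beta t|).
    apply: (locint_mull mG (continuous_measurable cPhi2) (continuous_locbounded cPhi2)).
    exact: (locint_norm (locint_beta mG beta_integrable)).
  apply: eint_bound => //; first exact: locint_fbeta.
  by move=> t _ /Sle/andP[S0 S1]; rewrite normrM ger0_norm// ler_wpM2r.
have mpsi := nuprim_measurable mG beta_integrable cPhi npsi.
have bpsi := nuprim_locbounded mG beta_integrable cPhi npsi.
have ipp : locint leb setT (fun t => p t * psi t).
  by have := locint_mull mT mpsi bpsi iF.1; congr locint; apply/funext => t; rewrite mulrC.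
(* From |z'| <= 2 and 0 <= z <= 1: 2 z z' Phi psi >= - S / 2 - 8 psi^2, and
   z^2 v psi <= (psi^2 + v^2) / 2. *)
pose low t := - (1 / 2) * S t + 1 * ((- 9) * psi t ^+ 2 + (- 1) * v t ^+ 2).
have i3 := locint_linear mT (- 9) (-1) (L2r_locint2 Lpsi) (L2r_locint2 Lv).
have iS := continuous_locint cS.
have b2 : lint (- r) r low <= lint (- r) r (fun t => p t * psi t).
  apply: le_eint => //; first exact: locint_linear.
  move=> t _ tr; have /andP[z0 z1] := cutoff01 r0 tr.
  have dz2 : `|dz t| <= 2.
    by apply: (le_trans (cutoff_deriv r0 tr)); rewrite ler_pdivrMr// ler_peMr.
  have dzz : dz t ^+ 2 <= 4.
    by rewrite -[dz t ^+ 2]real_normK ?num_real// (_ : 4 = 2 ^+ 2 :> R) ?ler_pXn2r ?nnegrE//; ring.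
  have zz : 0 <= z t * z t <= 1 by rewrite mulr_ge0//= mulr_ile1.
  rewrite /low /p /S.
  set Z := z t in z0 z1 zz *; set DZ := dz t in dzz *; set P := Phi t; set Q := psi t; set V := v t.
  have h1 := sqr_ge0 (Z * P + 2 * DZ * Q).
  have h2 := sqr_ge0 (Z * Z * V - Q).
  have h3 : (Z * Z * V) ^+ 2 <= V ^+ 2.
    by rewrite exprMn ler_piMl ?sqr_ge0// exprn_ile1//; case/andP : zz.
  have h4 : DZ ^+ 2 * Q ^+ 2 <= 4 * Q ^+ 2 by rewrite ler_wpM2r ?sqr_ge0.
  have h5 : (Z * P + 2 * DZ * Q) ^+ 2 = Z * Z * P * P + 4 * (Z * P * DZ * Q) + 4 * (DZ ^+ 2 * Q ^+ 2) by ring.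
  have h6 : (Z * Z * V - Q) ^+ 2 = (Z * Z * V) ^+ 2 - 2 * (Z * Z * V * Q) + Q ^+ 2 by ring.
  have -> : ((DZ * Z + Z * DZ) * P + Z * Z * - V) * Q = 2 * (Z * P * DZ * Q) - Z * Z * V * Q by ring.
  have h7 := sqr_ge0 Q; have h8 := sqr_ge0 V.
  rewrite h5 in h1; rewrite h6 in h2.
  move: h1 h2 h3 h4 h7 h8.
  set a1 := Z * Z * P * P; set a2 := Z * P * DZ * Q; set a3 := DZ ^+ 2 * Q ^+ 2.
  set a4 := (Z * Z * V) ^+ 2; set a5 := Z * Z * V * Q; set a6 := Q ^+ 2; set a7 := V ^+ 2.
  by clearbody a1 a2 a3 a4 a5 a6 a7; lra.
have b3 : lint (- r) r low = - (1 / 2) * lint (- r) r S +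
   ((- 9) * lint (- r) r (fun t => psi t ^+ 2) + (-1) * lint (- r) r (fun t => v t ^+ 2)).
  rewrite /low /lint (eint_linear mT (- r) r _ _ iS i3).
  by rewrite (eint_linear mT (- r) r _ _ (L2r_locint2 Lpsi) (L2r_locint2 Lv)); ring.
have b4 : lint (- r) r (fun t => psi t ^+ 2) <= \int[leb]_t (psi t ^+ 2).
  by apply: lint_le_int; [case: Lpsi|move=> t; exact: sqr_ge0].
have b5 : lint (- r) r (fun t => v t ^+ 2) <= \int[leb]_t (v t ^+ 2).
  by apply: lint_le_int; [case: Lv|move=> t; exact: sqr_ge0].
move=> b0.
have b6 : lint (- r) r S <= 2 * C0.
  move: b0 b1 b2 b3 b4 b5; rewrite /C0 ler_norml.
  set a1 := lint _ _ S; set a2 := lint _ _ low; set a3 := lint _ _ (fun t => p t * psi t).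
  set a4 := eint _ _ _ _ _; set a5 := lint _ _ _; set a6 := lint _ _ _; set a7 := Rintegral _ _ _; set a8 := Rintegral _ _ _.
  by move=> b0 /andP[b1 _]; clearbody a1 a2 a3 a4 a5 a6 a7 a8; lra.
have nr : n%:R <= r by rewrite /r; lra.
have n0 : - n%:R <= n%:R :> R by lra.
apply: (@le_trans _ _ (lint (- n%:R) n%:R (fun t => 2 * S t + 0 * S t))).
  apply: le_eint => //; first exact: locint_linear.
  move=> t _ /andP[t1 t2].
  have tt : r^-2 * (t * t) <= 1 / 4.
    have nn : t * t <= n%:R ^+ 2.
      by rewrite -expr2 -[t ^+ 2]real_normK ?num_real// ler_pXn2r ?nnegrE ?ler0n// ler_norml t1 ltW.
    rewrite mulrC ler_pdivrMr ?exprn_gt0//.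
    by have -> : 1 / 4 * r ^+ 2 = n%:R ^+ 2 by rewrite /r; field.
  have zt : 3 / 4 <= z t by rewrite /z /cutoff; lra.
  have zz : 9 / 16 <= z t * z t.
    have -> : 9 / 16 = 3 / 4 * (3 / 4) :> R by field.
    by apply: ler_pM => //; rewrite divr_ge0.
  have -> : 2 * S t + 0 * S t = 2 * (z t * z t) * Phi t ^+ 2 by rewrite /S; ring.
  by rewrite ler_peMl ?sqr_ge0//; lra.
rewrite /lint eint_linear// mul0r addr0.
have h : lint (- n%:R) n%:R S <= lint (- r) r S.
  rewrite /lint; have l1 : - r <= - n%:R by lra.
  rewrite (eintD mT iS l1 (le_trans n0 nr)) (eintD mT iS n0 nr).
  have k1 : 0 <= eint leb setT (- r) (- n%:R) S.
    by apply: eint_ge0 => t _ /andP[t1 t2]; case/andP : (Sle t ltac:(by rewrite t1; lra)).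
  have k2 : 0 <= eint leb setT n%:R r S.
    by apply: eint_ge0 => t _ /andP[t1 t2]; case/andP : (Sle t ltac:(by rewrite t2 andbT; lra)).
  by move: k1 k2; set a := eint _ _ _ _ _; set b := eint _ _ _ _ _; set c := eint _ _ _ _ _; lra.
by move: h; rewrite /lint; set a := eint _ _ _ _ _; move: b6; rewrite /lint; set b := eint _ _ _ _ _; lra.
Unshelve. all: by end_near. Qed.

End RealGraph.

Section Symmetry.
Context {R : realType}.
Local Notation Borel := (measurableTypeR R).
Local Notation leb := (@lebesgue_measure R).
Variables (G : set R) (mu : {finite_measure set Borel -> \bar R}) (beta : R -> R).
Hypothesis mG : measurable (G : set Borel).
Hypothesis beta_integrable : mu.-integrable (G : set Borel) (EFin \o beta).
Variables (A B : R).
Hypothesis AB : A < B.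
Hypothesis GAB : forall x, G x -> A < x < B.
Implicit Types (F f g p q u v w Phi phi psi : R -> R) (s t x a b c r : R).

Let mT := @measurableT _ Borel.
Local Notation nuprim := (nuprim G mu beta).
Local Notation nuint := (nuint G mu beta).
Local Notation real_graph := (real_graph G mu beta).

Let symmetry_pre psi1 Phi1 v1 psi2 Phi2 v2 : L2r setT psi1 -> L2r setT psi2 ->
  L2r setT v1 -> L2r setT v2 ->
  primitive Phi1 (fun t => - v1 t) -> nuprim psi1 Phi1 ->
  primitive Phi2 (fun t => - v2 t) -> nuprim psi2 Phi2 ->
  \int[leb]_t (1 * (v1 t * psi2 t) + -1 * (v2 t * psi1 t)) = 0.
Proof.
move=> Lp1 Lp2 Lv1 Lv2 i1 n1 i2 n2.
have LP1 := quasiderivative_L2 mG beta_integrable GAB Lp1 Lv1 i1 n1.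
have LP2 := quasiderivative_L2 mG beta_integrable GAB Lp2 Lv2 i2 n2.
have c1 := primitive_continuous i1; have c2 := primitive_continuous i2.
pose D t := 1 * (v1 t * psi2 t) + -1 * (v2 t * psi1 t).
pose W t := 1 * (Phi1 t * psi2 t) + -1 * (Phi2 t * psi1 t).
have int_lin a b p q : leb.-integrable (setT : set Borel) (EFin \o p) -> leb.-integrable (setT : set Borel) (EFin \o q) ->
    leb.-integrable (setT : set Borel) (EFin \o (fun t => a * p t + b * q t)).
  move=> ip iq; apply: (@integrableD _ _ _ _ _ mT (EFin \o (fun t => a * p t)) (EFin \o (fun t => b * q t))).
    exact: (@integrableZl _ _ _ _ _ mT a (EFin \o p)).
  exact: (@integrableZl _ _ _ _ _ mT b (EFin \o q)).
have iD : leb.-integrable setT (EFin \o D) by apply: int_lin; exact: L2r_mul.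
have iW : leb.-integrable setT (EFin \o W) by apply: int_lin; exact: L2r_mul.
pose z (n : nat) t := cutoff (n.+1%:R) t * \1_(`[- n.+1%:R, n.+1%:R[%classic) t.
have ccut r : continuous (cutoff r) by exact: primitive_continuous (cutoff_primitive r).
have rpos (n : nat) : 0 < n.+1%:R :> R by [].
have z01 n t : 0 <= z n t <= 1.
  rewrite /z indicE; have [h|h] := pselect ((`[- n.+1%:R, n.+1%:R[%classic : set R) t); last first.
    by rewrite memNset// mulr0 lexx ler01.
  by rewrite mem_set// mulr1; apply: cutoff01 => //; move: h; rewrite /= in_itv.
have mD : measurable_fun (setT : set Borel) (D : Borel -> R) by case/integrableP : iD => /measurable_EFinP.
have lim : \int[leb]_t (z n t * D t) @[n --> \oo] --> \int[leb]_t D t.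
  apply: (@Rintegral_dominated _ _ _ leb setT (fun n t => z n t * D t) D (fun t => `|D t|)) => //.
  - exact: integrable_norm.
  - move=> n; apply: measurable_funM => //; apply: measurable_funM; last exact: measurable_indic.
    exact: continuous_measurable.
  - apply: aeW => t _.
    have h : z n t @[n --> \oo] --> (1 : R).
      have h1 : 1 - (@harmonic R n * @harmonic R n) * (t * t) @[n --> \oo] --> (1 - (0 * 0) * (t * t) : R).
        apply: cvgB; first exact: cvg_cst.
        by apply: cvgM; [apply: cvgM; exact: cvg_harmonic|exact: cvg_cst].
      rewrite !mul0r subr0 in h1; apply: (cvg_trans _ h1); apply: near_eq_cvg.
      near=> n; rewrite /z /cutoff /harmonic /= indicE mem_set; last first.
        rewrite /= in_itv/=; have tn : `|t| < n%:R by near: n; exact: nbhs_infty_gtr.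
        have tn1 : `|t| < n.+1%:R by apply: (lt_trans tn); rewrite ltr_nat.
        by move: tn1; rewrite ltr_norml => /andP[/ltW -> ->].
      by rewrite mulr1 -exprVn expr2.
    by have := cvgM h (@cvg_cst _ (D t) _ \oo _); rewrite mul1r => h2; exact: h2.
  - move=> n t _; have /andP[z0 z1] := z01 n t.
    by rewrite normrM ger0_norm// ler_piMl.
have bound n : B <= n.+1%:R -> - n.+1%:R <= A ->
   `|\int[leb]_t (z n t * D t)| <= 2 * @harmonic R n * \int[leb]_t `|W t|.
  move=> rB rA; set r : R := n.+1%:R in rB rA; have r0 : 0 < r by exact: rpos.
  have rr : - r <= r by lra.
  have -> : \int[leb]_t (z n t * D t) = lint (- r) r (fun t => cutoff r t * D t).
    by rewrite lint_ind; apply: eq_Rintegral => t _; rewrite /z -/r; ring.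
  pose dz t := - (r^-2 * (t + t)).
  have iz := cutoff_primitive r.
  have j1 := primitiveM iz i1; have j2 := primitiveM iz i2.
  have := nuprim_by_parts mG beta_integrable rr j1 c2 n2.
  have := nuprim_by_parts mG beta_integrable rr j2 c1 n1.
  have [zr zr'] := cutoff_end r0; rewrite zr zr' !mul0r !subrr.
  have -> : nuint (- r) r (fun t => cutoff r t * Phi2 t * Phi1 t) =
     nuint (- r) r (fun t => cutoff r t * Phi1 t * Phi2 t).
    by congr (nuint _ _ _); apply/funext => t; ring.
  set p1 := (fun t => _ * psi1 t); set p2 := (fun t => _ * psi2 t) => h2 h1.
  have ip1 : locint leb setT p1.
    have := locint_mull mT (nuprim_measurable mG beta_integrable c1 n1)
      (nuprim_locbounded mG beta_integrable c1 n1) j2.1.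
    by congr locint; apply/funext => t; rewrite mulrC.
  have ip2 : locint leb setT p2.
    have := locint_mull mT (nuprim_measurable mG beta_integrable c2 n2)
      (nuprim_locbounded mG beta_integrable c2 n2) j1.1.
    by congr locint; apply/funext => t; rewrite mulrC.
  have lW := integrable_locint iW; have lD := integrable_locint iD.
  have lzD : locint leb setT (fun t => cutoff r t * D t).
    exact: (locint_mull mT (continuous_measurable (ccut r)) (continuous_locbounded (ccut r)) lD).
  have -> : lint (- r) r (fun t => cutoff r t * D t) =
     lint (- r) r (fun t => 1 * (1 * p1 t + -1 * p2 t) + 1 * (dz t * W t)).
    by apply: eq_eint => t _ _; rewrite /p1 /p2 /D /W /dz; ring.
  have cdz : continuous dz.
    have -> : dz = fun t => (- (r^-2 * 2)) * t + 0 by apply/funext => t; rewrite /dz; ring.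
    exact: affine_continuous.
  have ldW : locint leb setT (fun t => dz t * W t).
    exact: (locint_mull mT (continuous_measurable cdz) (continuous_locbounded cdz) lW).
  have lp := locint_linear mT 1 (-1) ip1 ip2.
  rewrite /lint (eint_linear mT _ _ 1 1 lp ldW) (eint_linear mT _ _ 1 (-1) ip1 ip2).
  rewrite -!/(lint _ _ _) (_ : _ + _ = lint (- r) r (fun t => dz t * W t)); last by lra.
  have lnW : locint leb setT (fun t => 2 / r * `|W t|).
    have := locint_linear mT (2 / r) 0 (locint_norm lW) (locint_norm lW).
    by congr locint; apply/funext => t; ring.
  apply: (@le_trans _ _ (lint (- r) r (fun t => 2 / r * `|W t|))).
    apply: eint_bound => // t _ tr; rewrite normrM ler_wpM2r//.
    exact: cutoff_deriv.
  have -> : lint (- r) r (fun t => 2 / r * `|W t|) = 2 / r * lint (- r) r (fun t => `|W t|).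
    have := eint_linear mT (- r) r (2 / r) 0 (locint_norm lW) (locint_norm lW).
    by rewrite mul0r addr0 => <-; apply: eq_eint => t _ _; ring.
  rewrite /harmonic/= -/r ler_wpM2l ?divr_ge0 ?(ltW r0)//.
  by apply: lint_le_int => //; exact: integrable_norm.
apply/eqP; rewrite -normr_le0.
have lim0 : 2 * @harmonic R n * \int[leb]_t `|W t| @[n --> \oo] --> (2 * 0 * \int[leb]_t `|W t| : R).
  by apply: cvgM; [apply: cvgM; [exact: cvg_cst|exact: cvg_harmonic]|exact: cvg_cst].
rewrite mulr0 mul0r in lim0.
have limn : `|\int[leb]_t (z n t * D t)| @[n --> \oo] --> `|\int[leb]_t D t|.
  by apply: cvg_norm.
apply: (ler_cvg_to limn lim0).
near=> n; apply: bound.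
  have nB : B <= n%:R by near: n; exact: nbhs_infty_ger.
  by rewrite (le_trans nB)// ler_nat.
have nA : - A <= n%:R by near: n; exact: nbhs_infty_ger.
by rewrite lerNl (le_trans nA)// ler_nat.
Unshelve. all: by end_near. Qed.

(** Green's formula; the boundary terms at infinity are removed by [cutoff],
    whose derivative multiplies the integrable Wronskian Phi1 psi2 - Phi2 psi1. *)
Lemma real_graph_symmetric u1 v1 u2 v2 : real_graph u1 v1 -> real_graph u2 v2 ->
  \int[leb]_t (v1 t * u2 t) = \int[leb]_t (u1 t * v2 t).
Proof.
move=> [Lu1 Lv1 [psi1 [Phi1 [i1 n1 e1]]]] [Lu2 Lv2 [psi2 [Phi2 [i2 n2 e2]]]].
have m1 := nuprim_measurable mG beta_integrable (primitive_continuous i1) n1.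
have m2 := nuprim_measurable mG beta_integrable (primitive_continuous i2) n2.
have Lp1 := L2r_ae Lu1 m1 e1; have Lp2 := L2r_ae Lu2 m2 e2.
have := symmetry_pre Lp1 Lp2 Lv1 Lv2 i1 n1 i2 n2.
rewrite Rintegral_linear; try exact: L2r_mul.
have -> : \int[leb]_t (v1 t * u2 t) = \int[leb]_t (v1 t * psi2 t).
  apply: ae_eq_Rintegral.
  - by apply: measurable_funM; [case: Lv1|case: Lu2].
  - by apply: measurable_funM; [case: Lv1|].
  - by apply: lebS e2 => t ->.
have -> : \int[leb]_t (u1 t * v2 t) = \int[leb]_t (v2 t * psi1 t).
  apply: ae_eq_Rintegral.
  - by apply: measurable_funM; [case: Lu1|case: Lv2].
  - by apply: measurable_funM; [case: Lv2|].
  - by apply: lebS e1 => t ->; rewrite mulrC.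
by set a := Rintegral _ _ _; set b := Rintegral _ _ _; lra.
Qed.

End Symmetry.

Section Adjoint.
Context {R : realType}.
Local Notation Borel := (measurableTypeR R).
Local Notation leb := (@lebesgue_measure R).
Variables (G : set R) (mu : {finite_measure set Borel -> \bar R}) (beta : R -> R).
Hypothesis mG : measurable (G : set Borel).
Hypothesis beta_integrable : mu.-integrable (G : set Borel) (EFin \o beta).
Variables (A B : R).
Hypothesis AB : A < B.
Hypothesis GAB : forall x, G x -> A < x < B.
Implicit Types (F f g h p q u v w Phi phi psi : R -> R) (s t x a b c r : R).

Let mT := @measurableT _ Borel.
Local Notation nuprim := (nuprim G mu beta).
Local Notation nuint := (nuint G mu beta).
Local Notation real_graph := (real_graph G mu beta).

Lemma nuint_eq0 s x f : (forall t, s <= t < x -> f t = 0) -> nuint s x f = 0.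
Proof.
move=> f0; have [sx|/ltW xs] := leP s x; last by rewrite /(nuint _ _ _) /lint !eint_ge// addr0.
rewrite (@eq_nuint _ G mu beta s x f (fun=> 0) f0).
have := nuprim_cst mu beta mG 0 sx; lra.
Qed.

Lemma Rintegral_supp s x p : (forall t, ~ (s <= t < x) -> p t = 0) -> \int[leb]_t p t = lint s x p.
Proof.
move=> p0; rewrite lint_ind; apply: eq_Rintegral => t _; rewrite indicE.
have [h|h] := pselect ((`[s, x[%classic : set R) t); first by rewrite mem_set// mulr1.
by rewrite memNset// mulr0 p0//; move: h; rewrite /= in_itv.
Qed.

Lemma locbounded_sqr_locint p : measurable_fun (setT : set Borel) (p : Borel -> R) ->
  locbounded p -> locint leb setT (fun t => p t ^+ 2).
Proof.
move=> mp bp; have i1 := locint_mull mT mp bp (locint_cst 1).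
have := locint_mull mT mp bp i1.
by congr locint; apply/funext => t; rewrite mulr1 expr2.
Qed.

(** The first moment condition makes the primitive of h vanish to the right of r,
    the second one does the same for the nu-primitive u of that primitive. *)
Lemma compact_graph r h F : 0 < r -> L2r setT h -> (forall t, ~ (- r <= t < r) -> h t = 0) ->
  nuprim F (fun=> 1) -> lint (- r) r h = 0 -> lint (- r) r (fun t => h t * F t) = 0 ->
  exists u phi, [/\ real_graph u (fun t => - h t), primitive phi h, nuprim u phi,
    phi (- r) = 0 /\ phi r = 0 & forall t, ~ (- r <= t < r) -> u t = 0].
Proof.
move=> r0 Lh h0 nF m0 m1; have rr : - r <= r by lra.
have [phi [iphi phir]] := primitive_exists (- r) 0 (L2r_locint Lh).
have phi_left t : t <= - r -> phi t = 0.
  move=> tr; have := iphi.2 _ _ tr; rewrite phir lint_eq0; first by rewrite addr0.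
  by move=> y /andP[_ yr]; apply: h0; rewrite leNgt yr.
have phi_r : phi r = 0 by rewrite (iphi.2 _ _ rr) phir -/(lint _ _ _) m0 addr0.
have phi_right t : r <= t -> phi t = 0.
  move=> tr; rewrite (iphi.2 _ _ tr) phi_r lint_eq0; first by rewrite addr0.
  by move=> y /andP[ry _]; apply: h0; rewrite andbC ltNge ry.
have cphi := primitive_continuous iphi.
pose u t := 0 + nuanti G mu beta (- r) phi t.
have nu_ : nuprim u phi by exact: nuprim_nuanti.
have ur : u (- r) = 0 by rewrite /u nuantixx addr0.
have u_left t : t <= - r -> u t = 0.
  move=> tr; have := nu_ _ _ tr; rewrite ur nuint_eq0; first by rewrite addr0.
  by move=> y /andP[_ /ltW]; exact: phi_left.
have u_r : u r = 0.
  have c1 : continuous (fun _ : R => 1 : R) by move=> y; exact: cvg_cst.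
  have := nuprim_by_parts mG beta_integrable rr iphi c1 nF.
  rewrite phi_r phir !mul0r subrr m1 add0r.
  move=> e; rewrite (nu_ _ _ rr) ur add0r [RHS]e.
  by apply: eq_nuint => t _; rewrite mulr1.
have u_right t : r <= t -> u t = 0.
  move=> tr; rewrite (nu_ _ _ tr) u_r nuint_eq0; first by rewrite addr0.
  by move=> y /andP[ry _]; exact: phi_right.
have u0 t : ~ (- r <= t < r) -> u t = 0.
  have [tr|rt] := leP r t; first by move=> _; exact: u_right.
  have [rt'|/ltW tr'] := leP (- r) t; last by move=> _; exact: u_left.
  by case.
have mu_ := nuprim_measurable mG beta_integrable cphi nu_.
have bu := nuprim_locbounded mG beta_integrable cphi nu_.
exists u, phi; split => //; split => //.
- have := L2r_cut (- r) r mu_ (locbounded_sqr_locint mu_ bu).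
  congr L2r; apply/funext => t; rewrite indicE.
  have [k|k] := pselect ((`[- r, r[%classic : set R) t); first by rewrite mem_set// mulr1.
  by rewrite memNset// mulr0 u0//; move: k; rewrite /= in_itv.
- exact: L2rN.
- exists u, phi; split => //; last exact: aeW.
  by move: iphi; congr primitive; apply/funext => t; rewrite opprK.
Qed.

Lemma moment k : lint (A - 1) A (fun t => (t - A) ^+ k) = (-1) ^+ k / k.+1%:R.
Proof.
have e : (fun t => (t - A) ^+ k) = (fun t => (1 * t + (- A)) ^+ k).
  by apply/funext => t; rewrite mul1r.
have ip : primitive (fun t => 1 / k.+1%:R * (1 * t + (- A)) ^+ k.+1 + 0 * (1 * t + (- A)) ^+ k.+1) (fun t => (t - A) ^+ k).
  have i0 : primitive (fun t => (1 * t + (- A)) ^+ k.+1) (fun t => k.+1%:R * (1 * t + (- A)) ^+ k * 1).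
    apply: is_derive_primitive => [x|]; first exact: is_derive_affineX.
    move=> x; apply: cvgM; last exact: cvg_cst.
    by apply: cvgM; [exact: cvg_cst|exact: affineX_continuous].
  have := increments_linear mT (1 / k.+1%:R) 0 i0 i0.
  by congr increments; apply/funext => t; rewrite !mul1r mul0r addr0 mulr1 mulrA mulVf ?mul1r// pnatr_eq0.
have A1 : A - 1 <= A by lra.
rewrite /lint (increments_eint ip A1) !mul0r !addr0 !mul1r subrr expr0n /= mulr0 sub0r.
rewrite (_ : A - 1 - A = -1); last by ring.
by rewrite exprS mulN1r mulrN opprK mulrC.
Qed.

Lemma lintZ s x a p : locint leb setT p -> lint s x (fun t => a * p t) = a * lint s x p.
Proof.
move=> ip; have := eint_linear mT s x a 0 ip ip; rewrite mul0r addr0 => <-.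
by apply: eq_eint => t _ _; ring.
Qed.

Lemma lint_supp s x s' x' p : s <= s' -> s' <= x' -> x' <= x -> locint leb setT p ->
  (forall t, ~ (s' <= t < x') -> p t = 0) -> lint s x p = lint s' x' p.
Proof.
move=> h1 h2 h3 ip p0; rewrite /lint (eintD mT ip h1 (le_trans h2 h3)) (eintD mT ip h2 h3).
rewrite [eint _ _ s s' _]lint_eq0 ?[eint _ _ x' x _]lint_eq0; first by rewrite add0r addr0.
  by move=> t /andP[a b]; apply: p0; rewrite andbC ltNge a.
by move=> t /andP[a b]; apply: p0; rewrite leNgt b.
Qed.

(** An affine function on [A - 1, A[; there nu is the Lebesgue measure, and
    F t = t - A. *)
Lemma moments_exist a b F : nuprim F (fun=> 1) -> F A = 0 -> exists h, [/\ L2r setT h,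
  forall t, ~ (A - 1 <= t < A) -> h t = 0,
  lint (A - 1) A h = a & lint (A - 1) A (fun t => h t * F t) = b].
Proof.
(* The integrals of 1, t - A and (t - A)^2 over [A - 1, A[ are 1, - 1 / 2 and
   1 / 3; c0 and c1 solve the resulting 2 x 2 system. *)
move=> nF FA; pose c0 := 4 * a + 6 * b; pose c1 := 6 * a + 12 * b.
pose q t := c0 * (t - A) ^+ 0 + c1 * (t - A) ^+ 1.
have cX k : continuous (fun t => (t - A) ^+ k).
  have -> : (fun t => (t - A) ^+ k) = (fun t => (1 * t + (- A)) ^+ k).
    by apply/funext => t; rewrite mul1r.
  exact: affineX_continuous.
have iX k := continuous_locint (cX k).
have cq : continuous q.
  by move=> x; apply: cvgD; (apply: cvgM; [exact: cvg_cst|exact: cX]).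
pose I := `[A - 1, A[%classic : set R.
have off t : ~ (A - 1 <= t < A) -> q t * \1_I t = 0.
  by move=> h; rewrite indicE memNset ?mulr0// /I /= in_itv.
have on t : A - 1 <= t < A -> \1_I t = 1 :> R.
  by move=> h; rewrite indicE mem_set// /I /= in_itv.
have FE t : A - 1 <= t < A -> F t = t - A.
  move=> /andP[t1 t2]; have := nF _ _ (ltW t2); rewrite FA (nuint_lint _ _ GAB); last by left.
  have i1 : primitive (fun t => 1 * t + 0) (fun=> 1).
    by apply: (@is_derive_primitive _ _ (fun=> 1)) => z; [exact: is_derive_affine|exact: cvg_cst].
  rewrite /lint (increments_eint i1 (ltW t2)); lra.
exists (fun t => q t * \1_I t); split => //.
- apply: L2r_cut; first exact: continuous_measurable.
  by apply: locbounded_sqr_locint; [exact: continuous_measurable|exact: continuous_locbounded].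
- transitivity (lint (A - 1) A q).
    by apply: eq_eint => t _ tI; rewrite (on t tI) mulr1.
  rewrite /q /lint (eint_linear mT _ _ c0 c1 (iX 0%N) (iX 1%N)) -!/(lint _ _ _) !moment.
  by rewrite /c0 /c1; field.
- transitivity (lint (A - 1) A (fun t => c0 * (t - A) ^+ 1 + c1 * (t - A) ^+ 2)).
    apply: eq_eint => t _ tI; rewrite (on t tI) (FE t tI) /q; ring.
  rewrite /lint (eint_linear mT _ _ c0 c1 (iX 1%N) (iX 2%N)) -!/(lint _ _ _) !moment.
  by rewrite /c0 /c1; field.
Qed.

(** Let rho = v - V, where V has quasi-derivative Phi0 and Phi0' = - w.  By
    [compact_graph] rho is orthogonal to every compactly supported h with two
    vanishing moments, hence a combination k1 + k2 F; and 1, F solve the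
    homogeneous system. *)
Lemma real_adjoint v w : L2r setT v -> L2r setT w ->
  (forall u Tu, real_graph u Tu -> \int[leb]_t (Tu t * v t) = \int[leb]_t (u t * w t)) ->
  real_graph v w.
Proof.
move=> Lv Lw adj.
have [Phi0 [iPhi0 PA]] := primitive_exists A 0 (L2r_locint (L2rN Lw)).
have cPhi0 := primitive_continuous iPhi0.
have c1 : continuous (fun _ : R => 1 : R) by move=> y; exact: cvg_cst.
pose V t := 0 + nuanti G mu beta A Phi0 t.
pose F t := 0 + nuanti G mu beta A (fun=> 1) t.
have nV : nuprim V Phi0 by exact: nuprim_nuanti.
have nF : nuprim F (fun=> 1) by exact: nuprim_nuanti.
have FA : F A = 0 by rewrite /F nuantixx addr0.
have mV := nuprim_measurable mG beta_integrable cPhi0 nV.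
have bV := nuprim_locbounded mG beta_integrable cPhi0 nV.
have mF := nuprim_measurable mG beta_integrable c1 nF.
have bF := nuprim_locbounded mG beta_integrable c1 nF.
pose rho t := v t - V t.
have lmul h p : L2r setT h -> measurable_fun (setT : set Borel) (p : Borel -> R) -> locbounded p ->
    locint leb setT (fun t => h t * p t).
  move=> Lh mp bp; have := locint_mull mT mp bp (L2r_locint Lh).
  by congr locint; apply/funext => t; rewrite mulrC.
have lrho h : L2r setT h -> locint leb setT (fun t => h t * rho t).
  move=> Lh; have := locint_linear mT 1 (-1) (integrable_locint (L2r_mul Lh Lv)) (lmul _ _ Lh mV bV).
  by congr locint; apply/funext => t; rewrite /rho; ring.
(* rho annihilates every h with two vanishing moments *)
have orth r h : 0 < r -> L2r setT h -> (forall t, ~ (- r <= t < r) -> h t = 0) ->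
    lint (- r) r h = 0 -> lint (- r) r (fun t => h t * F t) = 0 ->
    lint (- r) r (fun t => h t * rho t) = 0.
  move=> r0 Lh h0 m0 m1; have rr : - r <= r by lra.
  have [u [phi [gu iphi nu_ [phi1 phi2] u0]]] := compact_graph r0 Lh h0 nF m0 m1.
  have := adj _ _ gu.
  rewrite (@Rintegral_supp (- r) r); last by move=> t /h0 ->; rewrite oppr0 mul0r.
  rewrite (@Rintegral_supp (- r) r); last by move=> t /u0 ->; rewrite mul0r.
  have cphi := primitive_continuous iphi.
  have ur : u r = 0 by apply: u0; rewrite ltxx andbF.
  have ur' : u (- r) = 0.
    have := nu_ (- r - 1) (- r); rewrite (_ : u (- r - 1) = 0); last first.
      by apply: u0 => /andP[+ _]; lra.
    rewrite nuint_eq0; first by move=> ->; [rewrite addr0|lra].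
    move=> t /andP[_ tr]; have := iphi.2 _ _ (ltW tr); rewrite phi1 lint_eq0; first by rewrite addr0.
    by move=> y /andP[_ yr]; apply: h0; rewrite leNgt yr.
  have := nuprim_by_parts mG beta_integrable rr iPhi0 cphi nu_.
  have := nuprim_by_parts mG beta_integrable rr iphi cPhi0 nV.
  rewrite ur ur' phi1 phi2 !mulr0 !mul0r !subrr.
  have -> : nuint (- r) r (fun t => Phi0 t * phi t) = nuint (- r) r (fun t => phi t * Phi0 t).
    by congr (nuint _ _ _); apply/funext => t; rewrite mulrC.
  have -> : lint (- r) r (fun t => - w t * u t) = - lint (- r) r (fun t => u t * w t).
    rewrite -[RHS]mulN1r -lintZ; first by apply: eq_eint => t _ _; ring.
    by have [Lu _ _] := gu; exact: integrable_locint (L2r_mul Lu Lw).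
  have -> : lint (- r) r (fun t => - h t * v t) = - lint (- r) r (fun t => h t * v t).
    rewrite -[RHS]mulN1r -lintZ; first by apply: eq_eint => t _ _; ring.
    exact: integrable_locint (L2r_mul Lh Lv).
  have -> : lint (- r) r (fun t => h t * rho t) =
     1 * lint (- r) r (fun t => h t * v t) + -1 * lint (- r) r (fun t => h t * V t).
    rewrite /lint -(eint_linear mT) //.
    - by apply: eq_eint => t _ _; rewrite /rho; ring.
    - exact: integrable_locint (L2r_mul Lh Lv).
    - exact: lmul.
  by set a := lint _ _ _; set b := nuint _ _ _; set c := lint _ _ _; set d := lint _ _ _; lra.
have [h1 [Lh1 h10 m10 m11]] := moments_exist 1 0 nF FA.
have [h2 [Lh2 h20 m20 m21]] := moments_exist 0 1 nF FA.
pose k1 := lint (A - 1) A (fun t => h1 t * rho t).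
pose k2 := lint (A - 1) A (fun t => h2 t * rho t).
(* If rho is a combination of 1 and F, testing with h1 and h2 shows that its
   coefficients are k1 and k2. *)
pose X t := V t + (k1 + k2 * F t).
pose sg t := v t - X t.
have mX : measurable_fun (setT : set Borel) (X : Borel -> R).
  apply: measurable_funD => //; apply: measurable_funD; first exact: measurable_cst.
  by apply: measurable_funM => //; exact: measurable_cst.
have bX : locbounded X.
  apply: (locboundedD bV); apply: (locboundedD (p := fun t => k2 * F t) (f := fun=> k1)).
    by move=> s x; exists `|k1| => t _.
  by move=> s x; have [M hM] := bF s x; exists (`|k2| * M) => t tI; rewrite normrM ler_wpM2l// hM.
have mv : measurable_fun (setT : set Borel) (v : Borel -> R) by case: Lv.
have msg : measurable_fun (setT : set Borel) (sg : Borel -> R) by exact: measurable_funB.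
have isg2 : locint leb setT (fun t => sg t ^+ 2).
  have i3 := locint_linear mT 2 2 (L2r_locint2 Lv) (locbounded_sqr_locint mX bX).
  apply: (locint_le mT _ i3) => [s x|t _]; first exact: measurable_funS (measurable_sqr msg).
  rewrite ger0_norm ?sqr_ge0// /sg; have := sqr_ge0 (v t + X t).
  rewrite sqrrB sqrrD; set a := v t * X t; lra.
have zero r : - r <= A - 1 -> A <= r -> 0 < r -> lint (- r) r (fun t => sg t ^+ 2) = 0.
  move=> rA Ar r0; have rr : - r <= r by lra. have A1 : A - 1 <= A by lra.
  pose I := `[- r, r[%classic : set R.
  pose h t := sg t * \1_I t.
  have Lh : L2r setT h by exact: L2r_cut.
  have h0 t : ~ (- r <= t < r) -> h t = 0.
    by move=> k; rewrite /h indicE memNset ?mulr0// /I /= in_itv.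
  pose a := lint (- r) r h; pose b := lint (- r) r (fun t => h t * F t).
  (* sg itself, with its two moments corrected to 0. *)
  pose h' t := 1 * h t + 1 * (- a * h1 t + - b * h2 t).
  have Lh' : L2r setT h' by apply: L2r_linear => //; exact: L2r_linear.
  have out t : ~ (- r <= t < r) -> ~ (A - 1 <= t < A).
    by move=> k /andP[t1 t2]; apply: k; apply/andP; split; lra.
  have ext p q : locint leb setT p -> (forall t, ~ (A - 1 <= t < A) -> p t = 0) ->
      lint (- r) r p = lint (A - 1) A p.
    by move=> ip p0; apply: lint_supp.
  have lin p (m : measurable_fun (setT : set Borel) (p : Borel -> R)) :
      (forall g, L2r setT g -> locint leb setT (fun t => g t * p t)) ->
      lint (- r) r (fun t => h' t * p t) = lint (- r) r (fun t => h t * p t)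
        - a * lint (A - 1) A (fun t => h1 t * p t) - b * lint (A - 1) A (fun t => h2 t * p t).
    move=> lp; rewrite -(ext (fun t => h1 t * p t))//; [|exact: lp|by move=> t /h10 ->; rewrite mul0r].
    rewrite -(ext (fun t => h2 t * p t))//; [|exact: lp|by move=> t /h20 ->; rewrite mul0r].
    have -> : lint (- r) r (fun t => h' t * p t) = lint (- r) r (fun t =>
      1 * (h t * p t) + 1 * (- a * (h1 t * p t) + - b * (h2 t * p t))).
      by apply: eq_eint => t _ _; rewrite /h'; ring.
    rewrite /lint (eint_linear mT _ _ 1 1 (lp _ Lh)); last by apply: locint_linear => //; exact: lp.
    by rewrite (eint_linear mT _ _ _ _ (lp _ Lh1) (lp _ Lh2)); ring.
  have m1' : measurable_fun (setT : set Borel) ((fun=> 1 : R) : Borel -> R) by exact: measurable_cst.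
  have lp1 g : L2r setT g -> locint leb setT (fun t => g t * 1).
    by move=> Lg; have := L2r_locint Lg; congr locint; apply/funext => t; rewrite mulr1.
  have e1 p s x : lint s x (fun t => p t * 1) = lint s x p.
    by apply: eq_eint => t _ _; rewrite mulr1.
  have mom0 : lint (- r) r h' = 0.
    by rewrite -e1 (lin _ m1' lp1) !e1 m10 m20 -/a mulr1 mulr0 subrr subr0.
  have mom1 : lint (- r) r (fun t => h' t * F t) = 0.
    by rewrite (lin _ mF (fun g Lg => lmul _ _ Lg mF bF)) m11 m21 -/b mulr1 mulr0 subr0 subrr.
  have h'0 t : ~ (- r <= t < r) -> h' t = 0.
    by move=> k; rewrite /h' (h0 _ k) (h10 _ (out _ k)) (h20 _ (out _ k)); ring.
  have mrho : measurable_fun (setT : set Borel) (rho : Borel -> R) by exact: measurable_funB.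
  have := orth r h' r0 Lh' h'0 mom0 mom1; rewrite (lin _ mrho lrho) -/k1 -/k2 => hk.
  have -> : lint (- r) r (fun t => sg t ^+ 2) = lint (- r) r (fun t =>
      1 * (h t * rho t) + 1 * (- k1 * h t + - k2 * (h t * F t))).
    apply: eq_eint => t _ tr; rewrite /h indicE mem_set; last by rewrite /I /= in_itv.
    by rewrite /= !mulr1 /sg /X /rho; ring.
  have lhF := lmul _ _ Lh mF bF.
  rewrite /lint (eint_linear mT _ _ 1 1 (lrho _ Lh)); last by apply: locint_linear => //; exact: L2r_locint.
  rewrite (eint_linear mT _ _ _ _ (L2r_locint Lh) lhF) -!/(lint _ _ _) -/a -/b.
  by move: hk; set y := lint _ _ _; lra.
have zn : \forall n \near \oo, lint (- n%:R) n%:R (fun t => sg t ^+ 2) = 0.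
  near=> n; apply: zero.
  - have nA : 1 - A <= n%:R by near: n; exact: nbhs_infty_ger.
    by rewrite lerNl opprB.
  - by near: n; exact: nbhs_infty_ger.
  - by near: n; exact: nbhs_infty_gtr.
have isg : leb.-integrable setT (EFin \o (fun t => sg t ^+ 2)).
  apply: (integrable_bounded_lint (C := 0)) => //; first exact: measurable_sqr.
    by move=> t; exact: sqr_ge0.
  by apply: filterS zn => n ->.
have Lsg : L2r setT sg by split.
have I0 : \int[leb]_t (sg t ^+ 2) = 0.
  have lim := lint_cvg isg.
  have lim0 : lint (- n%:R) n%:R (fun t => sg t ^+ 2) @[n --> \oo] --> (0 : R).
    exact: cvg_near_cst.
  exact: (cvg_unique (@Rhausdorff R) lim lim0).
split => //; exists X, (fun t => 1 * Phi0 t + k2 * 1); split.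
- have := increments_linear mT 1 k2 iPhi0 (increments_cst leb mT 1).
  by congr increments; apply/funext => t; ring.
- have n1 := nuprim_linear mG beta_integrable 1 k2 cPhi0 c1 nV nF.
  have c2 : continuous (fun t => 1 * Phi0 t + k2 * 1).
    move=> y; apply: cvgD; last exact: cvg_cst.
    by apply: cvgM; [exact: cvg_cst|exact: cPhi0].
  have c0 : continuous (fun _ : R => 0 : R) by move=> y; exact: cvg_cst.
  have n2 := nuprim_linear mG beta_integrable 1 1 c2 c0 n1 (nuprim_cst mu beta mG k1).
  move=> s x sx; have := n2 s x sx.
  rewrite /X (_ : (fun t => 1 * (1 * Phi0 t + k2 * 1) + 1 * 0) = (fun t => 1 * Phi0 t + k2 * 1)).
    by move=> e; lra.
  by apply/funext => t; ring.
- apply: lebS (sqr_Rintegral_eq0 Lsg I0) => t; rewrite /sg => /eqP; rewrite subr_eq0 => /eqP//.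
Unshelve. all: by end_near. Qed.

End Adjoint.

(** * Density of the domain *)

Section Averages.
Context {R : realType}.
Local Notation Borel := (measurableTypeR R).
Local Notation leb := (@lebesgue_measure R).
Implicit Types (F f g h p : R -> R) (s t x y a b c r L M e : R).
Let mT := @measurableT _ Borel.

(** Mean of f over [x, x + e], F being a primitive of f. *)
Definition avg F e x := (F (x + e) - F x) / e.

Definition lip L f := forall x y, `|f x - f y| <= L * `|x - y|.

Lemma lip_continuous L f : lip L f -> continuous f.
Proof.
move=> lf x; have L1 : 0 < `|L| + 1 by rewrite ltr_wpDl.
apply/cvgrPdist_le => e e0; near=> y.
rewrite (le_trans (lf x y))// (@le_trans _ _ ((`|L| + 1) * `|x - y|))//.
  by rewrite ler_wpM2r// (le_trans (ler_norm _))// lerDl.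
rewrite -ler_pdivlMl// mulrC; near: y; apply: cvgr_dist_le; first exact: cvg_id.
by rewrite divr_gt0.
Unshelve. all: by end_near. Qed.

Lemma primitive_affine c d : primitive (fun t => c * t + d) (fun=> c).
Proof.
by apply: (@is_derive_primitive _ _ (fun=> c)) => z; [exact: is_derive_affine|exact: cvg_cst].
Qed.

Lemma primitive_lip F f M : primitive F f -> (forall t, `|f t| <= M) -> lip M F.
Proof.
move=> iF fM; have inc x y : x <= y -> `|F y - F x| <= M * (y - x).
  move=> xy; have := increments_bound mT iF (primitive_affine M 0) xy (fun t _ _ => fM t).
  by rewrite !addr0 -mulrBr.
move=> x y; have [xy|/ltW yx] := leP x y.
  by rewrite distrC [`|x - y|]distrC [`|y - x|]ger0_norm ?subr_ge0// inc.
by rewrite [`|x - y|]ger0_norm ?subr_ge0// inc.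
Qed.

Lemma avg_bound F f M e x : 0 < e -> primitive F f -> (forall t, `|f t| <= M) -> `|avg F e x| <= M.
Proof.
move=> e0 iF fM; rewrite /avg normrM normfV (gtr0_norm e0) ler_pdivrMr//.
by have := primitive_lip iF fM (x + e) x; rewrite [x + e]addrC addrK (gtr0_norm e0).
Qed.

Lemma avg_primitive F f e : e != 0 -> continuous f -> primitive F f ->
  primitive (avg F e) (fun x => (f (x + e) - f x) / e).
Proof.
move=> e0 cf iF; have dF := primitive_is_derive iF cf.
have cs : continuous (fun t => f (1 * t + e)).
  by move=> t; apply: (@continuous_comp _ _ _ (fun t => 1 * t + e) f); [exact: affine_continuous|exact: cf].
have i1 : primitive (fun t => F (1 * t + e)) (fun t => f (1 * t + e)).
  apply: is_derive_primitive => // x.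
  have := @is_derive1_comp _ F (fun t => 1 * t + e) x _ _ (dF (1 * x + e)) (is_derive_affine 1 e x).
  by rewrite mulr1.
have := increments_linear mT e^-1 (- e^-1) i1 iF.
by congr increments; apply/funext => t; rewrite /avg mul1r; field.
Qed.

Lemma avg_lip F f e L : 0 < e -> primitive F f -> lip L f -> lip L (avg F e).
Proof.
move=> e0 iF lf; have cf := lip_continuous lf.
apply: (primitive_lip (avg_primitive _ cf iF)); first by rewrite gt_eqF.
move=> t; rewrite normrM normfV (gtr0_norm e0) ler_pdivrMr//.
by have := lf (t + e) t; rewrite [t + e]addrC addrK (gtr0_norm e0).
Qed.

Lemma avg_close F f e L x : 0 < e -> 0 <= L -> primitive F f -> lip L f -> `|avg F e x - f x| <= L * e.
Proof.
move=> e0 L0 iF lf.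
have -> : avg F e x - f x = ((F (x + e) - f x * (x + e)) - (F x - f x * x)) / e.
  by rewrite /avg; field; rewrite gt_eqF.
rewrite normrM normfV (gtr0_norm e0) ler_pdivrMr//.
have i1 : primitive (fun t => F t - f x * t) (fun t => f t - f x).
  by have := primitiveB iF (primitive_affine (f x) 0); congr increments; apply/funext => t; rewrite addr0.
have xe : x <= x + e by rewrite lerDl ltW.
have := increments_bound mT i1 (primitive_affine (L * e) 0) xe.
rewrite !addr0 -mulrBr [x + e]addrC addrK; apply => t _ /andP[t1 t2].
apply: (le_trans (lf t x)); rewrite ler_wpM2l// ger0_norm ?subr_ge0// lerBlDr ltW//.
Qed.

Lemma avg_eq0 F f e x : 0 < e -> primitive F f -> (forall t, x <= t < x + e -> f t = 0) -> avg F e x = 0.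
Proof.
move=> e0 iF f0; have xe : x <= x + e by rewrite lerDl ltW.
by rewrite /avg (iF.2 _ _ xe) lint_eq0// addr0 subrr mul0r.
Qed.

(** Lebesgue differentiation along forward averages. *)
Lemma avg_cvg_ae g : leb.-integrable (setT : set Borel) (EFin \o g) ->
  exists H, primitive H g /\ {ae leb, forall x, avg H (@harmonic R n) x @[n --> \oo] --> g x}.
Proof.
move=> ig; pose H x := \int[leb]_(t in `]-oo, x]) g t.
have igS (D : set Borel) : measurable D -> leb.-integrable D (EFin \o g).
  by move=> mD; apply: integrableS ig.
exists H; split.
  split; first exact: integrable_locint.
  move=> s x sx; rewrite /H -/(lint _ _ _).
  have sx' : (BSide false s <= BSide false x)%O by rewrite bnd_simp.
  rewrite -(@Rintegral_itv_bndo_bndc _ _ s) ?igS// -(@Rintegral_itv_bndo_bndc _ _ x) ?igS//.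
  rewrite (@itv_bndbnd_setU _ _ _ (BLeft s))//.
  rewrite Rintegral_setU ?igS//; first by rewrite /lint /eint setIT.
    exact: measurableU.
  apply/disj_setPS => z [/=]; rewrite !in_itv/= => zs /andP[sz _].
  by move: zs; rewrite ltNge sz.
have loc : locally_integrable [set: R] g by apply: open_integrable_locally => //; exact: openT.
have := FTC1Ny (fun y => igS `]-oo, y]%classic (measurable_itv _)) loc.
apply: lebS => x [dH H'].
have h : k^-1 *: ((H \o shift x) (k *: 1) - H x) @[k --> (0:R)^'] --> g x.
  by rewrite -H' derive1E; exact: dH.
have h2 := (cvgr_dnbhsP (fun k : R => k^-1 *: ((H \o shift x) (k *: 1) - H x)) 0 (g x)).1 h.
have h3 := h2 (@harmonic R) (conj (fun n => lt0r_neq0 (harmonic_gt0 n)) cvg_harmonic).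
apply: (cvg_trans _ h3); apply: near_eq_cvg; near=> n.
by rewrite /avg /= /GRing.scale/= mulr1 [RHS]mulrC [_ + x]addrC.
Unshelve. all: by end_near. Qed.

End Averages.

Section Density.
Context {R : realType}.
Local Notation Borel := (measurableTypeR R).
Local Notation leb := (@lebesgue_measure R).
Variables (G : set R) (mu : {finite_measure set Borel -> \bar R}) (beta : R -> R).
Hypothesis mG : measurable (G : set Borel).
Hypothesis beta_integrable : mu.-integrable (G : set Borel) (EFin \o beta).
Implicit Types (F f g h p q u v w Phi phi psi : R -> R) (s t x a b c r M L : R).
Let mT := @measurableT _ Borel.
Local Notation nuprim := (nuprim G mu beta).
Local Notation real_graph := (real_graph G mu beta).

Lemma continuous_supported_L2r f a b : continuous f -> (forall t, ~ (a <= t < b) -> f t = 0) -> L2r setT f.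
Proof.
move=> cf f0; have mf := continuous_measurable cf.
have := L2r_cut a b mf (locbounded_sqr_locint mf (continuous_locbounded cf)).
congr L2r; apply/funext => t; rewrite indicE.
have [k|k] := pselect ((`[a, b[%classic : set R) t); first by rewrite mem_set// mulr1.
by rewrite memNset// mulr0 f0//; move: k; rewrite /= in_itv.
Qed.

(** As Phi = 0 on G, u has no jump whatever beta is. *)
Lemma smooth_graph u Phi q a b : primitive u Phi -> primitive Phi q -> continuous q ->
  (forall t, G t -> Phi t = 0) -> (forall t, ~ (a <= t < b) -> u t = 0) ->
  (forall t, ~ (a <= t < b) -> q t = 0) -> real_graph u (fun t => - q t).
Proof.
move=> iu iPhi cq PG u0 q0; have cPhi := primitive_continuous iPhi.
split.
- exact: continuous_supported_L2r (primitive_continuous iu) u0.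
- by apply: L2rN; exact: continuous_supported_L2r cq q0.
- exists u, Phi; split; last exact: aeW.
    by move: iPhi; congr primitive; apply/funext => t; rewrite opprK.
  move=> s x sx; rewrite /nuint (iu.2 _ _ sx) /lint.
  have -> : eint mu G s x (fun t => Phi t * beta t) = eint mu G s x (fun=> 0).
    by apply: eq_eint => t Gt _; rewrite PG// mul0r.
  by rewrite /eint Rintegral_cst ?mul0r ?addr0//; exact: measurable_itvE.
Qed.

Lemma bounded_supported_L2r f M a b : measurable_fun (setT : set Borel) (f : Borel -> R) ->
  (forall t, `|f t| <= M) -> (forall t, ~ (a <= t < b) -> f t = 0) -> L2r setT f.
Proof.
move=> mf fM f0.
have := L2r_cut a b mf (locbounded_sqr_locint mf (fun s x => ex_intro _ M (fun t _ => fM t))).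
congr L2r; apply/funext => t; rewrite indicE.
have [k|k] := pselect ((`[a, b[%classic : set R) t); first by rewrite mem_set// mulr1.
by rewrite memNset// mulr0 f0//; move: k; rewrite /= in_itv.
Qed.

Lemma L2r_sub p q : L2r setT p -> L2r setT q -> L2r setT (fun t => p t - q t).
Proof.
move=> Lp Lq; have := L2r_linear 1 (-1) Lp Lq.
by congr L2r; apply/funext => t; rewrite mul1r mulN1r.
Qed.

Lemma sqr_dist_triangle p q w : L2r setT p -> L2r setT q -> L2r setT w ->
  \int[leb]_t ((p t - w t) ^+ 2) <=
  2 * \int[leb]_t ((p t - q t) ^+ 2) + 2 * \int[leb]_t ((q t - w t) ^+ 2).
Proof.
move=> Lp Lq Lw; have [_ ipw] := L2r_sub Lp Lw; have [_ ipq] := L2r_sub Lp Lq.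
have [_ iqw] := L2r_sub Lq Lw.
rewrite -Rintegral_linear//; apply: le_Rintegral => //.
  have := integrableD mT (integrableZl mT 2 ipq) (integrableZl mT 2 iqw).
  by apply: eq_integrable => // t _; rewrite /= EFinD !EFinM.
move=> t _; have : 0 <= (p t - q t - (q t - w t)) ^+ 2 by exact: sqr_ge0.
by nra.
Qed.

(** Two more averages make u twice differentiable.  Forward averages at x only
    depend on values in [x, x + 2 eta[, where f0 vanishes if x is in G and
    2 eta < d; so u' = 0 on G. *)
Lemma smooth_approx f0 L a b d e : a < b -> 0 < d -> 0 < e -> 0 <= L -> lip L f0 ->
  (forall t, ~ (a <= t < b) -> f0 t = 0) -> (forall t, near_set G d t -> f0 t = 0) ->
  exists u v, real_graph u v /\ \int[leb]_t ((f0 t - u t) ^+ 2) < e.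
Proof.
move=> ab d0 e0 L0 lf s0 f0G; have cf := lip_continuous lf.
(* |f0 - u| <= 2 L eta on an interval of length at most b - a + 2, and eta <= 1. *)
pose K := (b - a + 2) * (4 * (L * L)) + 1.
have K1 : 1 <= K by rewrite /K lerDr !mulr_ge0// addr_ge0// subr_ge0 ltW.
have [eta [eta0 eta1 etad etaK]] : exists eta, [/\ 0 < eta, eta <= 1, 2 * eta < d & K * eta < e].
  have K0 : 0 < K by lra.
  exists (Num.min 1 (Num.min (d / 4) (e / (2 * K)))); split.
  - by rewrite !lt_min ltr01 !divr_gt0// mulr_gt0.
  - by rewrite ge_min lexx.
  - have : Num.min 1 (Num.min (d / 4) (e / (2 * K))) <= d / 4 by rewrite !ge_min lexx orbT.
    by lra.
  - have h : Num.min 1 (Num.min (d / 4) (e / (2 * K))) <= e / (2 * K) by rewrite !ge_min lexx !orbT.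
    have := ler_wpM2l (ltW K0) h.
    have -> : K * (e / (2 * K)) = e / 2 by field; rewrite gt_eqF.
    by lra.
have [F0 [iF0 _]] := primitive_exists 0 0 (continuous_locint cf).
pose f1 := avg F0 eta; have lf1 : lip L f1 by exact: avg_lip iF0 lf.
have cf1 := lip_continuous lf1.
have [F1 [iF1 _]] := primitive_exists 0 0 (continuous_locint cf1).
pose u := avg F1 eta; have en0 : eta != 0 by rewrite gt_eqF.
have if1 := avg_primitive en0 cf iF0; rewrite -/f1 in if1.
have iu := avg_primitive en0 cf1 iF1; rewrite -/u in iu.
pose df1 := fun x => (f0 (x + eta) - f0 x) / eta.
have csh (h : R -> R) : continuous h -> continuous (fun x => (h (x + eta) - h x) / eta).
  move=> ch; have h1 : continuous (fun t => h (1 * t + eta)).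
    by move=> t; apply: (@continuous_comp _ _ _ (fun t => 1 * t + eta) h); [exact: affine_continuous|exact: ch].
  have h2 : continuous (fun t => h (t + eta)).
    by rewrite (_ : (fun t => h (t + eta)) = (fun t => h (1 * t + eta)))//; apply/funext => t; rewrite mul1r.
  by move=> x; apply: cvgMl; apply: cvgB; [exact: h2|exact: ch].
have cdf1 : continuous df1 by exact: csh.
have iPhi := avg_primitive en0 cdf1 if1.
have f10 t : ~ (a - eta <= t < b) -> f1 t = 0.
  move=> nt; apply: (avg_eq0 eta0 iF0) => z /andP[z1 z2]; apply: s0 => /andP[z3 z4].
  by apply: nt; apply/andP; split; lra.
have u0 t : ~ (a - 2 * eta <= t < b) -> u t = 0.
  move=> nt; apply: (avg_eq0 eta0 iF1) => z /andP[z1 z2]; apply: f10 => /andP[z3 z4].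
  by apply: nt; apply/andP; split; lra.
have q0 t : ~ (a - 2 * eta <= t < b) -> (df1 (t + eta) - df1 t) / eta = 0.
  move=> nt; rewrite /df1 !s0 ?subrr ?mul0r ?subrr ?mul0r// => /andP[z3 z4];
  by apply: nt; apply/andP; split; lra.
have PG t : G t -> avg f1 eta t = 0.
  move=> Gt; have nG z : t <= z < t + 2 * eta -> f0 z = 0.
    move=> /andP[z1 z2]; apply: f0G; exists t => //; rewrite ger0_norm ?subr_ge0//; lra.
  rewrite /avg /f1 !(avg_eq0 eta0 iF0) ?subrr ?mul0r// => z /andP[z1 z2];
  by apply: nG; apply/andP; split; lra.
have gr := smooth_graph iu iPhi (csh _ cdf1) PG u0 q0.
exists u, (fun t => - ((df1 (t + eta) - df1 t) / eta)); split => //.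
have close t : (f0 t - u t) ^+ 2 <= 4 * (L * L) * eta.
  have h1 := avg_close t eta0 L0 iF0 lf; have h2 := avg_close t eta0 L0 iF1 lf1.
  rewrite -/f1 in h1; rewrite -/u in h2.
  have h : `|f0 t - u t| <= 2 * (L * eta).
    by rewrite distrC -(subrK (f1 t) (u t)) -addrA (le_trans (ler_normD _ _))//; lra.
  rewrite -real_normK ?num_real//.
  have := ler_pM (normr_ge0 _) (normr_ge0 _) h h; rewrite -expr2 => /le_trans; apply.
  have -> : 2 * (L * eta) * (2 * (L * eta)) = (4 * (L * L)) * (eta * eta) by ring.
  by rewrite ler_wpM2l ?mulr_ge0// -[leRHS]mulr1 ler_wpM2l// ltW.
rewrite (Rintegral_supp (s := a - 2 * eta) (x := b)); last first.
  move=> t nt; rewrite u0// s0 ?subrr ?expr0n// => /andP[z3 z4].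
  by apply: nt; apply/andP; split; lra.
have Lf0 := continuous_supported_L2r cf s0.
have [_ isq] := L2r_sub Lf0 (let: And3 h _ _ := gr in h).
apply: le_lt_trans (_ : lint (a - 2 * eta) b (fun=> 4 * (L * L) * eta) < _).
  apply: le_eint => //; first exact: integrable_locint.
  exact: locint_cst.
have -> : lint (a - 2 * eta) b (fun=> 4 * (L * L) * eta) = 4 * (L * L) * eta * (b - (a - 2 * eta)).
  have ab' : a - 2 * eta <= b by lra.
  have := (primitive_affine (4 * (L * L) * eta) 0).2 _ _ ab'; rewrite !addr0 -/(lint _ _ _) => h.
  by apply: (addrI (4 * (L * L) * eta * (a - 2 * eta))); rewrite -h; ring.
apply: le_lt_trans etaK; rewrite /K.
have : 4 * (L * L) * eta * (b - (a - 2 * eta)) <= 4 * (L * L) * eta * (b - a + 2).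
  by rewrite ler_wpM2l ?mulr_ge0// ?(ltW eta0)//; lra.
move=> /le_trans; apply; rewrite mulrDl mul1r -subr_ge0.
by rewrite [X in 0 <= X](_ : _ = eta) ?(ltW eta0)//; ring.
Qed.

Lemma avg_approx g M r d e : measurable_fun (setT : set Borel) (g : Borel -> R) ->
  (forall t, `|g t| <= M) -> (forall t, ~ (- r <= t < r) -> g t = 0) -> 0 < d -> 0 < e ->
  exists H eps, [/\ primitive H g, 0 < eps <= 1, eps < d & \int[leb]_t ((g t - avg H eps t) ^+ 2) < e].
Proof.
move=> mg gM g0 d0 e0.
have Lg := bounded_supported_L2r mg gM g0.
have ig : leb.-integrable (setT : set Borel) (EFin \o g).
  have L1 : L2r setT (\1_(`[- r, r[%classic : set R) : R -> R).
    apply: (@bounded_supported_L2r _ 1 (- r) r).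
    - exact: measurable_indic.
    - by move=> t; rewrite indicE; case: (_ \in _); rewrite ?normr1 ?normr0.
    - by move=> t nt; rewrite indicE memNset//= in_itv.
  have := L2r_mul Lg L1; apply: eq_integrable => // t _ /=; rewrite indicE.
  have [k|k] := pselect ((`[- r, r[%classic : set R) t); first by rewrite mem_set// mulr1.
  by rewrite memNset// mulr0 g0//; move: k; rewrite /= in_itv.
have [H [iH Hcvg]] := avg_cvg_ae ig.
have h1 n : 0 < @harmonic R n <= 1.
  by rewrite harmonic_gt0 /= /harmonic/= invf_le1// ler1n.
have mH : continuous H by exact: primitive_continuous iH.
have mavg n : measurable_fun (setT : set Borel) (avg H (@harmonic R n) : Borel -> R).
  apply: measurable_funM; last exact: measurable_cst.
  apply: measurable_funB; last exact: continuous_measurable.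
  apply: (measurableT_comp (continuous_measurable mH)).
  by apply: measurable_funD => //; exact: measurable_cst.
have a0 n t : ~ (- (r + 1) <= t < r + 1) -> avg H (@harmonic R n) t = 0.
  move=> nt; have /andP[k0 k1] := h1 n; apply: (avg_eq0 k0 iH) => z /andP[z1 z2].
  by apply: g0 => /andP[z3 z4]; apply: nt; apply/andP; split; lra.
have Ld : L2r setT (fun t : R => 2 * M * \1_(`[- (r + 1), r + 1[%classic : set R) t).
  apply: (@bounded_supported_L2r _ (2 * M) (- (r + 1)) (r + 1)).
  - by apply: measurable_funM; [exact: measurable_cst|exact: measurable_indic].
  - have M0 : 0 <= M by apply: le_trans (gM 0).
    by move=> t; rewrite indicE; case: (_ \in _); rewrite ?mulr1 ?mulr0 ?normr0 ?ger0_norm// mulr_ge0.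
  - by move=> t nt; rewrite indicE memNset ?mulr0//= in_itv.
have lim : \int[leb]_(t in setT) ((g t - avg H (@harmonic R n) t) ^+ 2) @[n --> \oo] -->
    \int[leb]_(t in setT) (0 : R).
  apply: (Rintegral_dominated (D := setT) (f := fun=> 0) mT Ld.2).
  - move=> n; apply: measurable_sqr; apply: measurable_funB => //.
  - exact: measurable_cst.
  - apply: lebS Hcvg => x hx _.
    have h2 : g x - avg H (@harmonic R n) x @[n --> \oo] --> g x - g x.
      by apply: cvgB => //; exact: cvg_cst.
    have h3 : (g x - avg H (@harmonic R n) x) * (g x - avg H (@harmonic R n) x) @[n --> \oo] -->
        (g x - g x) * (g x - g x) by exact: cvgM.
    by rewrite subrr mulr0 in h3; exact: h3.
  - move=> n t _; rewrite normrX.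
    have [tin|nt] := pselect (- (r + 1) <= t < r + 1).
      rewrite indicE mem_set ?mulr1; last by rewrite /= in_itv.
      rewrite ler_sqr ?nnegrE//; last first.
        by rewrite mulr_ge0// (le_trans _ (gM 0)).
      have /andP[k0 k1] := h1 n.
      have := avg_bound t k0 iH gM; have := gM t; have := ler_normB (g t) (avg H (@harmonic R n) t).
      by lra.
    rewrite a0// g0 ?subrr ?normr0 ?expr0n ?sqr_ge0// => /andP[z3 z4].
    by apply: nt; apply/andP; split; lra.
have i00 : \int[leb]_(t in setT) (0 : R) = 0 by rewrite Rintegral_cst// mul0r.
rewrite i00 in lim.
have h2 : \forall n \near \oo, \int[leb]_(t in setT) ((g t - avg H (@harmonic R n) t) ^+ 2) < e.
  exact: (cvgr_lt _ lim).
have h3 : \forall n \near \oo, @harmonic R n < d by exact: (cvgr_lt _ (@cvg_harmonic R)).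
near \oo => n; exists H, (@harmonic R n); split => //.
  by near: n; exact: h3.
by near: n; exact: h2.
Unshelve. all: by end_near. Qed.

Lemma bounded_dense g M r d e : measurable_fun (setT : set Borel) (g : Borel -> R) ->
  (forall t, `|g t| <= M) -> (forall t, ~ (- r <= t < r) -> g t = 0) -> 0 < r ->
  0 < d -> (forall t, near_set G d t -> g t = 0) -> 0 < e ->
  exists u v, real_graph u v /\ \int[leb]_t ((g t - u t) ^+ 2) < e.
Proof.
move=> mg gM g0 r0 d0 gG e0.
have M0 : 0 <= M by apply: le_trans (gM 0).
have d2 : 0 < d / 2 by rewrite divr_gt0.
have e4 : 0 < e / 4 by rewrite divr_gt0.
have [H [eps [iH /andP[eps0 eps1] epsd close]]] := avg_approx mg gM g0 d2 e4.
have lH := primitive_lip iH gM.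
have a0 t : ~ (- (r + 1) <= t < r + 1) -> avg H eps t = 0.
  move=> nt; apply: (avg_eq0 eps0 iH) => z /andP[z1 z2].
  by apply: g0 => /andP[z3 z4]; apply: nt; apply/andP; split; lra.
have aG t : near_set G (d / 2) t -> avg H eps t = 0.
  case=> y Gy ty; apply: (avg_eq0 eps0 iH) => z /andP[z1 z2]; apply: gG; exists y => //.
  have : `|z - t| < d / 2 by rewrite ger0_norm ?subr_ge0//; lra.
  have := ler_normD (z - t) (t - y); rewrite addrA subrK; lra.
have la : lip (2 * M / eps) (avg H eps).
  move=> x y; rewrite /avg -mulrBl normrM normfV (gtr0_norm eps0) mulrAC ler_wpM2r ?invr_ge0 ?(ltW eps0)//.
  have -> : H (x + eps) - H x - (H (y + eps) - H y) = (H (x + eps) - H (y + eps)) - (H x - H y) by ring.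
  apply: (le_trans (ler_normB _ _)).
  have := lH (x + eps) (y + eps); have -> : x + eps - (y + eps) = x - y by ring.
  by have := lH x y; lra.
have rr : - (r + 1) < r + 1 by lra.
have L0 : 0 <= 2 * M / eps by rewrite divr_ge0 ?mulr_ge0// ltW.
have [u [v [gr uclose]]] := smooth_approx rr d2 e4 L0 la a0 aG.
exists u, v; split => //.
have Lg := bounded_supported_L2r mg gM g0.
have La := continuous_supported_L2r (lip_continuous la) a0.
have := sqr_dist_triangle Lg La (let: And3 h _ _ := gr in h).
by lra.
Qed.

End Density.

Section RealDensity.
Context {R : realType}.
Local Notation Borel := (measurableTypeR R).
Local Notation leb := (@lebesgue_measure R).
Variables (G : set R) (mu : {finite_measure set Borel -> \bar R}) (beta : R -> R).
Hypothesis cG : closed G.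
Hypothesis nG : leb G = 0%E.
Hypothesis beta_integrable : mu.-integrable (G : set Borel) (EFin \o beta).
Implicit Types (F f g h p q u v w Phi phi psi : R -> R) (s t x a b c r M L : R).
Let mT := @measurableT _ Borel.
Let mG : measurable (G : set Borel) := closed_measurable cG.
Local Notation real_graph := (real_graph G mu beta).

Lemma quarters (x y z e : R) : z <= 2 * x + 2 * y -> x < e / 4 -> y < e / 4 -> z < e.
Proof. by lra. Qed.

Lemma ae_notin : {ae leb, forall x, ~ G x}.
Proof. by exists G; split => // x /=; rewrite notK. Qed.

(** Truncation in size, in space, and near G: the truncated functions converge
    off G, hence almost everywhere. *)
Lemma real_dense h e : L2r setT h -> 0 < e ->
  exists u v, real_graph u v /\ \int[leb]_t ((h t - u t) ^+ 2) < e.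
Proof.
move=> Lh e0; have [mh ih] := Lh.
pose S (n : nat) : set R := [set t | `|h t| <= n%:R].
have mS n : measurable (S n : set Borel).
  have mn : measurable_fun (setT : set Borel) ((fun t => `|h t|) : Borel -> R).
    exact: (measurableT_comp _ mh).
  have := mn mT _ (measurable_itv `]-oo, n%:R]); rewrite setTI.
  by congr measurable; apply/seteqP; split => t /=; rewrite in_itv.
pose c (n : nat) t : R :=
  \1_(S n) t * \1_(`[- n%:R, n%:R[%classic : set R) t * (1 - \1_(near_set G n.+1%:R^-1) t).
have c01 n t : 0 <= c n t <= 1.
  have h1 := indic01 (S n) t; have h2 := indic01 (`[- n%:R, n%:R[%classic : set R) t.
  have /andP[h3 h4] := indic01 (near_set G n.+1%:R^-1) t.
  move: h1 h2 => /andP[a1 a2] /andP[b1 b2]; rewrite /c.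
  by rewrite !mulr_ge0 ?subr_ge0//= !mulr_ile1 ?mulr_ge0 ?subr_ge0// gerBl.
have mc n : measurable_fun (setT : set Borel) (c n : Borel -> R).
  apply: measurable_funM; first by apply: measurable_funM; exact: measurable_indic.
  by apply: measurable_funB; [exact: measurable_cst|apply: measurable_indic; exact: near_set_measurable].
have cvg_c t : ~ G t -> c n t @[n --> \oo] --> (1 : R).
  move=> nGt.
  have c1 : \1_(S n) t @[n --> \oo] --> (1 : R).
    apply: cvg_near_cst; near=> n; rewrite indicE mem_set//=.
    by near: n; exact: nbhs_infty_ger.
  have c2 : \1_(`[- n%:R, n%:R[%classic : set R) t @[n --> \oo] --> (1 : R).
    apply: cvg_near_cst; near=> n; rewrite indicE mem_set//= in_itv/=.
    have : `|t| < n%:R by near: n; exact: nbhs_infty_gtr.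
    by rewrite ltr_norml => /andP[h1 h2]; rewrite (ltW h1) h2.
  have c3 : 1 - \1_(near_set G n.+1%:R^-1) t @[n --> \oo] --> 1 - (\1_G t : R).
    by apply: cvgB; [exact: cvg_cst|exact: near_set_cvg].
  have -> : 1 = 1 * 1 * (1 - \1_G t : R) by rewrite indicE memNset// subr0 !mulr1.
  by apply: cvgM => //; exact: cvgM.
have lim : \int[leb]_(t in setT) ((h t - h t * c n t) ^+ 2) @[n --> \oo] -->
    \int[leb]_(t in setT) (0 : R).
  apply: (Rintegral_dominated (D := setT) (f := fun=> 0) mT ih).
  - move=> n; apply: measurable_sqr; apply: measurable_funB => //; exact: measurable_funM.
  - exact: measurable_cst.
  - apply: lebS ae_notin => t nGt _.
    have h2 : h t - h t * c n t @[n --> \oo] --> h t - h t * 1.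
      by apply: cvgB; [exact: cvg_cst|apply: cvgMr; exact: cvg_c].
    have h3 : (h t - h t * c n t) * (h t - h t * c n t) @[n --> \oo] -->
        (h t - h t * 1) * (h t - h t * 1) by exact: cvgM.
    by rewrite mulr1 subrr mulr0 in h3; exact: h3.
  - move=> n t _; rewrite ger0_norm ?sqr_ge0//.
    have /andP[c0 c1] := c01 n t.
    have -> : h t - h t * c n t = h t * (1 - c n t) by ring.
    rewrite exprMn ler_piMr ?sqr_ge0// expr2 mulr_ile1 ?subr_ge0// gerBl//.
have i00 : \int[leb]_(t in setT) (0 : R) = 0 by rewrite Rintegral_cst// mul0r.
rewrite i00 in lim.
have e4 : 0 < e / 4 by rewrite divr_gt0.
have h2 : \forall n \near \oo, \int[leb]_(t in setT) ((h t - h t * c n t) ^+ 2) < e / 4.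
  exact: (cvgr_lt _ lim).
near \oo => n.
have close : \int[leb]_(t in setT) ((h t - h t * c n t) ^+ 2) < e / 4 by near: n; exact: h2.
have n0 : 0 < n%:R :> R by rewrite ltr0n; near: n; exact: nbhs_infty_gt.
have mg : measurable_fun (setT : set Borel) ((fun t => h t * c n t) : Borel -> R).
  exact: measurable_funM.
have gM t : `|h t * c n t| <= n%:R.
  have /andP[c0 c1] := c01 n t.
  have [St|nSt] := pselect (S n t).
    by rewrite normrM (ger0_norm c0) (le_trans _ St)// ler_piMr.
  by rewrite /c indicE memNset// !mul0r mulr0 normr0 ltW.
have g0 t : ~ (- n%:R <= t < n%:R) -> h t * c n t = 0.
  by move=> nt; rewrite /c [in X in _ * X]indicE [X in _ * X * _](_ : _ = 0) ?mulr0 ?mul0r ?mulr0// indicE memNset//= in_itv.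
have gG t : near_set G n.+1%:R^-1 t -> h t * c n t = 0.
  by move=> Gt; rewrite /c [X in 1 - X]indicE mem_set// subrr !mulr0.
have n1 : 0 < n.+1%:R^-1 :> R by rewrite invr_gt0.
have [u [v [gr uclose]]] := bounded_dense mu beta mG mg gM g0 n0 n1 gG e4.
exists u, v; split => //.
have Lg := bounded_supported_L2r mg gM g0.
exact: quarters (sqr_dist_triangle Lh Lg (let: And3 h _ _ := gr in h)) close uclose.
Unshelve. all: by end_near. Qed.

End RealDensity.

(** * Eigenfunctions *)

Section Eigenfunctions.
Context {R : realType}.
Local Notation Borel := (measurableTypeR R).
Local Notation leb := (@lebesgue_measure R).
Variables (G : set R) (mu : {finite_measure set Borel -> \bar R}) (beta : R -> R).
Hypothesis mG : measurable (G : set Borel).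
Hypothesis beta_integrable : mu.-integrable (G : set Borel) (EFin \o beta).
Variables (A B : R).
Hypothesis AB : A < B.
Hypothesis GAB : forall x, G x -> A < x < B.
Implicit Types (F f g h p q u v w Phi phi psi : R -> R) (s t x a b c r kap : R).
Let mT := @measurableT _ Borel.
Local Notation nuprim := (nuprim G mu beta).
Local Notation sol := (sol G mu beta).
Local Notation jost := (jost G mu beta A).
Local Notation mismatch := (mismatch B).
Local Notation real_graph := (real_graph G mu beta).

Lemma primitive_ae F p q : measurable_fun (setT : set Borel) (p : Borel -> R) -> locint leb setT q ->
  measurable_fun (setT : set Borel) (q : Borel -> R) ->
  {ae leb, forall x, p x = q x} -> primitive F p -> primitive F q.
Proof.
move=> mp lq mq pq [lp iF]; split => // s x sx.
rewrite (iF _ _ sx) -![eint leb setT _ _ _]/(lint _ _ _) !lint_ind; congr (_ + _).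
apply: ae_eq_Rintegral; last by apply: lebS pq => y ->.
  by apply: measurable_funM => //; exact: measurable_indic.
by apply: measurable_funM => //; exact: measurable_indic.
Qed.

(** Integrating g^2 >= c^2 over an interval of length n gives n c^2 <= int g^2. *)
Lemma L2r_tail g c : L2r setT g -> (forall n : nat, exists s, forall t, s <= t < s + n%:R -> `|c| <= `|g t|) ->
  c = 0.
Proof.
move=> Lg hg; apply/eqP; rewrite -normr_le0 leNgt; apply/negP => c0.
pose I := \int[leb]_t (g t ^+ 2).
have I0 : 0 <= I by apply: Rintegral_ge0 => // t _; exact: sqr_ge0.
have c2 : 0 < `|c| ^+ 2 by rewrite exprn_gt0.
near \oo => n.
have nI : I / `|c| ^+ 2 < n%:R by near: n; exact: nbhs_infty_gtr.
have [s hs] := hg n.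
have sn : s <= s + n%:R by rewrite lerDl.
have : lint s (s + n%:R) (fun=> `|c| ^+ 2) <= lint s (s + n%:R) (fun t => g t ^+ 2).
  apply: le_eint => //; [exact: locint_cst|exact: L2r_locint2|].
  by move=> t _ /hs h; rewrite -[leRHS]real_normK ?num_real// ler_pXn2r ?nnegrE.
have := lint_le_int s (s + n%:R) Lg.2 (fun t => sqr_ge0 (g t)); rewrite -/I.
have -> : lint s (s + n%:R) (fun=> `|c| ^+ 2) = `|c| ^+ 2 * n%:R.
  have := (primitive_affine (`|c| ^+ 2) 0).2 _ _ sn; rewrite !addr0 -/(lint _ _ _) mulrDr.
  by move/addrI.
rewrite ltr_pdivrMr// mulrC in nI.
by move=> h1 /le_trans/(_ h1); rewrite leNgt nI.
Unshelve. all: by end_near. Qed.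

Lemma exp_right_eq0 g c k a : L2r setT g -> 0 <= k ->
  (forall x, a <= x -> g x = c * expR (k * (x - a))) -> c = 0.
Proof.
move=> Lg k0 hg; apply: (L2r_tail Lg) => n; exists a => t /andP[at_ _].
by rewrite hg// normrM (gtr0_norm (expR_gt0 _)) ler_peMr// -expR0 ler_expR mulr_ge0// subr_ge0.
Qed.

Lemma exp_left_eq0 g c k a : L2r setT g -> k <= 0 ->
  (forall x, x <= a -> g x = c * expR (k * (x - a))) -> c = 0.
Proof.
move=> Lg k0 hg; apply: (L2r_tail Lg) => n; exists (a - n%:R) => t; rewrite subrK => /andP[_ /ltW ta].
by rewrite hg// normrM (gtr0_norm (expR_gt0 _)) ler_peMr// -expR0 ler_expR mulr_le0// subr_le0.
Qed.

Lemma sol_zero k : sol k (fun=> 0) (fun=> 0).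
Proof.
split; last exact: nuprim_cst.
by have := @increments_cst _ leb setT mT 0; congr increments; apply/funext => t; rewrite mulr0.
Qed.

Lemma sol_scale a k psi Phi : sol k psi Phi -> sol k (fun t => a * psi t) (fun t => a * Phi t).
Proof.
move=> [iPhi npsi]; have cPhi := primitive_continuous iPhi; split.
  have := increments_linear mT a 0 iPhi iPhi.
  by congr increments; apply/funext => t; rewrite mul0r addr0//; ring.
have := nuprim_linear mG beta_integrable a 0 cPhi cPhi npsi npsi.
by congr (nuprim _ _); apply/funext => t; rewrite mul0r addr0.
Qed.

(** Square integrability of psi and Phi rules out the growing exponential in
    both tails.  Moreover psi A <> 0, for otherwise Phi A = 0 as well and psi
    would vanish identically; so psi can be normalised at A. *)
Lemma graph_eigen_jost kap u : 0 < kap -> real_graph u (fun t => - kap ^+ 2 * u t) ->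
  ~ {ae leb, forall x, u x = 0} -> exists psi Phi, jost kap psi Phi /\ mismatch kap psi Phi = 0.
Proof.
move=> kap0 [Lu Lv [psi [Phi [iPhi npsi upsi]]]] u0.
have cPhi := primitive_continuous iPhi.
have mpsi := nuprim_measurable mG beta_integrable cPhi npsi.
have lpsi := nuprim_locint mG beta_integrable cPhi npsi.
have Lpsi := L2r_ae Lu mpsi upsi.
have LPhi := quasiderivative_L2 mG beta_integrable GAB Lpsi Lv iPhi npsi.
have S : sol (kap ^+ 2) psi Phi.
  split => //; apply: primitive_ae iPhi.
  - apply: measurableT_comp => //; apply: measurable_funM; [exact: measurable_cst|by case: Lu].
  - have := locint_linear mT (kap ^+ 2) 0 lpsi lpsi.
    by congr locint; apply/funext => t; rewrite mul0r addr0.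
  - by apply: measurable_funM; [exact: measurable_cst|].
  - by apply: lebS upsi => t ->; rewrite mulNr opprK.
have S' : sol ((- kap) ^+ 2) psi Phi by rewrite sqrrN.
have Lc c : L2r setT (fun t => Phi t + c * psi t).
  by have := L2r_linear 1 c LPhi Lpsi; congr L2r; apply/funext => t; rewrite mul1r.
have eA : Phi A + - kap * psi A = 0.
  apply: (@exp_left_eq0 (fun t => Phi t + - kap * psi t) _ (- kap) A (Lc _)).
    by rewrite oppr_le0 ltW.
  by move=> x xA; exact: (sol_left_tail mG beta_integrable GAB S').
have eB : Phi B + kap * psi B = 0.
  apply: (@exp_right_eq0 (fun t => Phi t + kap * psi t) _ kap B (Lc _) (ltW kap0)).
  by move=> x xB; exact: (sol_right_tail mG beta_integrable GAB S).
have psiA : psi A != 0.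
  apply/eqP => pA; apply: u0; apply: lebS upsi => t ->.
  have [] := sol_unique mG beta_integrable t S (sol_zero (kap ^+ 2)) pA => //.
  by move: eA; rewrite pA mulr0 addr0.
have SA := sol_scale (psi A)^-1 S.
exists (fun t => (psi A)^-1 * psi t), (fun t => (psi A)^-1 * Phi t); split.
  split => //; first by rewrite mulVf.
  have -> : Phi A = kap * psi A by move/eqP: eA; rewrite mulNr subr_eq0 => /eqP.
  by rewrite mulrC mulfK.
by rewrite /(mismatch _ _ _) mulrCA -mulrDr eB mulr0.
Qed.

Lemma lint_expR k a s x : s <= x ->
  k * lint s x (fun t => expR (k * (t - a))) = expR (k * (x - a)) - expR (k * (s - a)).
Proof.
move=> sx; have iE := primitive_expR k a.
have [k0|k0] := eqVneq k 0; first by rewrite k0 !mul0r subrr.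
rewrite -(increments_eint iE sx) -/(lint _ _ _) [in RHS]/lint.
have le : locint leb setT (fun t => expR (k * (t - a))).
  have := locint_linear mT k^-1 0 iE.1 iE.1.
  by congr locint; apply/funext => t; rewrite mul0r addr0 mulrA mulVf// mul1r.
by rewrite -/(lint _ _ _) lintZ.
Qed.

(** Both tails of psi are decaying exponentials.  The left one does not vanish,
    so psi is not 0 almost everywhere. *)
Lemma jost_graph kap psi Phi : 0 < kap -> jost kap psi Phi -> mismatch kap psi Phi = 0 ->
  real_graph psi (fun t => - kap ^+ 2 * psi t) /\ ~ {ae leb, forall x, psi x = 0}.
Proof.
move=> kap0 [S pA PA] m0; have [iPhi npsi] := S.
have S' : sol ((- kap) ^+ 2) psi Phi by rewrite sqrrN.
have cPhi := primitive_continuous iPhi.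
have mpsi := nuprim_measurable mG beta_integrable cPhi npsi.
have bpsi := nuprim_locbounded mG beta_integrable cPhi npsi.
have kn : 2 * kap != 0 by rewrite mulf_neq0// gt_eqF.
have left x : x <= A -> psi x = expR (kap * (x - A)).
  move=> xA; have e1 := sol_left_tail mG beta_integrable GAB S xA; have e2 := sol_left_tail mG beta_integrable GAB S' xA.
  rewrite PA pA mulr1 in e1; rewrite PA pA mulr1 subrr mul0r in e2.
  apply: (mulfI kn); have <- : Phi x + kap * psi x - (Phi x + - kap * psi x) = 2 * kap * psi x by ring.
  by rewrite e1 e2 subr0; ring.
have right x : B <= x -> psi x = psi B * expR (- kap * (x - B)).
  move=> xB; have e1 := sol_right_tail mG beta_integrable GAB S xB; have e2 := sol_right_tail mG beta_integrable GAB S' xB.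
  rewrite -/(mismatch kap psi Phi) m0 mul0r in e1.
  apply: (mulfI kn); have <- : Phi x + kap * psi x - (Phi x + - kap * psi x) = 2 * kap * psi x by ring.
  have eB : Phi B = - (kap * psi B) by apply/eqP; rewrite -addr_eq0; apply/eqP.
  by rewrite e1 e2 eB; ring.
have sq0 t : 0 <= psi t ^+ 2 by exact: sqr_ge0.
have ls := locbounded_sqr_locint mpsi bpsi.
have le k a : locint leb setT (fun t => expR (k * (t - a))).
  by apply: continuous_locint => t; apply: continuous_comp; [|exact: continuous_expR];
     apply: cvgMr; apply: cvgB; [exact: cvg_id|exact: cvg_cst].
have Lpsi : L2r setT psi.
  split => //.
  apply: (integrable_bounded_lint (C := (2 * kap)^-1 + lint A B (fun t => psi t ^+ 2) + psi B ^+ 2 / (2 * kap))) => //.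
    exact: measurable_sqr.
  near=> n.
  have nA : - n%:R <= A by rewrite lerNl; near: n; exact: nbhs_infty_ger.
  have nB : B <= n%:R by near: n; exact: nbhs_infty_ger.
  rewrite /lint (eintD mT ls nA (le_trans (ltW AB) nB)) (eintD mT ls (ltW AB) nB) -addrA.
  have h1 : eint leb setT (- n%:R) A (fun t => psi t ^+ 2) <= (2 * kap)^-1.
    have -> : eint leb setT (- n%:R) A (fun t => psi t ^+ 2) = lint (- n%:R) A (fun t => expR (2 * kap * (t - A))).
      by apply: eq_eint => t _ /andP[_ /ltW tA]; rewrite left// -expRM_natl mulrA.
    have := lint_expR (2 * kap) A nA; rewrite subrr mulr0 expR0 => h.
    rewrite -[leRHS]mul1r ler_pdivlMr ?mulr_gt0// mulrC h.
    by rewrite gerBl expR_ge0.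
  have h2 : eint leb setT B n%:R (fun t => psi t ^+ 2) <= psi B ^+ 2 / (2 * kap).
    have -> : eint leb setT B n%:R (fun t => psi t ^+ 2) =
        psi B ^+ 2 * lint B n%:R (fun t => expR (- (2 * kap) * (t - B))).
      rewrite -lintZ//; apply: eq_eint => t _ /andP[Bt _].
      by rewrite right// exprMn -expRM_natl mulrA mulrN.
    rewrite ler_wpM2l ?sqr_ge0//.
    have := lint_expR (- (2 * kap)) B nB; rewrite subrr mulr0 expR0 => h.
    rewrite -[leRHS]mul1r ler_pdivlMr ?mulr_gt0//.
    have := expR_ge0 (- (2 * kap) * (n%:R - B)); lra.
  by apply: lerD => //; rewrite lerD2l.
split.
  split => //; first by have := L2r_linear (- kap ^+ 2) 0 Lpsi Lpsi; congr L2r; apply/funext => t; rewrite mul0r addr0.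
  exists psi, Phi; split => //; last exact: aeW.
  by have := iPhi; congr primitive; apply/funext => t; rewrite mulNr opprK.
move=> psi0.
have h0 : lint (A - 1) A psi = 0.
  rewrite lint_ind -(_ : \int[leb]_(t in setT) (0 : R) = 0); last by rewrite Rintegral_cst// mul0r.
  apply: ae_eq_Rintegral; last by apply: lebS psi0 => t ->; rewrite mul0r.
    by apply: measurable_funM => //; exact: measurable_indic.
  exact: measurable_cst.
have A1 : A - 1 <= A by lra.
have h1 : lint (A - 1) A psi = lint (A - 1) A (fun t => expR (kap * (t - A))).
  by apply: eq_eint => t _ /andP[_ /ltW tA]; rewrite left.
have := lint_expR kap A A1; rewrite -h1 h0 mulr0 subrr mulr0 expR0 => /esym/eqP.
by rewrite subr_eq0 eq_sym lt_eqF// expR_lt1 addrAC subrr sub0r mulrN1 oppr_lt0.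
Unshelve. all: by end_near. Qed.

End Eigenfunctions.

(** * Real and imaginary parts of the operator *)

Section OffGamma.
Context {R : realType}.
Local Notation Borel := (measurableTypeR R).
Local Notation leb := (@lebesgue_measure R).
Variables (G : set R) (mu : {finite_measure set Borel -> \bar R}) (beta : R -> R).
Hypothesis cG : closed G.
Hypothesis nG : leb G = 0%E.
Hypothesis beta_integrable : mu.-integrable (G : set Borel) (EFin \o beta).
Implicit Types (F f g h p q u v w Phi phi psi : R -> R) (s t x a b c r kap : R) (D E : set R).
Let mT := @measurableT _ Borel.
Let mG : measurable (G : set Borel) := closed_measurable cG.
Local Notation nuprim := (nuprim G mu beta).
Local Notation nuint := (nuint G mu beta).
Local Notation real_graph := (real_graph G mu beta).

Lemma ae_eq_Rintegral_set D E p q : measurable (D : set Borel) -> measurable (E : set Borel) ->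
  measurable_fun (D : set Borel) (p : Borel -> R) -> measurable_fun (E : set Borel) (q : Borel -> R) ->
  {ae leb, forall x, (p \_ D) x = (q \_ E) x} ->
  \int[leb]_(t in D) p t = \int[leb]_(t in E) q t.
Proof.
move=> mD mE mp mq pq; rewrite Rintegral_mkcond [RHS]Rintegral_mkcond.
by apply: ae_eq_Rintegral => //; apply/(measurable_restrictT _ _).1.
Qed.

Lemma measurable_offG s x : measurable (`]s, x[ `\` G : set Borel).
Proof. by apply: measurableD. Qed.

(** The set G and the end point s are Lebesgue-null. *)
Lemma Rintegral_off p q s x : measurable_fun (~` G : set Borel) (p : Borel -> R) ->
  measurable_fun (setT : set Borel) (q : Borel -> R) -> {ae leb, forall t, ~ G t -> p t = q t} ->
  \int[leb]_(t in `]s, x[ `\` G) p t = lint s x q.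
Proof.
move=> mp mq pq; rewrite /lint /eint setIT.
apply: ae_eq_Rintegral_set => //; first exact: measurable_offG.
- by apply: measurable_funS mp; [exact: measurableC|move=> t []].
- exact: measurable_funS mq.
have ns : {ae leb, forall t, t <> s}.
  by exists [set s]; split => //; [exact: lebesgue_measure_set1|move=> t /=; rewrite notK].
have h := lebS2 (Q := fun t => t <> s /\ ~ G t) (fun t => @conj _ _) ns (ae_notin cG nG).
apply: lebS2 pq h => t pq [ts nGt]; rewrite !patchE.
have [tx|ntx] := pselect (s < t < x).
  have /andP[st tx'] := tx.
  by rewrite mem_set ?mem_set ?pq//= ?in_itv/= ?(ltW st).
rewrite !memNset//= ?in_itv/=; last by case.
by move=> /andP[]; rewrite le_eqVlt => /predU1P[/esym//|st tx]; apply: ntx; rewrite st.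
Qed.

Lemma Rintegral_offT p : measurable_fun (setT : set Borel) (p : Borel -> R) ->
  \int[leb]_(t in ~` G) p t = \int[leb]_t p t.
Proof.
move=> mp; apply: ae_eq_Rintegral_set => //; [exact: measurableC|exact: measurable_funS mp|].
by apply: lebS (ae_notin cG nG) => t nGt; rewrite !patchE !mem_set.
Qed.

(** Every interval contains points off G, so one-sided limits along the
    complement of G make sense at every point. *)
Lemma within_right_proper x : ProperFilter (within (~` G) x^'+).
Proof.
apply: Build_ProperFilter_ex => P; rewrite /within/= => /nbhs_ballP[e /= e0 h].
have xe : x < x + e by rewrite ltrDl.
have [c [/andP[xc ce] nGc]] := null_gap cG nG xe.
by exists c; apply: h => //; rewrite /ball/= ltr_norml; apply/andP; split; lra.
Qed.

Lemma within_left_proper x : ProperFilter (within (~` G) x^'-).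
Proof.
apply: Build_ProperFilter_ex => P; rewrite /within/= => /nbhs_ballP[e /= e0 h].
have xe : x - e < x by rewrite gtrBl.
have [c [/andP[xc ce] nGc]] := null_gap cG nG xe.
by exists c; apply: h => //; rewrite /ball/= ltr_norml; apply/andP; split; lra.
Qed.

Lemma lim_off_right p Phi x : continuous Phi -> (forall t, ~ G t -> p t = Phi t) ->
  lim (p @ within (~` G) x^'+) = Phi x.
Proof.
move=> cPhi pP; have pf := within_right_proper x; apply: cvg_lim => //.
move=> P /(cPhi x) hP.
by apply: (@filterS _ (nbhs x) _ _ _ _ hP) => t Pt _ /pP; rewrite /= => ->.
Qed.

Lemma lim_off_left p Phi x : continuous Phi -> (forall t, ~ G t -> p t = Phi t) ->
  lim (p @ within (~` G) x^'-) = Phi x.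
Proof.
move=> cPhi pP; have pf := within_left_proper x; apply: cvg_lim => //.
move=> P /(cPhi x) hP.
by apply: (@filterS _ (nbhs x) _ _ _ _ hP) => t Pt _ /pP; rewrite /= => ->.
Qed.

(** Off G the part of psi that comes from mu is locally constant. *)
Lemma nuprim_continuous_off psi f x : continuous f -> nuprim psi f -> ~ G x -> {for x, continuous psi}.
Proof.
move=> cf npsi nGx; have [psi1 [psi2 [i1 i2 ->]]] := nuprimP mG beta_integrable cf npsi.
have : nbhs x (~` G) by apply: open_nbhs_nbhs; split => //; exact: closed_openC.
move=> /nbhs_ballP[e /= e0 h].
have psi2x y : `|x - y| < e -> psi2 y = psi2 x.
  have key a b : a <= b -> (forall t, a <= t < b -> ~ G t) -> psi2 b = psi2 a.
    move=> ab nG'; rewrite (i2.2 _ _ ab).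
    have -> : eint mu G a b (fun t => f t * beta t) = eint mu G a b (fun=> 0).
      by apply: eq_eint => t Gt /nG'.
    by rewrite /eint Rintegral_cst ?mul0r ?addr0//; exact: measurable_itvE.
  rewrite ltr_norml => /andP[y1 y2]; have [xy|/ltW yx] := leP x y.
    apply: key => // t /andP[t1 t2]; apply: h; rewrite /ball/= ltr_norml.
    by apply/andP; split; lra.
  apply/esym; apply: key => // t /andP[t1 t2]; apply: h; rewrite /ball/= ltr_norml.
  by apply/andP; split; lra.
have c1 := primitive_continuous i1.
apply: (@cvgD _ _ _ _ _ psi1 psi2); first exact: c1.
apply: cvg_near_cst; apply/nbhs_ballP; exists e => //= y; rewrite /ball/= => xy.
Qed.

Lemma test_functionP phi : test_function (~` G) phi -> exists dphi r,
  [/\ primitive phi dphi /\ phi^`()%classic = dphi, continuous dphi,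
   [/\ 0 < r, phi (- r) = 0 & phi r = 0],
   forall t, ~ (- r <= t < r) -> phi t = 0 /\ dphi t = 0 & forall t, G t -> phi t = 0].
Proof.
case=> dphi cphi sphi; set S := [set x | phi x != 0] in cphi sphi.
have dp x : derivable phi x 1 by have := dphi 0%N x; rewrite derive1n0.
have cdp : continuous (phi^`()%classic).
  move=> x; apply: differentiable_continuous; apply/derivable1_diffP.
  by have := dphi 1%N x; rewrite derive1n1.
have : bounded_set (closure S) by exact: compact_bounded.
move=> [M [_ hM]]; pose r := `|M| + 1.
have Sr x : closure S x -> `|x| <= r.
  by move=> Sx; apply: (hM r) => //; rewrite /r (le_lt_trans (ler_norm M))// ltrDl.
have out x : r < `|x| -> ~ closure S x by move=> rx /Sr; rewrite leNgt rx.
have phi0 x : ~ closure S x -> phi x = 0.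
  by move=> nS; apply/eqP/negP => /negP h; apply: nS; exact: subset_closure.
have d0 x : ~ closure S x -> phi^`()%classic x = 0.
  move=> nS; have oS : open (~` closure S) by apply: closed_openC; exact: closed_closure.
  rewrite derive1E; have : \near x, phi x = (cst 0 : R -> R) x.
    by apply: filterS (open_nbhs_nbhs (conj oS nS)) => y /phi0.
  by move=> h; rewrite (near_eq_derive _ h) derive_cst.
have r0 : 0 < r by rewrite /r ltr_wpDl.
have far t : ~ (- (r + 1) < t < r + 1) -> phi t = 0 /\ phi^`()%classic t = 0.
  move=> nt; have /out nS : r < `|t|.
    rewrite ltNge; apply/negP; rewrite ler_norml => /andP[t1 t2].
    by apply: nt; apply/andP; split; lra.
  by split; [exact: phi0|exact: d0].
exists (phi^`()%classic), (r + 1); split => //.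
- by split => //; apply: is_derive_primitive => // x; apply: DeriveDef => //; rewrite derive1E.
- split; first by rewrite ltr_wpDl// ltW.
  + by apply: (far _ _).1; rewrite ltxx.
  + by apply: (far _ _).1; rewrite ltxx andbF.
- by move=> t nt; apply: far => /andP[t1 t2]; apply: nt; rewrite (ltW t1).
- by move=> t Gt; apply: phi0 => /sphi.
Qed.

(** The test function vanishes on G, which removes the jumps of psi. *)
Lemma weak_derivative_nuprim psi f phi : continuous f -> nuprim psi f ->
  test_function (~` G) phi ->
  \int[leb]_(t in ~` G) (psi t * phi^`()%classic t) = - \int[leb]_(t in ~` G) (f t * phi t).
Proof.
move=> cf npsi /test_functionP[dphi [r [[iphi ->] cdphi [r0 phil phir] out phiG]]].
have cphi := primitive_continuous iphi.
have mpsi := nuprim_measurable mG beta_integrable cf npsi.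
rewrite !Rintegral_offT; last 2 first.
- by apply: measurable_funM; exact: continuous_measurable.
- by apply: measurable_funM => //; exact: continuous_measurable.
rewrite !(Rintegral_supp (s := - r) (x := r)); last 2 first.
- by move=> t /out[-> _]; rewrite mulr0.
- by move=> t /out[_ ->]; rewrite mulr0.
have rr : - r <= r by lra.
have := nuprim_by_parts mG beta_integrable rr iphi cf npsi.
rewrite phir phil !mul0r subrr /(nuint _ _ _).
have -> : eint mu G (- r) r (fun t => phi t * f t * beta t) = eint mu G (- r) r (fun=> 0).
  by apply: eq_eint => t Gt _; rewrite phiG// !mul0r.
rewrite [eint mu _ _ _ _]Rintegral_cst; last exact: measurable_itvE.
rewrite mul0r addr0 => /esym/eqP; rewrite addr_eq0 => /eqP.
have -> : (fun t => psi t * dphi t) = (fun t => dphi t * psi t) by apply/funext => t; rewrite mulrC.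
by have -> : (fun t => f t * phi t) = (fun t => phi t * f t) by apply/funext => t; rewrite mulrC.
Qed.

Lemma weak_derivative_primitive Phi q phi : primitive Phi q ->
  measurable_fun (setT : set Borel) (q : Borel -> R) -> test_function (~` G) phi ->
  \int[leb]_(t in ~` G) (Phi t * phi^`()%classic t) = - \int[leb]_(t in ~` G) (q t * phi t).
Proof.
move=> iPhi mq /test_functionP[dphi [r [[iphi ->] cdphi [r0 phil phir] out _]]].
have cphi := primitive_continuous iphi; have cPhi := primitive_continuous iPhi.
rewrite !Rintegral_offT; last 2 first.
- by apply: measurable_funM => //; exact: continuous_measurable.
- by apply: measurable_funM; exact: continuous_measurable.
rewrite !(Rintegral_supp (s := - r) (x := r)); last 2 first.
- by move=> t /out[-> _]; rewrite mulr0.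
- by move=> t /out[_ ->]; rewrite mulr0.
have rr : - r <= r by lra.
have := increments_eint (primitiveM iPhi iphi) rr.
have l1 : locint leb setT (fun t => q t * phi t).
  have := locint_mull mT (continuous_measurable cphi) (continuous_locbounded cphi) iPhi.1.
  by congr locint; apply/funext => t; rewrite mulrC.
have l2 : locint leb setT (fun t => Phi t * dphi t).
  by apply: continuous_locint => t; apply: cvgM; [exact: cPhi|exact: cdphi].
have -> : (fun t => q t * phi t + Phi t * dphi t) = (fun t => 1 * (q t * phi t) + 1 * (Phi t * dphi t)).
  by apply/funext => t; rewrite !mul1r.
rewrite (eint_linear mT _ _ _ _ l1 l2) phir phil !mulr0 subrr !mul1r => /eqP.
by rewrite addrC addr_eq0 => /eqP.
Qed.

End OffGamma.

Section GraphOfIncrements.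
Context {R : realType}.
Local Notation Borel := (measurableTypeR R).
Local Notation leb := (@lebesgue_measure R).
Variables (G : set R) (mu : {finite_measure set Borel -> \bar R}) (beta : R -> R).
Hypothesis cG : closed G.
Hypothesis nG : leb G = 0%E.
Hypothesis beta_integrable : mu.-integrable (G : set Borel) (EFin \o beta).
Implicit Types (F f g h p q u v w Phi phi psi : R -> R) (s t x a b c r kap : R) (D E : set R).
Let mT := @measurableT _ Borel.
Let mG : measurable (G : set Borel) := closed_measurable cG.
Local Notation nuprim := (nuprim G mu beta).
Local Notation nuint := (nuint G mu beta).
Local Notation real_graph := (real_graph G mu beta).

Lemma Rintegral_open p q s x : ~ G s -> measurable_fun (G : set Borel) (p : Borel -> R) ->
  measurable_fun (G : set Borel) (q : Borel -> R) -> {ae mu, forall t, G t -> p t = q t} ->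
  \int[mu]_(t in `]s, x[ `&` G) p t = eint mu G s x q.
Proof.
move=> nGs mp mq pq; rewrite /eint.
have -> : `]s, x[%classic `&` G = `[s, x[%classic `&` G.
  apply/seteqP; split => t []; rewrite /= !in_itv/= => /andP[st tx] Gt; split => //; apply/andP; split => //.
    exact: ltW.
  by rewrite lt_neqAle st andbT; apply/eqP => st'; apply: nGs; rewrite st'.
rewrite /Rintegral; congr fine; apply: ae_eq_integral.
- exact: measurable_itvE.
- apply/measurable_EFinP; apply: measurable_funS mp => //; exact: subIsetr.
- apply/measurable_EFinP; apply: measurable_funS mq => //; exact: subIsetr.
- by apply: (@filterS _ _ (ae_filter_ringOfSetsType mu) _ _ _ pq) => t h [_ Gt]; rewrite h.
Qed.

(** Since dpsi1/dmu = 0, psi1 agrees off G with a continuous primitive Phi of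
    - v.  Both one-sided limits of psi1 are then values of Phi, and the interface
    condition reads dpsi/dmu = beta Phi. *)
Lemma graph_of_increments u v psi psi1 psi2 f g : L2r setT u -> L2r setT v ->
  measurable_fun (~` G : set Borel) (psi1 : Borel -> R) ->
  measurable_fun (~` G : set Borel) (psi2 : Borel -> R) ->
  measurable_fun (G : set Borel) (f : Borel -> R) -> measurable_fun (G : set Borel) (g : Borel -> R) ->
  {ae leb, forall x, u x = psi x} -> {ae leb, forall x, v x = - psi2 x} ->
  (forall s x, ~ G s -> ~ G x -> s < x ->
    psi x = psi s + \int[leb]_(t in `]s, x[ `\` G) psi1 t + \int[mu]_(t in `]s, x[ `&` G) f t) ->
  (forall s x, ~ G s -> ~ G x -> s < x ->
    psi1 x = psi1 s + \int[leb]_(t in `]s, x[ `\` G) psi2 t + \int[mu]_(t in `]s, x[ `&` G) g t) ->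
  {ae mu, forall x, G x -> g x = 0} ->
  {ae mu, forall x, G x -> f x = beta x *
     (2^-1 * (lim (psi1 @ within (~` G) x^'+) + lim (psi1 @ within (~` G) x^'-)))} ->
  real_graph u v.
Proof.
move=> Lu Lv m1 m2 mf mg upsi vpsi ipsi ipsi1 g0 fE; split => //.
have [a [_ nGa]] := null_gap cG nG (@ltr01 R).
have Lmv := L2rN Lv; have [mmv _] := Lmv.
have [Phi [iPhi Phia]] := primitive_exists a (psi1 a) (L2r_locint Lmv).
have cPhi := primitive_continuous iPhi.
have ev : {ae leb, forall t, ~ G t -> psi2 t = - v t} by apply: lebS vpsi => t -> _; rewrite opprK.
have inc s x : ~ G s -> ~ G x -> s < x -> psi1 x = psi1 s + (Phi x - Phi s).
  move=> nGs nGx sx; rewrite (ipsi1 _ _ nGs nGx sx).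
  rewrite (Rintegral_off cG nG s x m2 mmv ev) (Rintegral_open x nGs mg (measurable_cst (0 : R)) g0).
  rewrite [X in _ + X]Rintegral_cst ?mul0r ?addr0; last exact: measurable_itvE.
  by rewrite /lint (increments_eint iPhi (ltW sx)).
have psi1E x : ~ G x -> psi1 x = Phi x.
  move=> nGx; have [xa|ax|->] := ltgtP x a; last by rewrite Phia.
    by have := inc _ _ nGx nGa xa; rewrite Phia => h; lra.
  by have := inc _ _ nGa nGx ax; rewrite Phia => h; lra.
have fE' : {ae mu, forall t, G t -> f t = Phi t * beta t}.
  apply: (@filterS _ _ (ae_filter_ringOfSetsType mu) _ _ _ fE) => t h Gt.
  rewrite (h Gt) (lim_off_right cG nG t cPhi psi1E) (lim_off_left cG nG t cPhi psi1E).
  by field.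
have mb : measurable_fun (G : set Borel) ((fun t => Phi t * beta t) : Borel -> R).
  apply: measurable_funM; first exact: measurable_funS (continuous_measurable cPhi).
  by case/integrableP : beta_integrable => /measurable_EFinP.
exists (fun x => psi a + nuanti G mu beta a Phi x), Phi.
have np := nuprim_nuanti mG beta_integrable a (psi a) cPhi.
have e1 : {ae leb, forall t, ~ G t -> psi1 t = Phi t} by exact: aeW.
have inc2 s x : ~ G s -> ~ G x -> s < x -> psi x = psi s + nuint s x Phi.
  move=> nGs nGx sx; rewrite (ipsi _ _ nGs nGx sx).
  by rewrite (Rintegral_off cG nG s x m1 (continuous_measurable cPhi) e1)
    (Rintegral_open x nGs mf mb fE') -addrA.
split => //; apply: lebS2 upsi (ae_notin cG nG) => x -> nGx.
have [xa|ax|->] := ltgtP x a; last by rewrite nuantixx addr0.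
  have := inc2 _ _ nGx nGa xa; have := np _ _ (ltW xa).
  by rewrite nuantixx addr0 => h1 h2; apply: (addIr (nuint x a Phi)); rewrite -h2 -h1.
by rewrite (inc2 _ _ nGa nGx ax) (np _ _ (ltW ax)) nuantixx addr0.
Qed.

End GraphOfIncrements.

Local Open Scope complex_scope.

Section ComplexParts.
Context {R : realType}.
Local Notation Borel := (measurableTypeR R).
Local Notation leb := (@lebesgue_measure R).
Implicit Types (u v : R -> R[i]) (D : set R).
Let mT := @measurableT _ Borel.

Lemma L2_parts D u : measurable (D : set Borel) ->
  L2 D u <-> L2r D (re_part u) /\ L2r D (im_part u).
Proof.
move=> mD; split.
  move=> [[mr mi] fin].
  have mr2 : measurable_fun D (fun x : Borel => re_part u x ^+ 2) by exact: measurable_sqr.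
  have mi2 : measurable_fun D (fun x : Borel => im_part u x ^+ 2) by exact: measurable_sqr.
  have isq : leb.-integrable (D : set Borel) (fun x => (sqnorm (u x))%:E).
    apply/integrableP; split.
      by apply/measurable_EFinP; apply: measurable_funD.
    apply: le_lt_trans fin; rewrite /L2norm2.
    rewrite (@eq_integral _ _ _ leb D (fun x => (sqnorm (u x))%:E))// => x _.
    by rewrite gee0_abs// lee_fin addr_ge0// sqr_ge0.
  split; split => //; apply: (le_integrable mD _ _ isq) => //.
  - exact/measurable_EFinP.
  - move=> x _ /=; rewrite lee_fin ger0_norm ?sqr_ge0// ger0_norm ?addr_ge0 ?sqr_ge0//.
    by rewrite /sqnorm lerDl sqr_ge0.
  - exact/measurable_EFinP.
  - move=> x _ /=; rewrite lee_fin ger0_norm ?sqr_ge0// ger0_norm ?addr_ge0 ?sqr_ge0//.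
    by rewrite /sqnorm lerDr sqr_ge0.
move=> [[mr ir] [mi ii]]; split => //.
have := integrableD mD ir ii; case/integrableP => _; apply: le_lt_trans.
rewrite /L2norm2; apply: ge0_le_integral => //.
- by move=> x _; rewrite lee_fin addr_ge0// sqr_ge0.
- by apply/measurable_EFinP; apply: measurable_funD; exact: measurable_sqr.
- by apply/measurable_EFinP; apply: measurableT_comp => //; apply: measurable_funD; exact: measurable_sqr.
- by move=> x _; rewrite /= lee_fin ler_norm.
Qed.

Lemma L2norm2_parts u : L2r setT (re_part u) -> L2r setT (im_part u) ->
  L2norm2 setT u = (\int[leb]_x (re_part u x ^+ 2) + \int[leb]_x (im_part u x ^+ 2))%:E.
Proof.
move=> [mr ir] [mi ii]; rewrite /L2norm2 /Rintegral EFinD !fineK ?integrable_fin_num//.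
by rewrite -integralD.
Qed.

End ComplexParts.

Section GraphParts.
Context {R : realType}.
Local Notation Borel := (measurableTypeR R).
Local Notation leb := (@lebesgue_measure R).
Variables (G : set R) (mu : {finite_measure set Borel -> \bar R}) (beta : R -> R).
Hypothesis cG : closed G.
Hypothesis nG : leb G = 0%E.
Hypothesis beta_integrable : mu.-integrable (G : set Borel) (EFin \o beta).
Variables (A B : R).
Hypothesis AB : A < B.
Hypothesis GAB : forall x, G x -> A < x < B.
Implicit Types (u v : R -> R[i]).
Let mT := @measurableT _ Borel.
Let mG : measurable (G : set Borel) := closed_measurable cG.
Local Notation real_graph := (real_graph G mu beta).

Lemma ReD (x y : R[i]) : complex.Re (x + y) = complex.Re x + complex.Re y.
Proof. by case: x; case: y. Qed.

Lemma ImD (x y : R[i]) : complex.Im (x + y) = complex.Im x + complex.Im y.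
Proof. by case: x; case: y. Qed.

Lemma ReN (x : R[i]) : complex.Re (- x) = - complex.Re x.
Proof. by case: x. Qed.

Lemma ImN (x : R[i]) : complex.Im (- x) = - complex.Im x.
Proof. by case: x. Qed.

Lemma Re_scale (b : R) (x : R[i]) : complex.Re (b%:C * x) = b * complex.Re x.
Proof. by case: x => x y; rewrite /= mul0r subr0. Qed.

Lemma Im_scale (b : R) (x : R[i]) : complex.Im (b%:C * x) = b * complex.Im x.
Proof. by case: x => x y; rewrite /= mul0r addr0. Qed.

Lemma delta_prime_op_parts u v : delta_prime_op G mu beta u v ->
  real_graph (re_part u) (re_part v) /\ real_graph (im_part u) (im_part v).
Proof.
move=> [/(L2_parts _ mT)[Lru Liu] /(L2_parts _ mT)[Lrv Liv]].
move=> [psi [psi1 [psi2 [f [g [[[[Lpsi Lpsi1 Lpsi2] _] [[ifr ifi] [igr igi]] inc inc1] g0 fE upsi vpsi]]]]]].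
have mC : measurable (~` G : set Borel) by exact: measurableC.
have [[m1r _] [m1i _]] := (L2_parts _ mC).1 Lpsi1.
have [[m2r _] [m2i _]] := (L2_parts _ mC).1 Lpsi2.
have mf (h : R -> R) : mu.-integrable (G : set Borel) (EFin \o h) -> measurable_fun (G : set Borel) (h : Borel -> R).
  by case/integrableP => /measurable_EFinP.
split.
- apply: (graph_of_increments cG nG beta_integrable Lru Lrv m1r m2r (mf _ ifr) (mf _ igr)).
  + by apply: lebS upsi => x h; rewrite /re_part h.
  + by apply: lebS vpsi => x h; rewrite /re_part h ReN.
  + by move=> s x nGs nGx sx; have := congr1 (@complex.Re R) (inc _ _ nGs nGx sx); rewrite !ReD.
  + by move=> s x nGs nGx sx; have := congr1 (@complex.Re R) (inc1 _ _ nGs nGx sx); rewrite !ReD.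
  + by apply: (@filterS _ _ (ae_filter_ringOfSetsType mu) _ _ _ g0) => x h /h; rewrite /re_part => ->.
  + apply: (@filterS _ _ (ae_filter_ringOfSetsType mu) _ _ _ fE) => x h /h; rewrite /re_part => ->.
    by rewrite Re_scale /reg_value Re_scale ReD.
- apply: (graph_of_increments cG nG beta_integrable Liu Liv m1i m2i (mf _ ifi) (mf _ igi)).
  + by apply: lebS upsi => x h; rewrite /im_part h.
  + by apply: lebS vpsi => x h; rewrite /im_part h ImN.
  + by move=> s x nGs nGx sx; have := congr1 (@complex.Im R) (inc _ _ nGs nGx sx); rewrite !ImD.
  + by move=> s x nGs nGx sx; have := congr1 (@complex.Im R) (inc1 _ _ nGs nGx sx); rewrite !ImD.
  + by apply: (@filterS _ _ (ae_filter_ringOfSetsType mu) _ _ _ g0) => x h /h; rewrite /im_part => ->.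
  + apply: (@filterS _ _ (ae_filter_ringOfSetsType mu) _ _ _ fE) => x h /h; rewrite /im_part => ->.
    by rewrite Im_scale /reg_value Im_scale ImD.
Qed.

Lemma L2r_sub_set (D : set R) (p : R -> R) : measurable (D : set Borel) -> L2r setT p -> L2r D p.
Proof.
by move=> mD [mp ip]; split; [exact: measurable_funS mp|exact: integrableS ip].
Qed.

Lemma cintegral_scale (m : {measure set Borel -> \bar R}) (D : set R) (z : R -> R[i]) (h : R -> R) :
  cintegral m D (fun x => z x * (h x)%:C) =
  (\int[m]_(x in D) (re_part z x * h x)) +i* (\int[m]_(x in D) (im_part z x * h x)).
Proof.
by congr (_ +i* _); congr Rintegral; apply/funext => x;
  rewrite /re_part /im_part mulrC ?Re_scale ?Im_scale mulrC.
Qed.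

Lemma eq_complexP (x y : R[i]) : complex.Re x = complex.Re y -> complex.Im x = complex.Im y -> x = y.
Proof. by case: x => a b; case: y => c d /= -> ->. Qed.

(** With f = beta Phi, g = 0 and psi2 = - v; the continuity of Phi makes its
    regularised value at a point of G equal to Phi itself. *)
Lemma delta_prime_op_of_parts u v :
  real_graph (re_part u) (re_part v) -> real_graph (im_part u) (im_part v) ->
  delta_prime_op G mu beta u v.
Proof.
move=> [Lru Lrv [psr [Phr [ir nr ur]]]] [Liu Liv [psi_ [Phi_ [ii ni ui]]]].
have mC : measurable (~` G : set Borel) by exact: measurableC.
have [cr ci] := (primitive_continuous ir, primitive_continuous ii).
have mr := nuprim_measurable mG beta_integrable cr nr.
have mi := nuprim_measurable mG beta_integrable ci ni.
have Lr := L2r_ae Lru mr ur; have Li := L2r_ae Liu mi ui.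
have LPr := quasiderivative_L2 mG beta_integrable GAB Lr Lrv ir nr.
have LPi := quasiderivative_L2 mG beta_integrable GAB Li Liv ii ni.
split; [exact/(L2_parts _ mT)|exact/(L2_parts _ mT)|].
pose psi x := psr x +i* psi_ x; pose psi1 x := Phr x +i* Phi_ x.
pose f x := (Phr x * beta x) +i* (Phi_ x * beta x).
have LN : L2r setT (re_part (fun x => - v x)) /\ L2r setT (im_part (fun x => - v x)).
  split; [have := L2rN Lrv|have := L2rN Liv]; congr L2r; apply/funext => x.
    by rewrite /re_part ReN.
  by rewrite /im_part ImN.
have eR : re_part (fun x => - v x) = (fun x => - re_part v x) by apply/funext => x; rewrite /re_part ReN.
have eI : im_part (fun x => - v x) = (fun x => - im_part v x) by apply/funext => x; rewrite /im_part ImN.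
have ifG (h : R -> R) : continuous h -> mu.-integrable (G : set Borel) (EFin \o (fun t => h t * beta t)).
  move=> ch; have := locint_fbeta mG beta_integrable ch A B.
  rewrite (_ : `[A, B[%classic `&` G = G)//; apply/seteqP; split => [t []//|t Gt]; split => //=.
  by rewrite in_itv/=; have /andP[/ltW -> ->] := GAB Gt.
have mcG (h : R -> R) : continuous h -> measurable_fun (G : set Borel) ((fun t => h t * beta t) : Borel -> R).
  by move=> ch; have /integrableP[/measurable_EFinP] := ifG _ ch.
have mcC (h : R -> R) : continuous h -> measurable_fun (~` G : set Borel) (h : Borel -> R).
  by move=> ch; exact: measurable_funS (continuous_measurable ch).
have mC0 (h : R -> R) : L2r setT h -> measurable_fun (~` G : set Borel) ((fun t => - h t) : Borel -> R).
  by move=> Lh; exact: measurable_funS (L2rN Lh).1.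
exists psi, psi1, (fun x => - v x), f, (fun=> 0); split.
- split.
  + split; split.
    * by apply/(L2_parts _ mC); split; exact: L2r_sub_set.
    * by apply/(L2_parts _ mC); split; exact: L2r_sub_set.
    * by apply/(L2_parts _ mC); split; apply: L2r_sub_set => //; case: LN.
    * move=> phi tphi; rewrite !cintegral_scale; apply: eq_complexP => /=.
        exact: (weak_derivative_nuprim cG nG beta_integrable cr nr).
      exact: (weak_derivative_nuprim cG nG beta_integrable ci ni).
    * move=> phi tphi; rewrite !cintegral_scale eR eI; apply: eq_complexP => /=.
        by apply: (weak_derivative_primitive cG nG ir) => //; case: (L2rN Lrv).
      by apply: (weak_derivative_primitive cG nG ii) => //; case: (L2rN Liv).
    * by split; apply: continuous_in_subspaceT => x; rewrite inE => nGx;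
        [exact: (nuprim_continuous_off cG beta_integrable cr nr)|exact: (nuprim_continuous_off cG beta_integrable ci ni)].
    * by split; exact: continuous_within_itv.
  + split; split.
    * exact: ifG cr.
    * exact: ifG ci.
    * exact: integrable0.
    * exact: integrable0.
  + move=> s x nGs nGx sx; apply: eq_complexP; rewrite ?ReD ?ImD /= -addrA.
      by rewrite (Rintegral_off cG nG s x (mcC _ cr) (continuous_measurable cr) (aeW _ (fun _ _ => erefl)))
        (Rintegral_open cG x nGs (mcG _ cr) (mcG _ cr) (aeW _ (fun _ _ => erefl))) (nr _ _ (ltW sx)).
    by rewrite (Rintegral_off cG nG s x (mcC _ ci) (continuous_measurable ci) (aeW _ (fun _ _ => erefl)))
        (Rintegral_open cG x nGs (mcG _ ci) (mcG _ ci) (aeW _ (fun _ _ => erefl))) (ni _ _ (ltW sx)).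
  + have z0 s x : \int[mu]_(t in `]s, x[ `&` G) (0 : R) = 0.
      by rewrite Rintegral_cst ?mul0r//; exact: measurableI.
    move=> s x nGs nGx sx; apply: eq_complexP; rewrite ?ReD ?ImD /= z0 addr0 ?eR ?eI.
      rewrite (Rintegral_off cG nG s x (mC0 _ Lrv) (L2rN Lrv).1 (aeW _ (fun _ _ => erefl))).
      exact: ir.2 (ltW sx).
    rewrite (Rintegral_off cG nG s x (mC0 _ Liv) (L2rN Liv).1 (aeW _ (fun _ _ => erefl))).
    exact: ii.2 (ltW sx).
- exact: aeW.
- apply: aeW => x Gx; apply: eq_complexP.
    rewrite Re_scale /reg_value Re_scale ReD /=.
    by rewrite (lim_off_right cG nG x cr (fun _ _ => erefl)) (lim_off_left cG nG x cr (fun _ _ => erefl)); field.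
  rewrite Im_scale /reg_value Im_scale ImD /=.
  by rewrite (lim_off_right cG nG x ci (fun _ _ => erefl)) (lim_off_left cG nG x ci (fun _ _ => erefl)); field.
- apply: lebS2 ur ui => x; rewrite /psi -[re_part u x]/(complex.Re _) -[im_part u x]/(complex.Im _).
  by case: (u x) => a b /= -> ->.
- by apply: aeW => x; rewrite opprK.
Qed.

End GraphParts.

(** * Self-adjointness and the sequence of eigenvalues *)

Section Enumeration.
Context {R : realType}.
Implicit Types (X : set R) (x y K d : R).

(** Dividing by d and truncating is injective on X. *)
Lemma separated_finite X d K : 0 < d -> (forall x, X x -> 0 < x <= K) ->
  (forall x y, X x -> X y -> x != y -> d <= `|x - y|) -> finite_set X.
Proof.
move=> d0 X0 Xd; pose f x := Num.truncn (x / d).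
have fP x : X x -> (f x)%:R * d <= x < (f x).+1%:R * d.
  move=> /X0/andP[x0 _]; rewrite -ler_pdivlMr// -ltr_pdivrMr//.
  by apply: Num.Theory.truncn_itv; rewrite divr_ge0// ltW.
have inj : {in X &, injective f}.
  move=> x y /[!inE] Xx Xy fxy; apply/eqP/negP => /negP /(Xd _ _ Xx Xy); apply/negP.
  have := fP _ Xx; have := fP _ Xy; rewrite fxy -natr1 mulrDl mul1r => /andP[h1 h2] /andP[h3 h4].
  by rewrite -ltNge ltr_norml; apply/andP; split; lra.
rewrite -(eq_finite_set (inj_card_eq inj)).
apply: (@sub_finite_set _ _ `I_(Num.truncn (K / d)).+1) (finite_II _).
move=> _ [x Xx <-] /=; rewrite ltnS; apply: le_truncn.
by rewrite ler_pM2r ?invr_gt0//; case/andP : (X0 _ Xx).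
Qed.

Lemma enumerate_locally_finite X : (forall K, finite_set [set x | X x /\ x <= K]) ->
  (forall K, exists2 x, X x & K < x) ->
  exists f : nat -> R, [/\ injective f, range f = X & f @ \oo --> +oo].
Proof.
move=> Xfin Xoo.
have cX : countable X.
  have -> : X = \bigcup_(n in [set: nat]) [set x | X x /\ x <= n%:R].
    apply/seteqP; split => [x Xx|x [n _ []//]].
    exists (Num.truncn x).+1 => //; split => //; exact/ltW/truncnS_gt.
  by apply: bigcup_countable => // n _; exact: finite_set_countable.
have iX : infinite_set X.
  move=> /finite_seqP[s sX].
  have [x Xx] := Xoo (\big[Num.max/0]_(y <- s) y); rewrite ltNge => /negP; apply.
  by rewrite le_bigmax_seq//; move: Xx; rewrite sX.
have := eq_card_nat cX iX; rewrite card_eq_sym => /card_set_bijP[f [ffun finj fsurj]].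
have injf : injective f by move=> x y; apply: finj; rewrite inE.
exists f; split => //.
  by apply/seteqP; split => [_ [n _ <-]|x /fsurj[n _ <-]]; [exact: ffun|exists n].
apply/cvgryPgt => K.
have : finite_set (f @^-1` [set x | X x /\ x <= K]).
  by apply: finite_preimage => // x y _ _; exact: injf.
move=> /finite_seqP[s sE].
exists (\max_(i <- s) i).+1 => // n /= sn; rewrite ltNge; apply/negP => fK.
have : n \in s by have : [set` s] n by rewrite -sE; split => //; exact: ffun.
move=> ns; have := @leq_bigmax_seq _ s xpredT id n ns isT; by rewrite leqNgt sn.
Qed.

End Enumeration.

Section Conclusion.
Context {R : realType}.
Local Notation Borel := (measurableTypeR R).
Local Notation leb := (@lebesgue_measure R).
Variables (G : set R) (mu : {finite_measure set Borel -> \bar R}) (beta : R -> R).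
Hypothesis cG : closed G.
Hypothesis nG : leb G = 0%E.
Hypothesis beta_integrable : mu.-integrable (G : set Borel) (EFin \o beta).
Variables (A B : R).
Hypothesis AB : A < B.
Hypothesis GAB : forall x, G x -> A < x < B.
Implicit Types (u v : R -> R[i]) (p q : R -> R).
Let mT := @measurableT _ Borel.
Let mG : measurable (G : set Borel) := closed_measurable cG.
Local Notation real_graph := (real_graph G mu beta).
Local Notation T := (delta_prime_op G mu beta).
Local Notation jost := (jost G mu beta A).
Local Notation mismatch := (mismatch B).

Lemma Rintegral_add p q : leb.-integrable (setT : set Borel) (EFin \o p) ->
  leb.-integrable (setT : set Borel) (EFin \o q) ->
  \int[leb]_t (p t + q t) = \int[leb]_t p t + \int[leb]_t q t.
Proof.
move=> ip iq; have := Rintegral_linear 1 1 ip iq; rewrite !mul1r => <-.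
by congr Rintegral; apply/funext => t; rewrite !mul1r.
Qed.

Lemma L2dot_parts u v : L2 setT u -> L2 setT v -> L2dot u v =
  (\int[leb]_t (re_part u t * re_part v t) + \int[leb]_t (im_part u t * im_part v t)) +i*
  (\int[leb]_t (im_part u t * re_part v t) - \int[leb]_t (re_part u t * im_part v t)).
Proof.
move=> /(L2_parts _ mT)[Lru Liu] /(L2_parts _ mT)[Lrv Liv].
rewrite /L2dot /cintegral; congr (_ +i* _).
  rewrite -(Rintegral_add (L2r_mul Lru Lrv) (L2r_mul Liu Liv)).
  congr Rintegral; apply/funext => t; rewrite /re_part /im_part.
  by case: (u t) (v t) => a b [c d] /=; rewrite mulrN opprK.
have := Rintegral_linear 1 (-1) (L2r_mul Liu Lrv) (L2r_mul Lru Liv); rewrite mul1r mulN1r => <-.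
congr Rintegral; apply/funext => t; rewrite /re_part /im_part mul1r mulN1r.
by case: (u t) (v t) => a b [c d] /=; rewrite mulrN addrC.
Qed.

Lemma real_graph0 : real_graph (fun=> 0) (fun=> 0).
Proof.
have L0 : L2r setT (fun=> 0 : R).
  by apply: (@bounded_supported_L2r _ _ 0 0 0) => // t; rewrite normr0.
split => //; exists (fun=> 0), (fun=> 0); split; [|exact: nuprim_cst|exact: aeW].
by have := @increments_cst _ leb setT mT 0; congr increments; apply/funext => t; rewrite oppr0.
Qed.

Lemma op_real p q : real_graph p q -> T (fun t => (p t)%:C) (fun t => (q t)%:C).
Proof. by move=> pq; apply: (delta_prime_op_of_parts cG nG beta_integrable GAB) => //; exact: real_graph0. Qed.

Lemma op_L2 u v : T u v -> L2 setT u /\ L2 setT v.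
Proof. by case. Qed.

Lemma op_densely_defined : densely_defined T.
Proof.
move=> h /(L2_parts _ mT)[Lr Li] e e0; have e2 : 0 < e / 2 by rewrite divr_gt0.
have [ur [vr [gr dr]]] := real_dense mu beta cG nG Lr e2.
have [ui [vi [gi di]]] := real_dense mu beta cG nG Li e2.
exists (fun t => ur t +i* ui t), (fun t => vr t +i* vi t); split.
  exact: (delta_prime_op_of_parts cG nG beta_integrable GAB).
have er : re_part (fun t => h t - (ur t +i* ui t)) = (fun t => re_part h t - ur t).
  by apply/funext => t; rewrite /re_part ReD.
have ei : im_part (fun t => h t - (ur t +i* ui t)) = (fun t => im_part h t - ui t).
  by apply/funext => t; rewrite /im_part ImD.
have [[Lur _ _] [Lui _ _]] := (gr, gi).
rewrite L2norm2_parts ?er ?ei ?lte_fin; [by lra|exact: L2r_sub|exact: L2r_sub].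
Qed.

Lemma op_symmetric u Tu v Tv : T u Tu -> T v Tv -> L2dot Tu v = L2dot u Tv.
Proof.
move=> Hu Hv; have [Lu LTu] := op_L2 Hu; have [Lv LTv] := op_L2 Hv.
have [ur ui] := delta_prime_op_parts cG nG beta_integrable Hu.
have [vr vi] := delta_prime_op_parts cG nG beta_integrable Hv.
have sym := real_graph_symmetric mG beta_integrable GAB.
by rewrite !L2dot_parts// (sym _ _ _ _ ur vr) (sym _ _ _ _ ui vi) (sym _ _ _ _ ui vr) (sym _ _ _ _ ur vi).
Qed.

(** Real test functions suffice: pairing with them separates the real and the
    imaginary part. *)
Lemma op_adjoint v w : adjoint T v w -> T v w.
Proof.
move=> [Lv Lw adj]; have [Lrv Liv] := (L2_parts _ mT).1 Lv; have [Lrw Liw] := (L2_parts _ mT).1 Lw.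
have test p q : real_graph p q ->
    \int[leb]_t (q t * re_part v t) = \int[leb]_t (p t * re_part w t) /\
    \int[leb]_t (q t * im_part v t) = \int[leb]_t (p t * im_part w t).
  move=> gpq; have Hpq := op_real gpq; have [Lp Lq] := op_L2 Hpq.
  have z0 h : \int[leb]_t ((fun=> 0 : R) t * h t) = 0.
    have -> : (fun t => (fun=> 0 : R) t * h t) = (fun=> 0) by apply/funext => t; rewrite mul0r.
    by rewrite Rintegral_cst// mul0r.
  have := adj _ _ Hpq; rewrite !L2dot_parts// !z0 !addr0 !sub0r => -[-> /oppr_inj ->].
  by [].
apply: (delta_prime_op_of_parts cG nG beta_integrable GAB);
  apply: (real_adjoint mG beta_integrable GAB) => // p q /test[].
  by [].
by move=> _.
Qed.

Lemma op_selfadjoint : selfadjoint T.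
Proof.
split; first exact: op_densely_defined.
move=> v w; split; last exact: op_adjoint.
move=> Hvw; have [Lv Lw] := op_L2 Hvw; split => // u Tu Hu; exact: op_symmetric.
Qed.

(** The numbers kap > 0 for which - kap^2 is an eigenvalue. *)
Definition eigen_kappa : set R := [set kap | 0 < kap /\
  exists psi Phi, jost kap psi Phi /\ mismatch kap psi Phi = 0].

Lemma op_eigenvalueP (l : R) : (l < 0 /\ op_eigenvalue T l%:C) <->
  exists2 kap, eigen_kappa kap & - kap ^+ 2 = l.
Proof.
split.
  move=> [l0 [u [Hu u0]]]; have [gr gi] := delta_prime_op_parts cG nG beta_integrable Hu.
  have kl : - Num.sqrt (- l) ^+ 2 = l by rewrite sqr_sqrtr ?opprK// oppr_ge0 ltW.
  have k0 : 0 < Num.sqrt (- l) by rewrite sqrtr_gt0 oppr_gt0.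
  have er : re_part (fun x => l%:C * u x) = (fun x => - Num.sqrt (- l) ^+ 2 * re_part u x).
    by apply/funext => x; rewrite kl /re_part Re_scale.
  have ei : im_part (fun x => l%:C * u x) = (fun x => - Num.sqrt (- l) ^+ 2 * im_part u x).
    by apply/funext => x; rewrite kl /im_part Im_scale.
  rewrite er in gr; rewrite ei in gi; exists (Num.sqrt (- l)) => //; split => //.
  have [zr|nzr] := pselect {ae leb, forall x, re_part u x = 0}; last first.
    exact: (graph_eigen_jost mG beta_integrable GAB k0 gr nzr).
  apply: (graph_eigen_jost mG beta_integrable GAB k0 gi) => zi; apply: u0.
  by apply: lebS2 zr zi => x; rewrite /re_part /im_part; case: (u x) => a b /= -> ->.
move=> [kap [kap0 [psi [Phi [jp m0]]]] <-]; split; first by rewrite oppr_lt0 exprn_gt0.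
have [gr psi0] := jost_graph mG beta_integrable AB GAB kap0 jp m0.
exists (fun t => (psi t)%:C); split.
  have -> : (fun x => (- kap ^+ 2)%:C * (psi x)%:C) = (fun x => (- kap ^+ 2 * psi x)%:C).
    by apply/funext => x; apply: eq_complexP; rewrite ?Re_scale ?Im_scale//= mulr0.
  exact: op_real.
by move=> z; apply: psi0; apply: lebS z => x /(congr1 (@complex.Re R)).
Qed.

Lemma eigen_kappa_finite K : finite_set [set kap | eigen_kappa kap /\ kap <= K].
Proof.
have [K0|K0] := leP K 0.
  rewrite (_ : [set _ | _] = set0)//; apply/seteqP; split => // kap [[k0 _] kK].
  by have := lt_le_trans k0 (le_trans kK K0); rewrite ltxx.
have [d d0 sep] := mismatch_separated mG beta_integrable AB K0.
apply: (separated_finite d0 (K := K)).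
  by move=> x [[x0 _] xK]; rewrite x0.
move=> x y [[x0 [psi [Phi [j m]]]] xK] [[y0 [psi' [Phi' [j' m']]]] yK] xy.
by apply: (sep _ _ psi Phi psi' Phi') => //; apply/andP.
Qed.

Lemma eigen_kappa_unbounded : negative_on_infinitely_many G mu beta ->
  forall K, exists2 kap, eigen_kappa kap & K < kap.
Proof.
move=> neg K; have K0 : 0 < `|K| + 1 by rewrite ltr_wpDl.
have mz := many_zeros cG nG beta_integrable AB GAB neg.
have [kap [psi [Phi [Kk j m]]]] := mismatch_zero_exists mG beta_integrable AB GAB K0 mz.
exists kap; first by split; [exact: lt_le_trans Kk|exists psi, Phi].
by apply: lt_le_trans Kk; rewrite (le_lt_trans (ler_norm K))// ltrDl.
Qed.

Lemma op_eigenvalues : negative_on_infinitely_many G mu beta -> exists lam : nat -> R,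
  [/\ injective lam, [set l : R | l < 0 /\ op_eigenvalue T l%:C] = range lam & lam @ \oo --> -oo].
Proof.
move=> neg.
have [f [injf rf foo]] := enumerate_locally_finite eigen_kappa_finite (eigen_kappa_unbounded neg).
have f0 n : 0 < f n by have : eigen_kappa (f n) by [rewrite -rf; exists n]; case.
exists (fun n => - f n ^+ 2); split.
- move=> m n /oppr_inj /eqP; rewrite eqrXn2 ?(ltW (f0 _))// => /eqP; exact: injf.
- apply/seteqP; split => [l /op_eigenvalueP[kap]|_ [n _ <-]].
    by rewrite -rf => -[n _ <-] <-; exists n.
  by apply/op_eigenvalueP; exists (f n) => //; rewrite -rf; exists n.
- apply/cvgNry; apply/cvgryPgt => K; move/cvgryPgt : foo => /(_ (`|K| + 1)).
  apply: filterS => n fn; rewrite /= opprK.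
  have h : 1 < f n by apply: le_lt_trans fn; rewrite lerDr.
  apply: (@lt_trans _ _ (f n)); last by rewrite expr2 ltr_pMr.
  by apply: le_lt_trans fn; rewrite (le_trans (ler_norm K))// lerDl.
Qed.

End Conclusion.

Theorem theorem3 (R : realType) (Gamma : set R)
    (mu : {finite_measure set (measurableTypeR R) -> \bar R}) (beta : R -> R)
    (Gamma_closed : closed Gamma) (Gamma_bounded : bounded_set Gamma)
    (Gamma_null : lebesgue_measure Gamma = 0%E)
    (mu_regular : regular_measure mu)
    (mu_support : measure_support mu = Gamma)
    (beta_integrable : mu.-integrable Gamma (EFin \o beta))
    (beta_negative : negative_on_infinitely_many Gamma mu beta) :
  selfadjoint (delta_prime_op Gamma mu beta) /\
  exists lam : nat -> R,
    [/\ injective lam,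
        [set l : R | l < 0 /\
           op_eigenvalue (delta_prime_op Gamma mu beta) l%:C] = range lam &
        lam @ \oo --> -oo].
Proof.
have [M [_ hM]] := Gamma_bounded.
have M0 : 0 < `|M| + 1 by rewrite ltr_wpDl.
have GAB x : Gamma x -> - (`|M| + 2) < x < `|M| + 2.
  move=> /(hM (`|M| + 1)) h; rewrite -ltr_norml; apply: le_lt_trans (h _) _.
    by rewrite (le_lt_trans (ler_norm M))// ltrDl.
  by rewrite ltrD2l ltr1n.
have AB : - (`|M| + 2) < `|M| + 2 by have := normr_ge0 M; lra.
split; first exact: (op_selfadjoint Gamma_closed Gamma_null beta_integrable GAB).
exact: (op_eigenvalues Gamma_closed Gamma_null beta_integrable AB GAB).
Qed.
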